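(* Neither of the sequences $(B_n)$ and $(F_n)$ converges in $L_2(0,\infty)$ as $n\to\infty$.
   Context: $\mu$ is the Möbius function, $\rho(x):=x-[x]$ is the fractional part of $x$, $M(x):=\sum_{k\le x}\mu(k)$ and $g(x):=\sum_{k\le x}\mu(k)/k$. For $n\in\mathbb N$ and $x>0$, $$B_n(x):=\sum_{k=1}^{n}\mu(k)\,\rho\left(\frac{1}{kx}\right)-n\,g(n)\,\rho\left(\frac{1}{nx}\right),$$ $$F_n(x):=\sum_{k=1}^n\left(M\left(\frac{n}{k}\right)-M\left(\frac{n}{k+1}\right)\right)\rho\left(\frac{k}{nx}\right)-\rho\left(\frac{1}{nx}\right).$$ Convergence is in the norm of $L_2(0,\infty)$ with Lebesgue measure. *)

(* Defs.v *)
From HB Require Import structures.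
From mathcomp Require Import all_boot all_order all_algebra.
From mathcomp Require Import all_classical all_reals all_analysis.

Set Implicit Arguments.
Unset Strict Implicit.
Unset Printing Implicit Defensive.
Import Order.TTheory GRing.Theory Num.Theory.
Import numFieldNormedType.Exports.

Local Open Scope classical_set_scope.
Local Open Scope ring_scope.

Definition mobius (n : nat) : int :=
  if (0 < n)%N && all (fun p => logn p n == 1)%N (primes n)
  then (-1) ^+ size (primes n) else 0.

Section Sequences.
Variable R : realType.

Definition rho (x : R) : R := x - (Num.floor x)%:~R.

Definition mertens (x : R) : R :=
  \sum_(1 <= k < (Num.truncn x).+1) (mobius k)%:~R.

Definition gsum (x : R) : R :=
  \sum_(1 <= k < (Num.truncn x).+1) (mobius k)%:~R / k%:R.

(* Only n >= 1 and x > 0 are meaningful in Bapprox and Fapprox: elsewhere the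
   convention 0^-1 = 0 gives values that no norm or limit below sees. *)
Definition Bapprox (n : nat) (x : R) : R :=
  \sum_(1 <= k < n.+1) (mobius k)%:~R * rho (1 / (k%:R * x))
  - n%:R * gsum n%:R * rho (1 / (n%:R * x)).

Definition Fapprox (n : nat) (x : R) : R :=
  \sum_(1 <= k < n.+1)
     (mertens (n%:R / k%:R) - mertens (n%:R / k.+1%:R))
       * rho (k%:R / (n%:R * x))
  - rho (1 / (n%:R * x)).

Lemma measurable_pos_halfline :
  measurable (`]0, +oo[%classic : set (measurableTypeR R)).
Proof. exact: measurable_itv. Qed.

(* Lebesgue measure on (0, +oo), carried by the whole real line: functions on
   (0, +oo) are represented by measurable extensions to R. *)
Definition lebesgue_pos : {measure set (measurableTypeR R) -> \bar R} :=
  mrestr (@lebesgue_measure R) measurable_pos_halfline.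

Definition converges_L2_pos (u : nat -> R -> R) : Prop :=
  exists2 f : R -> R, f \in Lfun lebesgue_pos 2%:E &
    'N[lebesgue_pos]_2%:E [EFin \o (u n \- f)%R]%E @[n --> \oo] --> 0%E.

End Sequences.

(* Main.v *)
(* On (1/(2n), 1/n) both B_n and F_n are step functions whose values are given by
   the Mertens sums M, while B_{2n} and F_{(2n)!} are equal to -1 there.
   If (B_n) or (F_n) were a Cauchy sequence in L_2, comparing the n-th term there
   with the 2n-th, resp. (2n)!-th, would give
     sum_{n <= m < 2n} |M(m)| / m = o(sqrt n).
   This is impossible because zeta has a zero 1/2 + i t on the critical line.
   Let a be 3-periodic with values 1, 1, -2. At such a zero the partial sums
   V_n(q) = sum_{k < n} a_k k^{-1/2} cos(q - t ln k) are O(n^{-1/2}), hence the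
   function Phi(y) = sum_{k <= 1/y} a_k H(k y), where
   H(y) = y^{-1/2} cos(q - t ln y) - cos q, satisfies
   Phi(n/N) - Phi((n+1)/N) = O(1/n). Since sum_{d | n} mu(d) = [n = 1],
     sum_{n <= N} mu(n) Phi(n/N) = H(1/N) - 3 H(3/N),
   which is of order sqrt N for a suitable q, whereas summation by parts bounds the
   left-hand side by O(sum_{n < N} |M(n)| / n).

   The zero is obtained by Hardy's argument. For kap_al(u) = d(u) - sqrt 3 d(u - ln 3),
   d(u) = Re (e^{u/2 + i al/2} sum_k a_k exp(-pi k^2 e^{2u + 2 i al})), the function
   kap_0 is even, by the inversion of the theta series, and its Fourier transform
   Xi vanishes only at such t. Rotating by al multiplies Xi(t) by cosh(t al). If Xi
   had no zero it would have a constant sign, and |kap_al(u)| would be maximal at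
   u = 0; but for al -> pi/4, kap_al(0) stays bounded while the values of kap_al are
   unbounded. *)
From HB Require Import structures.
Require Import Defs.
From mathcomp Require Import all_boot all_order all_algebra.
From mathcomp Require Import all_classical all_reals all_analysis.
From mathcomp Require Import measurable_realfun lebesgue_integral_under ring lra zify.

Set Implicit Arguments.
Unset Strict Implicit.
Unset Printing Implicit Defensive.
Import Order.TTheory GRing.Theory Num.Theory.
Import numFieldNormedType.Exports.

Local Open Scope classical_set_scope.
Local Open Scope ring_scope.

(** * Integrals over the real line *)

Section LineIntegral.
Context {R : realType}.
Notation mu := (@lebesgue_measure R).
Implicit Types (f g F : R -> R).

(** The period 3 is forced by Hardy's argument. With alternating signs the terms [a_k e^{-i pi k^2}]
    would all be equal and the theta series would blow up at [u = 0] as [al] tends to [pi/4],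
    exactly where boundedness is needed. With period 3 the phases cancel at [u = 0], whereas near
    [u = ln 2 / 2] the shifted series has the phases [2 pi k^2 / 9], which are trivial on the
    multiples of 3 and make it large.

    Complex quantities are carried by a real phase [q]: a statement for all [q] is one about real
    and imaginary parts together. Under this encoding a contour shift becomes a differential
    equation in [al], and the gamma factor is kept from vanishing by its recursion, which leads to
    large exponents where its kernel is concentrated.

    In the final deduction the two sequences behave differently. The values of [B_n] contain,
    besides [M(m)], the unknown number [n g(n) - M(n)], which is controlled by comparing overlapping
    windows. For [F_n] the average of the values on its window already determines [M(n)]. *)

Definition intR (f : R -> R) : R := (\int[mu]_u f u)%R.
Definition integrableR (f : R -> R) := mu.-integrable setT (EFin \o f).

Lemma continuous_measurable_EFin f :
  continuous f -> measurable_fun setT (EFin \o f).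
Proof. by move=> cf; apply/measurable_EFinP; exact: continuous_measurable_fun. Qed.

Lemma derive_continuous (F f : R -> R) :
  (forall x : R, is_derive x (1 : R) F (f x)) -> continuous F.
Proof.
move=> dF x; apply: differentiable_continuous; apply/derivable1_diffP.
by have [] := dF x.
Qed.

Lemma cvgry_exp (a : R) : 0 < a -> expR (- (a * u)) @[u --> +oo] --> (0 : R).
Proof.
move=> a0; apply: (@cvg_comp _ _ _ (fun u : R => a * u) (fun x => expR (- x))).
  exact: (gt0_cvgMry a0 cvg_id).
exact: cvgr_expR.
Qed.

Lemma continuous_exp_abs : continuous (fun u : R => expR (- `|u| / 2)).
Proof.
move=> u; apply: continuous_comp; last exact: continuous_expR.
apply: cvgM; last exact: cvg_cst.
by apply: cvgN; exact: norm_continuous.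
Qed.

(** The common majorant of all kernels: the weight [e^{u/2}] decays at this rate at minus infinity,
    and the theta series does better at plus infinity. *)
Lemma integrableR_exp : integrableR (fun u => expR (- `|u| / 2)).
Proof.
have cf := continuous_exp_abs.
apply/integrableP; split; first exact: continuous_measurable_EFin.
under eq_integral do rewrite gee0_abs ?lee_fin ?expR_ge0//.
rewrite ge0_symfun_integralT//; last by move=> u /=; rewrite normrN.
rewrite (_ : [set x | _] = `[0, +oo[%classic); last first.
  by apply/seteqP; split => x/=; rewrite in_itv/= andbT.
have dF (x : R) : is_derive x 1 (fun u : R => -2 * expR (- (2^-1 * u)))
    (expR (- (2^-1 * x))).
  apply: is_derive_eq; rewrite /GRing.scale /=; by field.
rewrite (@ge0_continuous_FTC2y _ _ (fun u => -2 * expR (- (2^-1 * u))) 0 0).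
- rewrite /= mulr0 oppr0 expR0; exact: ltry.
- by move=> x _; exact: expR_ge0.
- exact: continuous_subspaceT.
- rewrite -[X in _ --> X](mulr0 (-2)).
  by apply: cvgM; [exact: cvg_cst|apply: cvgry_exp; lra].
- by move=> x _; have [] := dF x.
- by apply: cvg_at_right_filter; exact: (derive_continuous dF).
- move=> x; rewrite in_itv/= andbT => x0.
  rewrite derive1E; have [_ ->] := dF x.
  by rewrite (ger0_norm (ltW x0)) mulNr mulrC.
Qed.

Lemma integrableR_dom f g : continuous f -> integrableR g ->
  (forall u, `|f u| <= g u) -> integrableR f.
Proof.
move=> cf ig fg; apply: (le_integrable _ _ _ ig) => //=.
  exact: continuous_measurable_EFin.
by move=> x _; rewrite lee_fin (le_trans (fg x))// ler_norm.
Qed.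

Lemma integrableRZ k f : integrableR f -> integrableR (fun u => k * f u).
Proof. by move=> fi; apply: (integrableZl _ k fi). Qed.

Lemma integrableRD f g : integrableR f -> integrableR g ->
  integrableR (fun u => f u + g u).
Proof. by move=> fi gi; apply: (integrableD _ fi gi). Qed.

Lemma integrableR_norm f : integrableR f -> integrableR (fun u => `|f u|).
Proof. by move=> fi; exact: (integrable_abse fi). Qed.

Lemma integrableR_decay C f : continuous f ->
  (forall u, `|f u| <= C * expR (- `|u| / 2)) -> integrableR f.
Proof.
move=> cf; apply: integrableR_dom => //.
by apply: integrableRZ; exact: integrableR_exp.
Qed.

Lemma intRZ k f : integrableR f -> intR (fun u => k * f u) = k * intR f.
Proof. by move=> fi; rewrite /intR RintegralZl. Qed.

Lemma intRD f g : integrableR f -> integrableR g ->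
  intR (fun u => f u + g u) = intR f + intR g.
Proof. by move=> fi gi; rewrite /intR RintegralD. Qed.

Lemma intR_ge0 f : (forall u, 0 <= f u) -> 0 <= intR f.
Proof. by move=> f0; apply: Rintegral_ge0. Qed.

Lemma le_intR f g : integrableR f -> integrableR g -> (forall u, f u <= g u) ->
  intR f <= intR g.
Proof. by move=> fi gi fg; apply: le_Rintegral. Qed.

Lemma intR_norm f : integrableR f -> `|intR f| <= intR (fun u => `|f u|).
Proof. by move=> fi; apply: le_normr_Rintegral. Qed.

Lemma eq_intR f g : f =1 g -> intR f = intR g.
Proof. by move=> fg; rewrite /intR; apply: eq_Rintegral => x _; exact: fg. Qed.

Lemma integrableR_sum (F : nat -> R -> R) m n :
  (forall k, integrableR (F k)) ->
  integrableR (fun u => \sum_(m <= k < n) F k u).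
Proof.
move=> Fi; elim: n => [|n IH].
  rewrite (_ : (fun u => _) = cst 0); first exact: integrable0.
  by apply/funext => u; rewrite big_geq.
have [mn|nm] := leqP m n; last first.
  rewrite (_ : (fun u => _) = cst 0); first exact: integrable0.
  by apply/funext => u; rewrite big_geq.
rewrite (_ : (fun u => _) = (fun u => \sum_(m <= k < n) F k u + F n u)).
  exact: integrableRD.
by apply/funext => u; rewrite big_nat_recr.
Qed.

Lemma intR_sum (F : nat -> R -> R) m n : (forall k, integrableR (F k)) ->
  intR (fun u => \sum_(m <= k < n) F k u) = \sum_(m <= k < n) intR (F k).
Proof.
move=> Fi; elim: n => [|n IH].
  rewrite big_geq// (_ : intR _ = intR (cst 0)).
    by rewrite /intR /Rintegral integral0.
  by apply: eq_intR => u; rewrite big_geq.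
have [mn|nm] := leqP m n; last first.
  rewrite big_geq// (_ : intR _ = intR (cst 0)).
    by rewrite /intR /Rintegral integral0.
  by apply: eq_intR => u; rewrite big_geq.
rewrite big_nat_recr//= -IH -intRD//; last exact: integrableR_sum.
by apply: eq_intR => u; rewrite big_nat_recr.
Qed.

Lemma intR_shift_ge0 (b : R) f : continuous f -> (forall u, 0 <= f u) ->
  (\int[mu]_u (f u)%:E = \int[mu]_u (f (u + b))%:E)%E.
Proof.
move=> cf f0.
have dF (x : R) : is_derive x (1 : R) (fun u : R => u + b) 1.
  by apply: is_derive_eq; rewrite addr0.
have F' : derive1 (fun u : R => u + b) = cst 1.
  by apply/funext => x; rewrite derive1E; have [] := dF x.
rewrite (@increasing_ge0_integration_by_substitutionT _ (fun u => u + b))//.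
- apply: eq_integral => x _; rewrite F' /=.
  by rewrite [X in X%:E](_ : _ = f (x + b) * 1)// mulr1.
- by move=> x y; rewrite ltrD2r.
- by rewrite F'; exact: cst_continuous.
- by rewrite F'; exact: is_cvg_cst.
- by rewrite F'; exact: is_cvg_cst.
- exact: cvg_addrr_Ny.
- exact: cvg_addrr.
Qed.

Lemma continuous_shift (b : R) f : continuous f -> continuous (fun u => f (u + b)).
Proof.
move=> cf u; apply: continuous_comp; last exact: cf.
by apply: cvgD; [exact: cvg_id|exact: cvg_cst].
Qed.

Lemma integrableR_shift (b : R) f : continuous f -> integrableR f ->
  integrableR (fun u => f (u + b)).
Proof.
move=> cf /integrableP[mf fi]; apply/integrableP; split.
  by apply: continuous_measurable_EFin; exact: continuous_shift.
rewrite -(@intR_shift_ge0 b (fun u => `|f u|))//.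
by move=> x; apply: continuous_comp; [exact: cf|exact: norm_continuous].
Qed.

Lemma intR_shift (b : R) f : continuous f -> integrableR f ->
  intR (fun u => f (u + b)) = intR f.
Proof.
move=> cf fi.
have cn : continuous (fun u => `|f u|).
  by move=> x; apply: continuous_comp; [exact: cf|exact: norm_continuous].
have cp : continuous (fun u => f u + `|f u|).
  by move=> x; apply: cvgD; [exact: cf|exact: cn].
(* [g] is the difference of [g + |g|] and [|g|], both nonnegative, to which the substitution for
   nonnegative functions applies. *)
have fE g : integrableR g -> intR g =
    intR (fun u => g u + `|g u|) - intR (fun u => `|g u|).
  move=> gi; rewrite intRD ?addrK//; exact: integrableR_norm.
rewrite [RHS]fE// fE; last exact: integrableR_shift.
rewrite /intR /Rintegral.
rewrite -(@intR_shift_ge0 b (fun u => `|f u|))//.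
rewrite -(@intR_shift_ge0 b (fun u => f u + `|f u|))// => u.
by rewrite -lerBlDl sub0r -normrN ler_norm.
Qed.

Lemma intR_dct (f_ : nat -> R -> R) f g :
  (forall n, continuous (f_ n)) -> continuous f -> integrableR g ->
  (forall n u, `|f_ n u| <= g u) ->
  (forall u, f_ n u @[n --> \oo] --> f u) ->
  intR (f_ n) @[n --> \oo] --> intR f.
Proof.
move=> cf_ cf gi fg ff.
have fi : integrableR f.
  apply: (integrableR_dom cf gi) => u.
  have nf : `|f_ n u| @[n --> \oo] --> `|f u|.
    by apply: cvg_norm; exact: ff.
  rewrite -(cvg_lim _ nf)//; apply: limr_le; first by apply/cvg_ex; exists `|f u|.
  by near=> n; exact: fg.
rewrite /intR /Rintegral; apply: fine_cvg; rewrite fineK; last first.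
  exact: integrable_fin_num.
apply: (@dominated_cvg _ _ _ mu setT measurableT (fun n x => (f_ n x)%:E) (EFin \o f) (EFin \o g)) => //.
- by move=> n; exact: continuous_measurable_EFin.
- by move=> x _; apply: cvg_EFin; [exact: nearW|exact: ff].
- by move=> n x _; rewrite lee_fin.
Unshelve. all: by end_near. Qed.

Lemma intR_lim f : continuous f -> integrableR f ->
  (\int[mu]_(x in `[(- n.+1%:R), n.+1%:R]) f x)%R @[n --> \oo] --> intR f.
Proof.
move=> cf fi.
pose I n : set R := `[- n.+1%:R, n.+1%:R]%classic.
rewrite /intR /Rintegral; apply: fine_cvg; rewrite fineK; last first.
  exact: integrable_fin_num.
under eq_fun do rewrite integral_mkcond.
apply: (@dominated_cvg _ _ _ mu setT measurableT (fun n => (EFin \o f) \_ (I n)) (EFin \o f) (abse \o (EFin \o f))) => //.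
- move=> n; apply/(measurable_restrictT _ _).1; first exact: measurable_itv.
  by apply: (measurable_funS measurableT) => //; exact: continuous_measurable_EFin.
- move=> x _; apply: cvg_near_cst; near=> n.
  rewrite patchE ifT// inE /I /= in_itv /= -ler_norml.
  near: n; exists (Num.truncn `|x|) => // n /= hn.
  by rewrite (le_trans (ltW (truncnS_gt _)))// ler_nat.
- exact: (integrable_abse fi).
- move=> n x _; rewrite patchE; case: ifPn => //=.
  by rewrite normr0 lee_fin.
Unshelve. all: by end_near. Qed.

Lemma intR_opp f : continuous f -> integrableR f -> integrableR (fun u => f (- u)) ->
  intR (fun u => f (- u)) = intR f.
Proof.
move=> cf fi fi'.
have cf' : continuous (fun u : R => f (- u)).
  by move=> u; apply: continuous_comp; [exact: opp_continuous|exact: cf].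
have h1 := intR_lim cf fi; have h2 := intR_lim cf' fi'.
move: h2; rewrite (_ : (fun n => _) = (fun n => (\int[mu]_(x in `[(- n.+1%:R), n.+1%:R]) f x)%R)).
  by move=> h2; exact: (cvg_unique _ h2 h1).
apply/funext => n.
have h : - n.+1%:R <= n.+1%:R :> R by rewrite (@le_trans _ _ 0)// oppr_le0.
rewrite /Rintegral; have := @integration_by_substitution_oppr R f (- n.+1%:R) n.+1%:R h.
rewrite opprK => -> //; exact: continuous_subspaceT.
Qed.

(** The form in which every later integration by parts is used: the decay of [F] removes the
    boundary terms. *)
Lemma intR_derive C F f : (forall x, is_derive x (1:R) F (f x)) ->
  continuous f -> integrableR f ->
  (forall u, `|F u| <= C * expR (- `|u| / 2)) -> intR f = 0.
Proof.
move=> dF cf fi Fb.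
have cF := derive_continuous dF.
pose I n : set R := `[- n.+1%:R, n.+1%:R]%classic.
have FI n : (\int[mu]_(x in I n) f x = F n.+1%:R - F (- n.+1%:R))%R.
  rewrite /Rintegral (@continuous_FTC2 _ f F)//.
  - by rewrite (@lt_trans _ _ 0)// oppr_lt0.
  - exact: continuous_subspaceT.
  - split.
    + by move=> x _; have [] := dF x.
    + by apply: cvg_at_right_filter; exact: cF.
    + by apply: cvg_at_left_filter; exact: cF.
  - by move=> x _; rewrite derive1E; have [] := dF x.
have h1 := intR_lim cf fi.
have h2 : (\int[mu]_(x in I n) f x)%R @[n --> \oo] --> (0:R).
  under eq_fun do rewrite FI.
  apply: norm_cvg0.
  apply: (@squeeze_cvgr _ _ _ _ (cst 0) (fun n => 2 * C * expR (- (2^-1 * n.+1%:R)))).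
  - near=> n; rewrite normr_ge0 /= (le_trans (ler_normB _ _))//.
    have := Fb n.+1%:R; have := Fb (- n.+1%:R).
    rewrite normrN (@ger0_norm _ n.+1%:R)// (_ : - _ / 2 = - (2^-1 * n.+1%:R)); last first.
      by rewrite mulNr mulrC.
    move=> h1' h2'; lra.
  - exact: cvg_cst.
  - rewrite -[X in _ --> X](mulr0 (2 * C)); apply: cvgM; first exact: cvg_cst.
    have hn : (n.+1%:R : R) @[n --> \oo] --> +oo.
      by rewrite (@cvg_shiftS _ (fun n => n%:R : R)); exact: cvgr_idn.
    by apply: (cvg_comp _ _ hn (@cvgry_exp 2^-1 _)); rewrite invr_gt0.
by rewrite -(cvg_lim _ h1)// (cvg_lim _ h2).
Unshelve. all: by end_near. Qed.

End LineIntegral.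

(** * Summation by parts *)

Section AbelSummation.
Context {R : realType}.
Implicit Types (b F G : nat -> R).

(** [G] majorises both the increments and the values of [F], so the telescoped variation and the
    boundary term at the last index add up to [G m], independently of [n]. *)
Lemma abel_summation b F G (B : R) m n : 
  (forall j, `|\sum_(m <= k < j) b k| <= B) ->
  (forall k, (m <= k)%N -> (k.+1 < n)%N -> `|F k - F k.+1| <= G k - G k.+1) ->
  (forall k, (m <= k < n)%N -> `|F k| <= G k) ->
  0 <= G m ->
  `|\sum_(m <= k < n) b k * F k| <= B * G m.
Proof.
move=> bB dF FG Gm0.
have B0 : 0 <= B by rewrite (le_trans _ (bB m))// normr_ge0.
have [nm|mn] := leqP n m; first by rewrite big_geq// normr0 mulr_ge0.
have step j : (m + j < n)%N ->
    `|\sum_(m <= k < (m + j).+1) b k * F k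
      - (\sum_(m <= k < (m + j).+1) b k) * F (m + j)%N| <= B * (G m - G (m + j)%N).
  elim: j => [_|j IH hj].
    by rewrite addn0 !big_nat1 !subrr normr0 mulr0.
  have {}IH := IH (ltac:(lia)).
  rewrite addnS in hj *.
  rewrite (big_nat_recr _ _ _ (_ : m <= (m + j).+1)%N)/=; last by lia.
  rewrite (big_nat_recr _ _ b (_ : m <= (m + j).+1)%N)/=; last by lia.
  set S1 := \sum_(m <= k < _) b k * F k; set S0 := \sum_(m <= k < _) b k.
  rewrite (_ : _ - _ = (S1 - S0 * F (m + j)%N) + S0 * (F (m + j)%N - F (m + j).+1)); last by ring.
  rewrite (_ : B * _ = B * (G m - G (m + j)%N) + B * (G (m + j)%N - G (m + j).+1)); last by ring.
  rewrite (le_trans (ler_normD _ _))// lerD//.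
  rewrite normrM ler_pM//; first exact: bB.
  by apply: dF; lia.
have hn : n = (m + (n - m.+1)).+1 by lia.
have := step (n - m.+1)%N; rewrite -hn => /(_ (ltac:(lia))).
set j := (m + (n - m.+1))%N => h.
rewrite -[X in `|X|](subrK ((\sum_(m <= k < n) b k) * F j)).
rewrite (le_trans (ler_normD _ _))//.
rewrite (_ : B * G m = B * (G m - G j) + B * G j); last by ring.
rewrite lerD// normrM ler_pM//.
by apply: FG; lia.
Qed.

(** Complete windows of length [P] are cut off, each with sum 0, until fewer than [P] terms
    remain. *)
Lemma sum_window_bound b (B : R) P m n : (0 < P)%N -> (forall k, `|b k| <= B) ->
  (forall k, \sum_(i < P) b (k + i)%N = 0) ->
  `|\sum_(m <= k < n) b k| <= P%:R * B.
Proof.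
move=> P0 bB b0.
have B0 : 0 <= B by rewrite (le_trans _ (bB 0)).
elim/ltn_ind : {n}(n - m)%N {-2}m {-2}n (erefl (n - m)%N) => l IH k n nkl.
have [lP|Pl] := ltnP l P.
  rewrite (le_trans (ler_norm_sum _ _ _))//.
  rewrite (le_trans (ler_sum _ (fun i _ => bB i)))//.
  rewrite sumr_const_nat -(mulr_natl B) ler_wpM2r// ler_nat; lia.
rewrite (big_cat_nat _ (n := (k + P)%N))//=; try lia.
have -> : \sum_(k <= i < k + P) b i = 0.
  rewrite -[X in \sum_(X <= _ < _) _]add0n big_addn addKn big_mkord.
  by rewrite -[RHS](b0 k); apply: eq_bigr => i _; rewrite addnC.
rewrite add0r; apply: (IH (l - P)%N); lia.
Qed.

Lemma cauchy_dom (x e : nat -> R) N : e n @[n --> \oo] --> (0 : R) ->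
  (forall m n, (N <= m <= n)%N -> `|x n - x m| <= e m) ->
  cvgn x /\ (forall m, (N <= m)%N -> `|limn x - x m| <= e m).
Proof.
move=> e0 xe.
have cx : cvgn x.
  apply/cauchy_cvgP/cauchy_exP => eps eps0.
  have /cvgrPdist_lt/(_ _ eps0)[M _ hM] := e0.
  exists (x (maxn M N)); exists (maxn M N) => // n /= hn.
  have := hM (maxn M N); rewrite /= leq_maxl => /(_ isT).
  rewrite sub0r normrN => he.
  rewrite /ball /= distrC; apply: (le_lt_trans _ he).
  rewrite (le_trans _ (ler_norm _))//; apply: xe; lia.
split => // m Nm.
have h : `|x n - x m| @[n --> \oo] --> `|limn x - x m|.
  by apply: cvg_norm; apply: cvgB => //; exact: cvg_cst.
rewrite -(cvg_lim _ h)//; apply: limr_le; first by apply/cvg_ex; exists `|limn x - x m|.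
exists m => // n /= mn; apply: xe; lia.
Qed.
End AbelSummation.

(** * Damped sums with 3-periodic coefficients *)

Section CosExp.
Context {R : realType}.

(** Mean value theorem for [g - k f] with [k = 1] and [k = -1]. With a constant [g] it also shows
    that [f] does not vary. *)
Lemma lip_dom (f df g dg : R -> R) (a b : R) : a <= b ->
  (forall x, a <= x <= b -> is_derive x (1 : R) f (df x)) ->
  (forall x, a <= x <= b -> is_derive x (1 : R) g (dg x)) ->
  (forall x, a <= x <= b -> `|df x| <= dg x) ->
  `|f b - f a| <= g b - g a.
Proof.
move=> ab dF dG h.
have key (k : R) : `|k| = 1 -> k * (f b - f a) <= g b - g a.
  move=> k1.
  have dK x : a <= x <= b -> is_derive x (1 : R) (fun y => g y - k * f y) (dg x - k * df x).
    by move=> xab; have := dF x xab; have := dG x xab => ? ?; apply: is_derive_eq.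
  have [||x xab E] := @MVT_segment R (fun y => g y - k * f y) (fun x => dg x - k * df x) a b ab.
  - by move=> x; rewrite in_itv /= => /andP[ax xb]; apply: dK; rewrite !ltW.
  - apply: continuous_in_subspaceT => x; rewrite inE /= in_itv /= => xab.
    by apply: differentiable_continuous; apply/derivable1_diffP; have [] := dK x xab.
  have hx : k * df x <= dg x.
    apply: (le_trans (ler_norm _)); rewrite normrM k1 mul1r; apply: h.
    by move: xab; rewrite in_itv.
  have : 0 <= (dg x - k * df x) * (b - a) by rewrite mulr_ge0// subr_ge0.
  rewrite -E; lra.
rewrite ler_norml; apply/andP; split.
  by have := key (-1); rewrite normrN normr1 => /(_ erefl); lra.
by have := key 1; rewrite normr1 => /(_ erefl); lra.
Qed.

(* The real part of [exp (i p - (c + i d) s)]. *)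
Definition cosexp (c d p s : R) := expR (- (c * s)) * cos (p - d * s).

Lemma cosexp_le (c d p s : R) : `|cosexp c d p s| <= expR (- (c * s)).
Proof.
rewrite normrM ger0_norm ?expR_ge0// ler_piMr ?expR_ge0//; exact: cos_max.
Qed.

Lemma cosexp_lip (c d p L s s' : R) : 0 < c -> 0 <= L -> c ^+ 2 + d ^+ 2 <= L ^+ 2 ->
  s <= s' ->
  `|cosexp c d p s - cosexp c d p s'| <= L / c * (expR (- (c * s)) - expR (- (c * s'))).
Proof.
move=> c0 L0 cdL ss'.
pose df x := expR (- (c * x)) * (d * sin (p - d * x) - c * cos (p - d * x)).
have := @lip_dom (cosexp c d p) df (fun x => - (L / c) * expR (- (c * x))) (fun x => L * expR (- (c * x))) s s' ss'.
rewrite distrC (_ : _ * expR (- (c * s')) - _ = L / c * (expR (- (c * s)) - expR (- (c * s')))); last by ring.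
apply.
- move=> x _; rewrite /cosexp; apply: is_derive_eq.
  by rewrite /df /GRing.scale /=; ring.
- move=> x _; apply: is_derive_eq; rewrite /GRing.scale /=.
  by rewrite mulr1; field; rewrite gt_eqF.
- move=> x _; rewrite /df normrM ger0_norm ?expR_ge0// mulrC ler_wpM2r ?expR_ge0//.
  rewrite -(ler_pXn2r (_ : 0 < 2)%N) ?nnegrE// real_normK ?num_real//.
  apply: (le_trans _ cdL).
  have := cos2Dsin2 (p - d * x).
  set C := cos _; set S := sin _ => CS.
  (* Lagrange's identity [(d S - c C)^2 + (c S + d C)^2 = (c^2 + d^2) (C^2 + S^2)]. *)
  rewrite -subr_ge0 (_ : _ - _ = (c * S + d * C) ^+ 2 + (c ^+ 2 + d ^+ 2) * (1 - (C ^+ 2 + S ^+ 2))); last by ring.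
  by rewrite CS subrr mulr0 addr0 sqr_ge0.
Qed.

(** The variation of the damped oscillation is at most [L / c] times its damping. [L] is left free:
    [L = 1] suits the unit circle but degenerates as [c] tends to 0, where [L = c] and [L = 2 c]
    give bounds uniform in [c]. *)
Lemma cosexp_sum (c d p L B s : R) (b : nat -> R) m n : 0 < c -> c <= L ->
  c ^+ 2 + d ^+ 2 <= L ^+ 2 -> 0 <= s -> 
  (forall j, `|\sum_(m <= k < j) b k| <= B) ->
  `|\sum_(m <= k < n) b k * cosexp c d p (k%:R ^+ 2 * s)|
    <= B * (L / c * expR (- (c * (m%:R ^+ 2 * s)))).
Proof.
move=> c0 cL cdL s0 bB.
have Lc : 1 <= L / c by rewrite ler_pdivlMr// mul1r.
apply: (@abel_summation _ _ _ (fun k => L / c * expR (- (c * (k%:R ^+ 2 * s))))) => //.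
- move=> k _ _; rewrite -mulrBr; apply: cosexp_lip => //.
    by rewrite (le_trans _ cL)// ltW.
  by rewrite ler_wpM2r// ler_pXn2r ?nnegrE// ler_nat.
- move=> k _; apply: (le_trans (cosexp_le _ _ _ _)).
  by rewrite ler_peMl// expR_ge0.
- by rewrite mulr_ge0 ?expR_ge0// (le_trans _ Lc).
Qed.

(* The coefficients of the Dirichlet series of [(1 - 3^(1 - s)) zeta(s)]. *)
Definition a3 (k : nat) : R := if (3 %| k)%N then -2 else 1.

Lemma a3_le k : `|a3 k| <= 2.
Proof. by rewrite /a3; case: ifP => _; rewrite ?normrN ger0_norm//; lra. Qed.

Lemma a3_window k : \sum_(i < 3) a3 (k + i)%N = 0.
Proof.
rewrite !big_ord_recr big_ord0 /= /a3 !addn0 !addn1 !addn2 /=.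
rewrite (_ : (3 %| k.+1) = (k %% 3 == 2))%N; last by lia.
rewrite (_ : (3 %| k.+2) = (k %% 3 == 1))%N; last by lia.
rewrite /dvdn; have : (k %% 3 < 3)%N by rewrite ltn_pmod.
by case: (k %% 3)%N => [|[|[|//]]] _ /=; lra.
Qed.

Lemma a3_sum m n : `|\sum_(m <= k < n) a3 k| <= 6.
Proof.
have := @sum_window_bound R a3 2 3 m n erefl a3_le a3_window.
by rewrite -natrM.
Qed.

End CosExp.

Section ThetaSeries.
Context {R : realType}.
Variables (c d p : R).
Hypotheses (c0 : 0 < c) (c1 : c <= 1) (cd1 : c ^+ 2 + d ^+ 2 = 1).
Implicit Types s : R.

(** Partial sums of the real part of [e^{ip} sum a_k e^{-(c + i d) k^2 s}]. The point [c + i d] of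
    the unit circle will be [e^{2 i al}], and [p] will be [al / 2]. *)
Definition Dsum (n : nat) s := \sum_(1 <= k < n) a3 k * cosexp c d p (k%:R ^+ 2 * s).
Definition Dlim s := limn (fun n => Dsum n s).

Lemma Dsum_diff m n s : 0 <= s -> (1 <= m <= n)%N ->
  `|Dsum n s - Dsum m s| <= 6 / c * expR (- (c * (m%:R ^+ 2 * s))).
Proof.
move=> s0 /andP[m1 mn].
rewrite /Dsum (big_cat_nat m1 mn)/= [X in X - _]addrC addrK.
apply: (le_trans (@cosexp_sum R c d p 1 6 s a3 m n c0 c1 _ s0 _)).
- by rewrite cd1 expr1n.
- by move=> j; exact: a3_sum.
- by rewrite mul1r mulrA.
Qed.

Lemma Dsum_cvg s : 0 < s -> cvgn (fun n => Dsum n s) /\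
  forall m, (1 <= m)%N -> `|Dlim s - Dsum m s| <= 6 / c * expR (- (c * (m%:R ^+ 2 * s))).
Proof.
move=> s0.
apply: (@cauchy_dom R (fun n => Dsum n s) (fun m => 6 / c * expR (- (c * (m%:R ^+ 2 * s))))).
  have cs0 : 0 < c * s by rewrite mulr_gt0.
  rewrite -[X in _ --> X](mulr0 (6 / c)); apply: cvgM; first exact: cvg_cst.
  apply: (@squeeze_cvgr _ _ _ _ (cst 0) (fun m : nat => expR (- (c * s * m%:R)))).
  - near=> n; rewrite expR_ge0 /= ler_expR lerN2.
    rewrite (_ : c * (_ * s) = c * s * n%:R ^+ 2); last by ring.
    rewrite ler_pM2l// -natrX ler_nat; nia.
  - exact: cvg_cst.
  - by apply: (cvg_comp _ _ cvgr_idn (@cvgry_exp _ (c * s) _)).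
by move=> m n mn; apply: Dsum_diff => //; exact: ltW.
Unshelve. all: by end_near. Qed.

End ThetaSeries.

(** * Theta functions in the logarithmic variable *)

Section DFun.
Context {R : realType}.

(** For [u > 0] the inequality [e^{-x} <= 1 / x] at [x = c e^{2u}] gains a factor [e^{-2u}], more
    than the weight loses. *)
Lemma exp_decay (c u : R) : 0 < c ->
  expR (u / 2) * expR (- (c * (pi * expR (2 * u)))) <=
  (1 + c^-1) * expR (- `|u| / 2).
Proof.
move=> c0; have [u0|u0] := leP u 0.
  rewrite (ler0_norm u0) opprK mulrC ler_wpM2r ?expR_ge0//.
  rewrite (@le_trans _ _ 1)//; last by rewrite lerDl invr_ge0 ltW.
  rewrite -expR0 ler_expR oppr_le0 mulr_ge0 ?ltW// mulr_gt0 ?expR_gt0 ?pi_gt0//.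
rewrite (ger0_norm (ltW u0)).
have pi1 : 1 <= (pi : R) by have := pi_ge2 R; lra.
have xe : 0 < c * expR (2 * u) by rewrite mulr_gt0 ?expR_gt0.
have h : expR (- (c * (pi * expR (2 * u)))) <= (c * expR (2 * u))^-1.
  rewrite expRN lef_pV2 ?posrE ?expR_gt0//.
  apply: (@le_trans _ _ (c * (pi * expR (2 * u)))).
    by rewrite ler_pM2l// ler_peMl// expR_ge0.
  apply: le_trans (expR_ge1Dx _); lra.
apply: (le_trans (ler_wpM2l (expR_ge0 _) h)).
rewrite invfM mulrCA -expRN -expRD ler_pM ?invr_ge0 ?(ltW c0) ?expR_ge0//.
  lra.
rewrite ler_expR; lra.
Qed.

Lemma cont_lim (f_ : nat -> R -> R) (f : R -> R) : (forall n, continuous (f_ n)) ->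
  (forall M : R, exists2 e : nat -> R, e n @[n --> \oo] --> (0 : R) &
     forall n u, (1 <= n)%N -> `|u| <= M -> `|f u - f_ n u| <= e n) ->
  continuous f.
Proof.
move=> cf h u; apply/cvgrPdist_lt => eps eps0.
have [e e0 he] := h (`|u| + 1).
have eps3 : 0 < eps / 3 by rewrite divr_gt0.
have /cvgrPdist_lt/(_ _ eps3)[N _ hN] := e0.
pose n := maxn 1 N.
have en : e n < eps / 3.
  have := hN n; rewrite /= leq_maxr => /(_ isT); rewrite sub0r normrN.
  by apply: le_lt_trans; exact: ler_norm.
have /cvgrPdist_lt/(_ _ eps3) hc := cf n u.
near=> v.
have v1 : `|v| <= `|u| + 1.
  have : `|u - v| < 1 by near: v; apply: (@cvgr_dist_lt _ _ _ _ _ id u) => //.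
  have := ler_normD (v - u) u; rewrite subrK distrC; lra.
have h1 : `|f u - f_ n u| <= e n by apply: he => //; rewrite ?leq_maxl// lerDl.
have h2 : `|f v - f_ n v| <= e n by apply: he => //; rewrite leq_maxl.
have h3 : `|f_ n u - f_ n v| < eps / 3 by near: v.
rewrite (_ : f u - f v = (f u - f_ n u) + ((f_ n u - f_ n v) - (f v - f_ n v))); last by ring.
apply: (le_lt_trans (ler_normD _ _)).
have := ler_normB (f_ n u - f_ n v) (f v - f_ n v).
lra.
Unshelve. all: by end_near. Qed.

Lemma cosexp_continuous (c d p : R) : continuous (cosexp c d p).
Proof.
have h x : is_derive x (1 : R) (cosexp c d p) (expR (- (c * x)) * (d * sin (p - d * x) - c * cos (p - d * x))).
  by rewrite /cosexp; apply: is_derive_eq; rewrite /GRing.scale /=; ring.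
exact: (derive_continuous h).
Qed.

(** The substitution [s = pi e^{2u}] with weight [e^{u/2}] turns Mellin transforms on the critical
    line into Fourier transforms, and dilations of [s] by [k^2] into shifts by [ln k]. *)
Definition wt (f : R -> R) (u : R) := expR (u / 2) * f (pi * expR (2 * u)).

Lemma wt_continuous f : continuous f -> continuous (wt f).
Proof.
move=> cf u; apply: cvgM.
  by apply: (@continuous_comp _ _ _ (fun u : R => u / 2) expR);
    [apply: cvgM; [exact: cvg_id|exact: cvg_cst]|exact: continuous_expR].
apply: (@continuous_comp _ _ _ (fun u : R => pi * expR (2 * u)) f); last exact: cf.
apply: cvgM; first exact: cvg_cst.
by apply: (@continuous_comp _ _ _ (fun u : R => 2 * u) expR);
    [apply: cvgM; [exact: cvg_cst|exact: cvg_id]|exact: continuous_expR].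
Qed.

Section Fixed.
Variables (c d p : R).
Hypotheses (c0 : 0 < c) (c1 : c <= 1) (cd1 : c ^+ 2 + d ^+ 2 = 1).

Definition dfun n := wt (Dsum c d p n).
Definition dlim := wt (Dlim c d p).

Lemma Dsum_continuous n : continuous (Dsum c d p n).
Proof.
elim: n => [|n IH].
  rewrite /Dsum (_ : (fun u => _) = cst 0); first exact: cst_continuous.
  by apply/funext => u; rewrite big_geq.
case: n IH => [_|n IH].
  rewrite /Dsum (_ : (fun u => _) = cst 0); first exact: cst_continuous.
  by apply/funext => u; rewrite big_geq.
rewrite (_ : Dsum c d p n.+2 = (fun s => Dsum c d p n.+1 s + a3 n.+1 * cosexp c d p (n.+1%:R ^+ 2 * s))).
  move=> s; apply: cvgD; first exact: IH.
  apply: cvgM; first exact: cvg_cst.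
  apply: (@continuous_comp _ _ _ (fun s : R => n.+1%:R ^+ 2 * s)); last exact: cosexp_continuous.
  by apply: cvgM; [exact: cvg_cst|exact: cvg_id].
by apply/funext => s; rewrite /Dsum big_nat_recr.
Qed.

Lemma spos (u : R) : 0 < pi * expR (2 * u) :> R.
Proof. by rewrite mulr_gt0 ?pi_gt0 ?expR_gt0. Qed.

Let C := 6 / c * (1 + c^-1).

Lemma Dlim_bound s : 0 < s -> `|Dlim c d p s| <= 6 / c * expR (- (c * s)).
Proof.
move=> s0; have [_ /(_ 1%N erefl)] := Dsum_cvg p c0 c1 cd1 s0.
by rewrite /Dsum big_geq// subr0 expr1n mul1r.
Qed.

Lemma Dsum_bound n s : 0 < s -> `|Dsum c d p n s| <= 6 / c * expR (- (c * s)).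
Proof.
move=> s0; case: n => [|n].
  by rewrite /Dsum big_geq// normr0 mulr_ge0 ?expR_ge0// divr_ge0// ltW.
have := @Dsum_diff R c d p c0 c1 cd1 1 n.+1 s (ltW s0) isT.
by rewrite {2}/Dsum big_geq// subr0 expr1n mul1r.
Qed.

Lemma wt_bound f (B : R) : 0 <= B -> (forall s, 0 < s -> `|f s| <= B * expR (- (c * s))) ->
  forall u, `|wt f u| <= B * (1 + c^-1) * expR (- `|u| / 2).
Proof.
move=> B0 fB u; rewrite /wt normrM (ger0_norm (expR_ge0 _)).
apply: (le_trans (ler_wpM2l (expR_ge0 _) (fB _ (spos u)))).
by rewrite mulrCA -mulrA ler_wpM2l//; exact: exp_decay.
Qed.

Let B0 : 0 <= 6 / c :> R.
Proof. by rewrite divr_ge0// ltW. Qed.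

Lemma dlim_bound u : `|dlim u| <= C * expR (- `|u| / 2).
Proof. by apply: wt_bound => // s; exact: Dlim_bound. Qed.

Lemma dfun_bound n u : `|dfun n u| <= C * expR (- `|u| / 2).
Proof. by apply: wt_bound => // s; exact: Dsum_bound. Qed.

Lemma dfun_continuous n : continuous (dfun n).
Proof. by apply: wt_continuous; exact: Dsum_continuous. Qed.

Lemma dlim_diff m u : (1 <= m)%N -> `|dlim u - dfun m u| <=
  6 / c * (expR (u / 2) * expR (- (c * (m%:R ^+ 2 * (pi * expR (2 * u)))))).
Proof.
move=> m1; rewrite /dlim /dfun /wt -mulrBr normrM (ger0_norm (expR_ge0 _)).
have [_ /(_ _ m1) h] := Dsum_cvg p c0 c1 cd1 (spos u).
by rewrite mulrCA ler_wpM2l ?expR_ge0.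
Qed.

Lemma dlim_continuous : continuous dlim.
Proof.
apply: (cont_lim dfun_continuous) => M.
have cs0 : 0 < c * (pi * expR (2 * - M)) by rewrite mulr_gt0// spos.
exists (fun n : nat => 6 / c * (expR (M / 2) * expR (- (c * (pi * expR (2 * - M)) * n%:R)))).
  rewrite -[X in _ --> X](mulr0 (6 / c)); apply: cvgM; first exact: cvg_cst.
  rewrite -[X in _ --> X](mulr0 (expR (M / 2))); apply: cvgM; first exact: cvg_cst.
  by apply: (cvg_comp _ _ cvgr_idn (@cvgry_exp _ _ _)).
move=> n u n1 uM; apply: (le_trans (dlim_diff u n1)).
rewrite ler_wpM2l// ler_pM ?expR_ge0// ler_expR.
  by rewrite ler_wpM2r ?invr_ge0// (le_trans (ler_norm _)).
rewrite lerN2 -mulrA ler_pM2l// mulrC ler_pM ?(ltW (spos _))//.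
  by rewrite -natrX ler_nat; nia.
rewrite ler_wpM2l ?pi_ge0// ler_expR.
have := ler_norm (- u); rewrite normrN; lra.
Qed.

Lemma dfun_cvg u : dfun n u @[n --> \oo] --> dlim u.
Proof.
apply: cvgM; first exact: cvg_cst.
by have [h _] := Dsum_cvg p c0 c1 cd1 (spos u).
Qed.

Lemma dlim_integrable : integrableR dlim.
Proof. by apply: (integrableR_decay dlim_continuous dlim_bound). Qed.

End Fixed.
End DFun.

(** * Rotation of the argument *)

Section Rotation.
Context {R : realType}.
Variables (t q : R).

(** [rot1] and [rot2] are the real and imaginary parts of [e^{i (t u + q)} f(u + i al)] with
    [f(z) = e^{z/2} exp(- pi e^{2z})]. *)
Definition rot1 (al u : R) := wt (fun s => expR (- (cos (2 * al) * s)) *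
  cos (t * u + q + al / 2 - sin (2 * al) * s)) u.
Definition rot2 (al u : R) := wt (fun s => expR (- (cos (2 * al) * s)) *
  sin (t * u + q + al / 2 - sin (2 * al) * s)) u.

Definition drot2 (al u : R) : R :=
  rot2 al u / 2 + expR (u / 2) * (expR (- (cos (2 * al) * (pi * expR (2 * u)))) *
   (- (cos (2 * al)) * (2 * (pi * expR (2 * u))) * sin (t * u + q + al / 2 - sin (2 * al) * (pi * expR (2 * u)))
   + (t - sin (2 * al) * (2 * (pi * expR (2 * u)))) * cos (t * u + q + al / 2 - sin (2 * al) * (pi * expR (2 * u))))).

Lemma rot2_derive al u : is_derive u (1 : R) (rot2 al) (drot2 al u).
Proof.
rewrite /rot2 /wt; apply: is_derive_eq.
rewrite /drot2 /rot2 /wt /GRing.scale /=.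
set x := expR (u / 2); set y := expR (2 * u); set z := expR (- _).
set S := sin (t * u + _ + _ - _); set C := cos (t * u + _ + _ - _). by field.
Qed.

(** The Cauchy-Riemann equations: [F = rot1 + i rot2] satisfies [dF/d al = i dF/du + t F]. *)
Lemma rot1_derive al u : is_derive al (1 : R) (fun al => rot1 al u)
  (t * rot1 al u - drot2 al u).
Proof.
rewrite /rot1 /wt; apply: is_derive_eq.
rewrite /drot2 /rot2 /rot1 /wt /GRing.scale /=.
set x := expR (u / 2); set y := expR (2 * u); set z := expR (- _).
set S := sin (t * u + _ + _ - _); set C := cos (t * u + _ + _ - _). by field.
Qed.

Lemma trig_decay (c A y : R) : 0 < c -> 0 <= y -> 0 <= A ->
  (A + 4 * y) * expR (- (c * y)) <= (A + 8 / c) * expR (- (c / 2 * y)).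
Proof.
move=> c0 y0 A0.
have h : y <= 2 / c * expR (c / 2 * y).
  have := expR_ge1Dx (c / 2 * y) => h.
  have -> : y = 2 / c * (c / 2 * y) by field; rewrite gt_eqF.
  rewrite [X in _ <= _ * expR (c / 2 * X)](_ : _ = y); last by field; rewrite gt_eqF.
  rewrite ler_wpM2l// ?divr_ge0 ?(ltW c0)//; lra.
have -> : expR (- (c * y)) = expR (- (c / 2 * y)) * expR (- (c / 2 * y)).
  by rewrite -expRD; congr expR; field.
rewrite mulrA ler_wpM2r ?expR_ge0// mulrDl lerD//.
  by rewrite ler_piMr// -expR0 ler_expR oppr_le0 mulr_ge0// divr_ge0// ltW.
rewrite expRN ler_pdivrMr ?expR_gt0//.
by rewrite (_ : 8 / c * _ = 4 * (2 / c * expR (c / 2 * y))) ?ler_pM2l//; ring.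
Qed.

(** Uniform in [al] as long as [cos (2 al)] stays above [c]; these are the majorants for
    differentiating under the integral. *)
Lemma rot_bound (c al u : R) : 0 < c -> c <= cos (2 * al) ->
  [/\ `|rot1 al u| <= (1 + c^-1) * expR (- `|u| / 2),
      `|rot2 al u| <= (1 + c^-1) * expR (- `|u| / 2) &
      `|drot2 al u| <= (1 + `|t| + 8 / c) * (1 + (c / 2)^-1) * expR (- `|u| / 2)].
Proof.
move=> c0 cal.
have s0 := spos u; set s := pi * expR (2 * u) in s0.
have hE : expR (- (cos (2 * al) * s)) <= expR (- (c * s)).
  by rewrite ler_expR lerN2 ler_pM2r.
have key (x : R) : `|x| <= 1 ->
    `|expR (u / 2) * (expR (- (cos (2 * al) * s)) * x)| <= (1 + c^-1) * expR (- `|u| / 2).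
  move=> x1; apply: (le_trans _ (exp_decay u c0)).
  rewrite !normrM !(ger0_norm (expR_ge0 _)) ler_wpM2l ?expR_ge0//.
  by rewrite -[leRHS]mulr1 ler_pM ?expR_ge0.
split; [exact: key (cos_max _)|exact: key (sin_max _)|].
rewrite /drot2 /rot2 /wt -/s.
set S := sin _; set C := cos (_ - sin _ * s).
rewrite (_ : _ + _ = expR (u / 2) * (expR (- (cos (2 * al) * s)) *
  (S / 2 + (- cos (2 * al) * (2 * s) * S + (t - sin (2 * al) * (2 * s)) * C)))); last by ring.
set X := _ + (_ + _).
have hX : `|X| <= 1 + `|t| + 4 * s.
  have hS : `|S| <= 1 by exact: sin_max.
  have hC : `|C| <= 1 by exact: cos_max.
  have h1 : `|cos (2 * al) * S| <= 1 by rewrite normrM mulr_ile1 ?cos_max.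
  have h2 : `|sin (2 * al) * C| <= 1 by rewrite normrM mulr_ile1 ?sin_max.
  have h3 : `|t * C| <= `|t| by rewrite normrM ler_piMr.
  rewrite (_ : X = S / 2 + (t * C - 2 * s * (cos (2 * al) * S) - 2 * s * (sin (2 * al) * C))); last by rewrite /X; ring.
  rewrite (le_trans (ler_normD _ _))//.
  have h4 : `|S / 2| <= 1 by rewrite normrM [`|2^-1|]ger0_norm ?invr_ge0//; lra.
  have h5 := ler_normB (t * C - 2 * s * (cos (2 * al) * S)) (2 * s * (sin (2 * al) * C)).
  have h6 := ler_normB (t * C) (2 * s * (cos (2 * al) * S)).
  have h7 : `|2 * s * (cos (2 * al) * S)| <= 2 * s.
    by rewrite normrM (@ger0_norm _ (2 * s)) ?ler_piMr// mulr_ge0// ltW.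
  have h8 : `|2 * s * (sin (2 * al) * C)| <= 2 * s.
    by rewrite normrM (@ger0_norm _ (2 * s)) ?ler_piMr// mulr_ge0// ltW.
  lra.
rewrite !normrM !(ger0_norm (expR_ge0 _)).
have A0 : 0 <= 1 + `|t| by rewrite addr_ge0.
have := trig_decay c0 (ltW s0) A0 => hd.
have c20 : 0 < c / 2 by rewrite divr_gt0.
have := exp_decay u c20; rewrite -/s => he.
apply: (@le_trans _ _ (expR (u / 2) * ((1 + `|t| + 8 / c) * expR (- (c / 2 * s))))).
  rewrite ler_wpM2l ?expR_ge0//; apply: (le_trans _ hd).
  by rewrite mulrC ler_pM ?expR_ge0.
rewrite mulrCA -(mulrA (1 + `|t| + 8 / c)).
apply: ler_wpM2l => //; by rewrite addr_ge0// divr_ge0// ltW.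
Qed.

Lemma rot1_continuous al : continuous (rot1 al).
Proof.
have h u : derivable (rot1 al) u 1 by rewrite /rot1 /wt; apply: ex_derive.
by move=> u; apply: differentiable_continuous; apply/derivable1_diffP; exact: h.
Qed.

Lemma drot2_continuous al : continuous (drot2 al).
Proof.
have h u : derivable (drot2 al) u 1 by rewrite /drot2 /rot2 /wt; apply: ex_derive.
by move=> u; apply: differentiable_continuous; apply/derivable1_diffP; exact: h.
Qed.

Let J al := intR (rot1 al).

(* A contour shift in disguise: [d/d al rot1 - t rot1] is a derivative in [u]. *)
Lemma rot_intR al : 0 <= al < pi / 4 -> J al = expR (t * al) * J 0.
Proof.
move=> /andP[al0 alpi].
(* The open interval from [- a0] to [a0] contains all of [[0, al]], and [cos (2 x)] stays above a
   positive constant on it. *)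
pose a0 := (al + pi / 4) / 2.
have a0E : al < a0 < pi / 4 by rewrite /a0; apply/andP; split; lra.
pose c := cos (2 * a0).
have c0 : 0 < c by apply: cos_gt0_pihalf; apply/andP; split; lra.
have cI x : x \in `]- a0, a0[ -> c <= cos (2 * x).
  rewrite in_itv /= => /andP[x1 x2].
  rewrite -(cos_norm (2 * x)) /c; apply/ltW.
  rewrite ltr_cos ?in_itv /= ?normr_ge0 /=; try lra.
    by rewrite normrM ger0_norm// ltr_pM2l// ltr_norml x1.
  by have := pi_ge0 R; have : `|2 * x| <= 2 * a0; [rewrite normrM ger0_norm// ler_pM2l// ler_norml !ltW|lra].
have bI x (xI : x \in `]- a0, a0[) u := rot_bound u c0 (cI x xI).
have aI : `]- a0, a0[%classic al by rewrite /= in_itv /=; apply/andP; split; lra.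
have Int x : x \in `]- a0, a0[ -> integrableR (rot1 x).
  move=> xI; apply: (@integrableR_decay _ (1 + c^-1)); first exact: rot1_continuous.
  by move=> u; have [] := bI x xI u.
have dJ x : x \in `]- a0, a0[ -> is_derive x (1 : R) J (t * J x).
  move=> xI.
  pose G (u : R) := (`|t| * (1 + c^-1) + (1 + `|t| + 8 / c) * (1 + (c / 2)^-1)) * expR (- `|u| / 2).
  have iG : integrableR G by apply: integrableRZ; exact: integrableR_exp.
  have p1 y u : partial1of2 rot1 y u = t * rot1 y u - drot2 y u.
    by rewrite /partial1of2 derive1E; have [_ ->] := rot1_derive y u.
  have h1 (y u : R) : `]- a0, a0[%classic y -> setT u -> derivable (rot1^~ u) y 1.
    by move=> _ _; have [] := rot1_derive y u.
  have h2 (y u : R) : `]- a0, a0[%classic y -> setT u -> `|partial1of2 rot1 y u| <= G u.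
    move=> yI _; rewrite p1; have [b1 _ b2] := bI y yI u.
    rewrite (le_trans (ler_normB _ _))// /G mulrDl lerD// normrM -mulrA.
    by rewrite ler_wpM2l.
  have G0 u : 0 <= G u by exact: (le_trans (normr_ge0 _) (h2 x u xI I)).
  apply: DeriveDef.
    exact: (@derivable_under_integral R _ _ lebesgue_measure rot1 setT measurableT x (- a0) a0 xI Int h1 G G0 iG h2).
  rewrite -derive1E.
  rewrite (@differentiation_under_integral R _ _ lebesgue_measure rot1 setT measurableT x (- a0) a0 xI Int h1 G G0 iG h2).
  transitivity (intR (fun u => t * rot1 x u + (-1) * drot2 x u)).
    by apply: eq_intR => u; rewrite p1 mulN1r.
  have id2 : integrableR (drot2 x).
    apply: (@integrableR_decay _ ((1 + `|t| + 8 / c) * (1 + (c / 2)^-1))).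
      exact: drot2_continuous.
    by move=> u; have [] := bI x xI u.
  rewrite intRD ?intRZ//; try (by apply: integrableRZ => //; exact: Int); last exact: Int.
  have -> : intR (drot2 x) = 0; last by rewrite mulr0 addr0.
  apply: (@intR_derive _ (1 + c^-1) (rot2 x) (drot2 x)) => //.
  - by move=> u; exact: rot2_derive.
  - exact: drot2_continuous.
  - by move=> u; have [] := bI x xI u.
have sub x : 0 <= x <= al -> x \in `]- a0, a0[.
  by rewrite in_itv /= => /andP[x1 x2]; apply/andP; split; lra.
(* The differential equation [J' = t J] makes [e^{-t x} J x] constant. *)
have key : `|expR (- (t * al)) * J al - expR (- (t * 0)) * J 0| <= 0 - 0.
  apply: (@lip_dom R (fun x => expR (- (t * x)) * J x) (cst 0) (cst 0) (cst 0) 0 al al0).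
  - move=> x xI; have dx := dJ x (sub x xI); apply: is_derive_eq.
    by rewrite /GRing.scale /=; ring.
  - by move=> x _; rewrite /= normr0.
move: key; rewrite /= subrr normr_le0 subr_eq0 mulr0 oppr0 expR0 mul1r => /eqP <-.
by rewrite mulrA -expRD subrr expR0 mul1r.
Qed.

End Rotation.

(** * Fourier transforms with a phase *)

Section Fourier.
Context {R : realType}.
Implicit Types (f : R -> R) (t q : R).

(** The real part of [e^{iq}] times the complex Fourier transform: [q = 0] and [q = pi/2] give its
    real part and minus its imaginary part. *)
Definition FT f t q := intR (fun u => f u * cos (t * u + q)).

Lemma cos_aff_continuous t q : continuous (fun u : R => cos (t * u + q)).
Proof.
move=> u; apply: (@continuous_comp _ _ _ (fun u : R => t * u + q)); last exact: continuous_cos.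
by apply: cvgD; [apply: cvgM; [exact: cvg_cst|exact: cvg_id]|exact: cvg_cst].
Qed.

Lemma FT_continuous f t q : continuous f -> continuous (fun u => f u * cos (t * u + q)).
Proof. by move=> cf u; apply: cvgM; [exact: cf|exact: cos_aff_continuous]. Qed.

Lemma FT_integrable f t q : continuous f -> integrableR f ->
  integrableR (fun u => f u * cos (t * u + q)).
Proof.
move=> cf fi; apply: (integrableR_dom _ (integrableR_norm fi)).
  exact: FT_continuous.
by move=> u; rewrite normrM ler_piMr// cos_max.
Qed.

Lemma FT_shift f b t q : continuous f -> integrableR f ->
  FT (fun u => f (u + b)) t q = FT f t (q - t * b).
Proof.
move=> cf fi; rewrite /FT -[RHS](@intR_shift _ b).
- by apply: eq_intR => u; congr (_ * cos _); ring.
- exact: FT_continuous.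
- exact: FT_integrable.
Qed.

Lemma FTZ f k t q : continuous f -> integrableR f ->
  FT (fun u => k * f u) t q = k * FT f t q.
Proof.
move=> cf fi; rewrite /FT -intRZ; last exact: FT_integrable.
by apply: eq_intR => u; rewrite mulrA.
Qed.

Lemma FTD f g t q : continuous f -> integrableR f -> continuous g -> integrableR g ->
  FT (fun u => f u + g u) t q = FT f t q + FT g t q.
Proof.
move=> cf fi cg gi; rewrite /FT -intRD; try exact: FT_integrable.
by apply: eq_intR => u; rewrite mulrDl.
Qed.

Lemma FT_le f t q : continuous f -> integrableR f ->
  `|FT f t q| <= intR (fun u => `|f u|).
Proof.
move=> cf fi; apply: (le_trans (intR_norm (FT_integrable t q cf fi))).
apply: le_intR.
- by apply: integrableR_norm; exact: FT_integrable.
- exact: integrableR_norm.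
- by move=> u; rewrite normrM ler_piMr// cos_max.
Qed.

Definition gs (c d p : R) := wt (cosexp c d p).

Section gs.
Variables (c d p : R).
Hypothesis (c0 : 0 < c).
Lemma gs_continuous : continuous (gs c d p).
Proof. by apply: wt_continuous; exact: cosexp_continuous. Qed.

Lemma gs_integrable : integrableR (gs c d p).
Proof.
apply: (@integrableR_decay _ (1 * (1 + c^-1))); first exact: gs_continuous.
apply: wt_bound => // s _; rewrite mul1r; exact: cosexp_le.
Qed.

Lemma gs_shift k u : (0 < k)%N ->
  wt (fun s => cosexp c d p (k%:R ^+ 2 * s)) u =
  expR (- (ln k%:R / 2)) * gs c d p (u + ln k%:R).
Proof.
move=> k0; rewrite /gs /wt.
have -> : expR ((u + ln k%:R) / 2) = expR (u / 2) * expR (ln k%:R / 2).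
  by rewrite -expRD; congr expR; ring.
rewrite (_ : expR (- _) * (_ * _ * _) = expR (- (ln k%:R / 2)) * expR (ln k%:R / 2) *
  (expR (u / 2) * cosexp c d p (pi * expR (2 * (u + ln k%:R))))); last by ring.
rewrite -expRD addNr expR0 mul1r; congr (_ * cosexp _ _ _ _).
rewrite mulrDr expRD mulrCA; congr (_ * _); rewrite mulrC.
rewrite (_ : 2 * ln k%:R = ln k%:R + ln k%:R); last by ring.
by rewrite expRD lnK ?posrE ?ltr0n// expr2.
Qed.

(** Each term is a copy of [gs] shifted by [ln k]. The transform of a partial theta sum is thus a
    partial sum of the Dirichlet series at [1/2 + i t], multiplied by the transform of [gs]. *)
Lemma FT_dfun n t q : FT (dfun c d p n) t q =
  \sum_(1 <= k < n) a3 k * expR (- (ln k%:R / 2)) * FT (gs c d p) t (q - t * ln k%:R).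
Proof.
pose F k u := a3 k * expR (- (ln k%:R / 2)) * (gs c d p (u + ln k%:R) * cos (t * u + q)).
have iF k : integrableR (F k).
  apply: integrableRZ; apply: FT_integrable.
    exact: (continuous_shift gs_continuous).
  exact: (integrableR_shift _ gs_continuous gs_integrable).
rewrite /FT; transitivity (intR (fun u => \sum_(1 <= k < n) F k u)).
  apply: eq_intR => u; rewrite /dfun {1}/wt /Dsum mulr_sumr mulr_suml.
  apply: eq_big_nat => k /andP[k1 _].
  have := gs_shift u k1; rewrite {1}/wt => E.
  by rewrite mulrCA E /F !mulrA.
rewrite intR_sum//; apply: eq_bigr => k _.
rewrite /F intRZ.
  by congr (_ * _); exact: (FT_shift _ _ _ gs_continuous gs_integrable).
apply: FT_integrable.
  exact: (continuous_shift gs_continuous).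
exact: (integrableR_shift _ gs_continuous gs_integrable).
Qed.

Lemma FT_dlim t q : c <= 1 -> c ^+ 2 + d ^+ 2 = 1 ->
  FT (dfun c d p n) t q @[n --> \oo] --> FT (dlim c d p) t q.
Proof.
move=> c1 cd1.
apply: (@intR_dct _ _ _ (fun u => 6 / c * (1 + c^-1) * expR (- `|u| / 2))).
- by move=> n; apply: FT_continuous; exact: dfun_continuous.
- by apply: FT_continuous; exact: dlim_continuous.
- by apply: integrableRZ; exact: integrableR_exp.
- move=> n u; rewrite normrM; apply: (le_trans _ (@dfun_bound R c d p c0 c1 cd1 n u)).
  by rewrite ler_piMr// cos_max.
- move=> u; apply: cvgM; last exact: cvg_cst.
  exact: dfun_cvg.
Qed.
End gs.

Definition coshR (x : R) : R := (expR x + expR (- x)) / 2.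

(** A product of two cosines splits into the frequencies [t] and [-t], which the rotation multiplies
    by [e^{t al}] and [e^{-t al}]; at [al = 0] the two halves agree. *)
Lemma FT_gs_rot al t q : 0 <= al < pi / 4 ->
  FT (gs (cos (2 * al)) (sin (2 * al)) (al / 2)) t q =
  coshR (t * al) * FT (gs 1 0 0) t q.
Proof.
move=> hal.
have E b : 0 <= b < pi / 4 -> FT (gs (cos (2 * b)) (sin (2 * b)) (b / 2)) t q =
   2^-1 * intR (rot1 t q b) + 2^-1 * intR (rot1 (- t) (- q) b).
  move=> /andP[b0 bpi].
  have cb : 0 < cos (2 * b) by apply: cos_gt0_pihalf; apply/andP; split; have := pi_gt0 R; lra.
  have i1 t' q' : integrableR (rot1 t' q' b).
    apply: (@integrableR_decay _ (1 + (cos (2 * b))^-1)); first exact: rot1_continuous.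
    by move=> u; have [] := rot_bound t' q' u cb (lexx _).
  rewrite -!intRZ// -intRD; try exact: integrableRZ.
  apply: eq_intR => u; rewrite /gs /rot1 /wt /cosexp.
  set s := pi * _.
  rewrite (_ : t * u + q + b / 2 - sin (2 * b) * s = (b / 2 - sin (2 * b) * s) + (t * u + q)); last by ring.
  rewrite (_ : - t * u - q + b / 2 - sin (2 * b) * s = (b / 2 - sin (2 * b) * s) - (t * u + q)); last by ring.
  move: (b / 2 - _) (t * u + q) => A B.
  by rewrite (cosD A B) (cosB A B); field.
have z : 0 <= (0 : R) < pi / 4 by rewrite lexx divr_gt0 ?pi_gt0.
rewrite E// (rot_intR t q hal) (rot_intR (- t) (- q) hal).
have := E 0 z; rewrite !mulr0 cos0 sin0 mul0r => ->.
have -> : intR (rot1 (- t) (- q) 0) = intR (rot1 t q 0).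
  apply: eq_intR => u; rewrite /rot1 /wt !(mulr0, mul0r, sin0, subr0, addr0).
  by rewrite mulNr -opprD cosN.
by rewrite /coshR mulNr; field.
Qed.

Lemma FT_dlim_rot al t q : 0 <= al < pi / 4 ->
  FT (dlim (cos (2 * al)) (sin (2 * al)) (al / 2)) t q =
  coshR (t * al) * FT (dlim 1 0 0) t q.
Proof.
move=> hal; have /andP[a0 a1] := hal.
have c0 : 0 < cos (2 * al) by apply: cos_gt0_pihalf; apply/andP; split; have := pi_gt0 R; lra.
have h1 := @FT_dlim _ _ (al / 2) c0 t q (cos_le1 _) (cos2Dsin2 _).
have h2 := @FT_dlim 1 0 0 ltr01 t q (lexx _) (ltac:(by rewrite expr1n expr0n addr0)).
have h3 : coshR (t * al) * FT (dfun 1 0 0 n) t q @[n --> \oo] --> coshR (t * al) * FT (dlim 1 0 0) t q.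
  by apply: cvgM; [exact: cvg_cst|exact: h2].
move: h1; rewrite (_ : (fun n => _) = (fun n => coshR (t * al) * FT (dfun 1 0 0 n) t q)).
  by move=> h1; exact: (cvg_unique _ h1 h3).
apply/funext => n; rewrite !FT_dfun// mulr_sumr; apply: eq_bigr => k _.
by rewrite FT_gs_rot//; ring.
Qed.

End Fourier.

(** * Fourier transforms and positivity *)

Section ItvBound.
Context {R : realType}.
Notation mu := (@lebesgue_measure R).

Lemma intR_itv (a b : R) : a <= b ->
  integrableR (\1_(`[a, b] : set R)) /\ intR (\1_(`[a, b] : set R)) = b - a.
Proof.
move=> ab; split; first exact: integrable_indic_itv.
rewrite /intR /Rintegral integral_indic// setIT.
transitivity (fine (if (a < b)%R then (b%:E - a%:E)%E else 0%E)).
  by congr fine; apply: (etrans (lebesgue_measure_itv _)); rewrite /= lte_fin.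
have [//|ba] := ltP a b.
by rewrite (_ : a = b) ?subrr//; apply/eqP; rewrite eq_le ab ba.
Qed.

Lemma intR_ge_itv (a b m : R) (f : R -> R) : a <= b -> integrableR f ->
  (forall u, 0 <= f u) -> (forall u, a <= u <= b -> m <= f u) -> m * (b - a) <= intR f.
Proof.
move=> ab fi f0 fm; have [i1 <-] := intR_itv ab.
rewrite -intRZ//; apply: le_intR => //; first exact: integrableRZ.
move=> u; rewrite indicE; case: (boolP (u \in _)) => [|_]; last by rewrite mulr0.
by rewrite inE /= in_itv /= mulr1; exact: fm.
Qed.
End ItvBound.

Section GaussFT.
Context {R : realType}.
Variable (h : R).
Hypothesis h0 : 0 < h.

Definition gw (t : R) := expR (- (h * t ^+ 2)).

Lemma gw_continuous : continuous gw.
Proof.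
have d t : derivable gw t 1 by rewrite /gw; apply: ex_derive.
by move=> t; apply: differentiable_continuous; apply/derivable1_diffP; exact: d.
Qed.

(** [1 + |t| <= e^{|t|}], and [9 / (16 h)] is the maximum of [3 x / 2 - h x^2]. *)
Lemma gw_bound t : (1 + `|t|) * gw t <= expR (9 / (16 * h)) * expR (- `|t| / 2).
Proof.
rewrite -expRD; apply: (@le_trans _ _ (expR `|t| * gw t)).
  by rewrite ler_wpM2r ?expR_ge0// expR_ge1Dx.
rewrite -expRD ler_expR -(real_normK (num_real t)).
set x := `|t|; rewrite -subr_ge0.
rewrite (_ : _ - _ = h * (x - 3 / (4 * h)) ^+ 2); last by field; rewrite gt_eqF.
by rewrite mulr_ge0 ?sqr_ge0// ltW.
Qed.

Let C := expR (9 / (16 * h)).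

Lemma gw_le t : gw t <= C * expR (- `|t| / 2).
Proof. by apply: (le_trans _ (gw_bound t)); rewrite ler_peMl ?expR_ge0// lerDl. Qed.

Lemma gw_integrable : integrableR gw.
Proof.
apply: (@integrableR_decay _ C); first exact: gw_continuous.
by move=> t; rewrite ger0_norm ?expR_ge0//; exact: gw_le.
Qed.

Definition gK (v : R) := intR (fun t => gw t * cos (t * v)).

Lemma gK_int v : integrableR (fun t => gw t * cos (t * v)).
Proof.
rewrite (_ : (fun _ => _) = (fun t => gw t * cos (v * t + 0))).
  by apply: FT_integrable; [exact: gw_continuous|exact: gw_integrable].
by apply/funext => t; rewrite addr0 [v * t]mulrC.
Qed.

(** The derivative of [gw t * sin (t v)] in [t] integrates to 0, which expresses the integral of
    [t * gw t * sin (t v)] through [gK v]. The resulting equation determines the transform of the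
    Gaussian up to a constant. *)
Lemma gK_derive v : is_derive v (1 : R) gK (- (v / (2 * h)) * gK v).
Proof.
pose f (v t : R) := gw t * cos (t * v).
have vI : `]v - 1, v + 1[%classic v by rewrite /= in_itv /=; apply/andP; split; lra.
have dsin t : is_derive t (1 : R) (fun t => gw t * sin (t * v))
   (-2 * h * (t * gw t * sin (t * v)) + v * (gw t * cos (t * v))).
  by rewrite /gw; apply: is_derive_eq; rewrite /GRing.scale /=; ring.
have df (x t : R) : is_derive x (1 : R) (f ^~ t) (- (t * gw t * sin (t * x))).
  by rewrite /f; apply: is_derive_eq; rewrite /GRing.scale /=; ring.
have h1 (y u : R) : `]v - 1, v + 1[%classic y -> setT u -> derivable (f^~ u) y 1.
  by move=> _ _; have [] := df y u.
have p1 y u : partial1of2 f y u = - (u * gw u * sin (u * y)).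
  by rewrite /partial1of2 derive1E; have [_ ->] := df y u.
have tb (t x : R) : `|x| <= 1 -> `|t * gw t * x| <= C * expR (- `|t| / 2).
  move=> x1; apply: (le_trans _ (gw_bound t)).
  rewrite !normrM (@ger0_norm _ (gw t)) ?expR_ge0// -[leRHS]mulr1 ler_pM ?mulr_ge0 ?expR_ge0//.
  by rewrite ler_wpM2r ?expR_ge0// lerDr.
have h2 (y u : R) : `]v - 1, v + 1[%classic y -> setT u ->
    `|partial1of2 f y u| <= C * expR (- `|u| / 2).
  by move=> _ _; rewrite p1 normrN; apply: tb; exact: sin_max.
have G0 (u : R) : 0 <= C * expR (- `|u| / 2) by rewrite mulr_ge0 ?expR_ge0.
have iG : integrableR (fun u => C * expR (- `|u| / 2)).
  by apply: integrableRZ; exact: integrableR_exp.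
have Int x : `]v - 1, v + 1[%classic x -> integrableR (f x) by move=> _; exact: gK_int.
apply: DeriveDef.
  exact: (@derivable_under_integral R _ _ lebesgue_measure f setT measurableT v (v - 1) (v + 1) vI Int h1 _ G0 iG h2).
rewrite -derive1E.
rewrite (@differentiation_under_integral R _ _ lebesgue_measure f setT measurableT v (v - 1) (v + 1) vI Int h1 _ G0 iG h2).
transitivity (intR (fun t => (-1) * (t * gw t * sin (t * v)))).
  by apply: eq_intR => t; rewrite p1 mulN1r.
have cs : continuous (fun t : R => t * gw t * sin (t * v)).
  have d t : derivable (fun t : R => t * gw t * sin (t * v)) t 1 by rewrite /gw; apply: ex_derive.
  by move=> t; apply: differentiable_continuous; apply/derivable1_diffP; exact: d.
have is_ : integrableR (fun t : R => t * gw t * sin (t * v)).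
  by apply: (@integrableR_decay _ C) => // t; apply: tb; exact: sin_max.
rewrite intRZ//.
have E : intR (fun t => -2 * h * (t * gw t * sin (t * v)) + v * (gw t * cos (t * v))) = 0.
  apply: (@intR_derive R C (fun t => gw t * sin (t * v)) _ dsin).
  - move=> t; apply: cvgD; (apply: cvgM; first exact: cvg_cst); first exact: cs.
    apply: cvgM; first exact: gw_continuous.
    apply: (@continuous_comp _ _ _ (fun t : R => t * v)); last exact: continuous_cos.
    by apply: cvgM; [exact: cvg_id|exact: cvg_cst].
  - by apply: integrableRD; apply: integrableRZ => //; exact: gK_int.
  - move=> t; rewrite normrM ger0_norm ?expR_ge0//; apply: (le_trans _ (gw_le t)).
    by rewrite ler_piMr ?expR_ge0// sin_max.
move: E; rewrite intRD ?intRZ//; try (by apply: integrableRZ => //; exact: gK_int); try exact: gK_int.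
rewrite -/(gK v); set X := intR _ => E.
have -> : X = v * gK v / (2 * h).
  have -> : X = - (-2 * h * X + v * gK v) / (2 * h) + v * gK v / (2 * h) by field; rewrite gt_eqF.
  by rewrite E oppr0 mul0r add0r.
by field; rewrite gt_eqF.
Qed.

Lemma gK_E v : gK v = gK 0 * expR (- (v ^+ 2 / (4 * h))).
Proof.
have d x : is_derive x (1 : R) (fun v => gK v * expR (v ^+ 2 / (4 * h))) 0.
  have dk := gK_derive x; apply: is_derive_eq.
  rewrite /GRing.scale /=; field; by rewrite gt_eqF.
have := @is_derive_0_is_cst R _ v 0 d.
rewrite expr0n mul0r expR0 mulr1 => <-.
by rewrite -mulrA -expRD subrr expR0 mulr1.
Qed.

Lemma gK_pos : 0 < gK 0.
Proof.
have E : gK 0 = intR gw by apply: eq_intR => t; rewrite mulr0 cos0 mulr1.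
rewrite E; apply: (@lt_le_trans _ _ (expR (- h) * (1 - 0))).
  by rewrite subr0 mulr1 expR_gt0.
apply: (intR_ge_itv ler01) => //; first exact: gw_integrable.
  by move=> u; exact: expR_ge0.
move=> u /andP[u0 u1]; rewrite ler_expR lerN2 ler_piMr ?(ltW h0)//.
by rewrite expr_le1.
Qed.

End GaussFT.

Section Positivity.
Context {R : realType}.
Notation mu := (@lebesgue_measure R).

Lemma fubini_FT (h : R) (P : R -> R) : 0 < h -> continuous P -> integrableR P ->
  intR (fun u => P u * gK h u) = intR (fun t => gw h t * FT P t 0).
Proof.
move=> h0 cP iP.
pose f (z : R * R) : R := P z.1 * (gw h z.2 * cos (z.2 * z.1)).
have mf : measurable_fun setT f.
  apply: measurable_funM.
    apply: (measurableT_comp (continuous_measurable_fun cP)); exact: measurable_fst.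
  apply: measurable_funM.
    apply: (measurableT_comp (continuous_measurable_fun (@gw_continuous _ h))); exact: measurable_snd.
  apply: (measurableT_comp (continuous_measurable_fun (@continuous_cos R))).
  by apply: measurable_funM; [exact: measurable_snd|exact: measurable_fst].
have mEf : measurable_fun setT (EFin \o f) by apply/measurable_EFinP.
have fi1 u : integrableR (fun t => f (u, t)).
  exact: (@integrableRZ _ (P u) _ (gK_int h0 u)).
have fi2 t : integrableR (fun u => f (u, t)).
  rewrite (_ : (fun u => _) = (fun u => gw h t * (P u * cos (t * u + 0)))).
    by apply: integrableRZ; exact: FT_integrable.
  by apply/funext => u; rewrite /f /= addr0 mulrCA.
have imf : (mu \x mu)%E.-integrable setT (EFin \o f).
  apply: (proj2 (@integrable12ltyP _ _ _ _ R mu mu _ mEf)).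
  apply: (@le_lt_trans _ _ (\int[mu]_u (`|P u| * intR (gw h))%:E)%E).
    apply: ge0_le_integral => //.
    - by move=> u _; apply: integral_ge0.
    - apply: (@measurable_fun_fubini_tonelli_F _ _ _ _ _ mu (abse \o (EFin \o f))).
        exact: measurableT_comp.
      by move=> z; exact: abse_ge0.
    - apply/measurable_EFinP; apply: measurable_funM => //.
      by apply: measurableT_comp => //; exact: continuous_measurable_fun.
    - move=> u _.
      rewrite -intRZ; last exact: gw_integrable.
      rewrite /intR /Rintegral fineK; last first.
        by apply: integrable_fin_num => //; apply: integrableRZ; exact: gw_integrable.
      apply: ge0_le_integral => //.
      + by apply: measurableT_comp => //; have /integrableP[] := fi1 u.
      + by apply/measurable_EFinP; apply: measurable_funM => //; apply: continuous_measurable_fun; exact: gw_continuous.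
      + move=> t _; rewrite lee_fin /f /= normrM ler_wpM2l// normrM ger0_norm ?expR_ge0//.
        by rewrite ler_piMr ?expR_ge0// cos_max.
  have i2 : integrableR (fun u => intR (gw h) * `|P u|) by apply: integrableRZ; exact: integrableR_norm.
  have /integrableP[_] := i2.
  apply: le_lt_trans; apply: ge0_le_integral => //.
  - by move=> u _; rewrite lee_fin mulr_ge0//; apply: intR_ge0 => t; exact: expR_ge0.
  - apply/measurable_EFinP; apply: measurable_funM => //.
    by apply: measurableT_comp => //; exact: continuous_measurable_fun.
  - by apply: measurableT_comp => //; have /integrableP[] := i2.
  - by move=> u _ /=; rewrite lee_fin mulrC ler_norm.
have := Fubini imf.
have E1 : (\int[mu]_u \int[mu]_t (EFin \o f) (u, t) = \int[mu]_u (P u * gK h u)%:E)%E.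
  apply: eq_integral => u _; rewrite /gK -intRZ; last exact: gK_int.
  by rewrite /intR /Rintegral fineK//; apply: integrable_fin_num => //; exact: fi1.
have E2 : (\int[mu]_t \int[mu]_u (EFin \o f) (u, t) = \int[mu]_t (gw h t * FT P t 0)%:E)%E.
  apply: eq_integral => t _; rewrite /FT -intRZ; last exact: FT_integrable.
  rewrite (_ : intR _ = intR (fun u => f (u, t))).
    by rewrite /intR /Rintegral fineK//; apply: integrable_fin_num => //; exact: fi2.
  by apply: eq_intR => u; rewrite /f /= addr0 mulrCA.
by rewrite E1 E2 /intR /Rintegral => ->.
Qed.

(* Integrating [P] against a narrow Gaussian, whose Fourier transform is positive. *)
Lemma fourier_pos (P : R -> R) : continuous P -> integrableR P ->
  (forall t, 0 <= FT P t 0) -> 0 <= P 0.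
Proof.
move=> cP iP Pt; rewrite leNgt; apply/negP => P0.
have [e eE] : {e | e = - P 0 / 2} by exists (- P 0 / 2).
have e0 : 0 < e by rewrite eE; lra.
have /cvgrPdist_lt/(_ _ e0)[d /= d0 hd] := cP 0.
have Pd u : `|u| < d -> P u <= - e.
  move=> ud; have := hd u; rewrite /= sub0r normrN => /(_ ud).
  by rewrite eE ltr_norml => /andP[h1 h2]; lra.
pose N := intR (fun u => `|P u|).
have N0 : 0 <= N by apply: intR_ge0.
(* With [y = 3 d^2 / (16 h)] this choice gives [e^{-y} N <= N / y = e d N / (N + 1) < e d], the
   contradiction reached at the end. *)
have [h hE] : {h | h = 3 * e * d ^+ 3 / (16 * (N + 1))} by exists (3 * e * d ^+ 3 / (16 * (N + 1))).
have h0 : 0 < h by rewrite hE divr_gt0 ?mulr_gt0 ?exprn_gt0//; lra.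
pose g u := expR (- (u ^+ 2 / (4 * h))).
have cg : continuous g.
  have dg (u : R) : derivable g u 1 by rewrite /g; apply: ex_derive.
  by move=> u; apply: differentiable_continuous; apply/derivable1_diffP; exact: dg.
have ig : integrableR (fun u => P u * g u).
  apply: (integrableR_dom _ (integrableR_norm iP)).
    by move=> u; apply: cvgM; [exact: cP|exact: cg].
  move=> u; rewrite normrM ler_piMr// ger0_norm ?expR_ge0// -expR0 ler_expR oppr_le0.
  by rewrite divr_ge0 ?sqr_ge0// mulr_ge0// ltW.
have Pg : 0 <= intR (fun u => P u * g u).
  rewrite -(pmulr_rge0 _ (gK_pos h0)) -intRZ//.
  rewrite (_ : intR _ = intR (fun u => P u * gK h u)).
    rewrite fubini_FT//; apply: intR_ge0 => t; by rewrite mulr_ge0 ?expR_ge0.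
  by apply: eq_intR => u; rewrite (gK_E h0 u) mulrCA.
have dd : - (d / 2) <= d / 2 by lra.
have [iI IE] := intR_itv dd.
(* The values of the Gaussian at [d/2] and [d]. The part [|u| <= d/2] contributes at most
   [- e k1 d], the rest of [|u| < d] is not positive, and the part beyond [d] contributes at most
   [k2 N]. *)
pose k1 := expR (- (d ^+ 2 / (16 * h))); pose k2 := expR (- (d ^+ 2 / (4 * h))).
have : intR (fun u => P u * g u) <= intR (fun u => - (e * k1) * \1_(`[- (d / 2), d / 2] : set R) u + k2 * `|P u|).
  apply: le_intR => //.
    by apply: integrableRD; apply: integrableRZ => //; exact: integrableR_norm.
  move=> u; rewrite indicE; case: (boolP (u \in _)) => [|_].
    rewrite inE /= in_itv /= mulr1 => /andP[u1 u2].
    have ud : `|u| <= d / 2 by rewrite ler_norml u1.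
    have Pu : P u <= - e by apply: Pd; lra.
    apply: (@le_trans _ _ (- (e * k1))); last by rewrite lerDl mulr_ge0 ?expR_ge0.
    rewrite -mulNr; apply: (@le_trans _ _ (- e * g u)); first by rewrite ler_wpM2r// expR_ge0.
    rewrite ler_wnM2l ?oppr_le0 ?(ltW e0)// ler_expR lerN2.
    have -> : d ^+ 2 / (16 * h) = (d / 2) ^+ 2 / (4 * h) by field; rewrite gt_eqF.
    rewrite ler_wpM2r ?invr_ge0 ?mulr_ge0 ?(ltW h0)//.
    by rewrite -(real_normK (num_real u)) ler_pXn2r ?nnegrE// divr_ge0// ltW.
  rewrite mulr0 add0r.
  have [ud|du] := ltP `|u| d.
    have := Pd u ud => Pu.
    apply: (@le_trans _ _ 0); last by rewrite mulr_ge0 ?expR_ge0.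
    by rewrite mulr_le0_ge0 ?expR_ge0//; lra.
  rewrite mulrC; apply: (@le_trans _ _ (g u * `|P u|)).
    by rewrite ler_wpM2l ?expR_ge0// ler_norm.
  rewrite ler_wpM2r// ler_expR lerN2 ler_wpM2r ?invr_ge0 ?mulr_ge0 ?(ltW h0)//.
  by rewrite -(real_normK (num_real u)) ler_pXn2r ?nnegrE// ltW.
rewrite intRD; try (by apply: integrableRZ => //; exact: integrableR_norm).
rewrite !intRZ// ?IE; last exact: integrableR_norm.
rewrite -/N => hh.
have : e * d * k1 <= k2 * N by lra.
have -> : k2 = k1 * expR (- (3 * d ^+ 2 / (16 * h))).
  by rewrite /k1 /k2 -expRD; congr expR; field; rewrite gt_eqF.
rewrite mulrC -mulrA ler_pM2l ?expR_gt0//.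
apply/negP; rewrite -ltNge.
have y0 : 0 < 3 * d ^+ 2 / (16 * h) by rewrite divr_gt0 ?mulr_gt0 ?exprn_gt0.
apply: (@le_lt_trans _ _ ((3 * d ^+ 2 / (16 * h))^-1 * N)).
  rewrite ler_wpM2r// expRN lef_pV2 ?posrE ?expR_gt0//.
  apply: le_trans (expR_ge1Dx _); lra.
rewrite (_ : _^-1 * N = e * d * (N / (N + 1))); last first.
  rewrite hE; field; do ?[apply/andP; split]; rewrite gt_eqF//; lra.
rewrite gtr_pMr ?mulr_gt0// ltr_pdivrMr; lra.
Qed.

End Positivity.

(** * A zero on the critical line *)

Section Kap.
Context {R : realType}.
Implicit Types (al t q u : R).

Let cc al : R := cos (2 * al).
Let ss al : R := sin (2 * al).

Lemma cc_gt0 al : 0 <= al < pi / 4 -> 0 < cc al.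
Proof. by move=> /andP[a0 a1]; apply: cos_gt0_pihalf; apply/andP; split; have := pi_gt0 R; lra. Qed.

Definition dal al : R -> R := dlim (cc al) (ss al) (al / 2).

(* Corresponds to the factor [(1 - 3^(1 - s)) (1 - 3^s)], which is symmetric under
   [s -> 1 - s]. *)
Definition kap al u : R := dal al u + (- expR (ln 3 / 2)) * dal al (u + (- ln 3)).

Section Fix.
Variable al : R.
Hypothesis hal : 0 <= al < pi / 4.
Let c0 := cc_gt0 hal.
Let c1 : cc al <= 1 := cos_le1 _.
Let cd1 : cc al ^+ 2 + ss al ^+ 2 = 1 := cos2Dsin2 _.

Lemma dal_continuous : continuous (dal al).
Proof. exact: dlim_continuous. Qed.

Lemma dal_integrable : integrableR (dal al).
Proof. exact: dlim_integrable. Qed.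

Lemma kap_continuous : continuous (kap al).
Proof.
move=> u; apply: cvgD; first exact: dal_continuous.
apply: cvgM; first exact: cvg_cst.
exact: (continuous_shift dal_continuous).
Qed.

Lemma kap_integrable : integrableR (kap al).
Proof.
apply: integrableRD; first exact: dal_integrable.
apply: integrableRZ; apply: integrableR_shift; [exact: dal_continuous|exact: dal_integrable].
Qed.

Lemma FT_kap_dal t q : FT (kap al) t q = FT (dal al) t q - expR (ln 3 / 2) * FT (dal al) t (q + t * ln 3).
Proof.
have cs := continuous_shift dal_continuous.
have is_ := integrableR_shift (- ln 3) dal_continuous dal_integrable.
have cz : continuous (fun u => - expR (ln 3 / 2) * dal al (u + - ln 3)).
  by move=> u; apply: cvgM; [exact: cvg_cst|exact: cs].
rewrite /kap FTD; [|exact: dal_continuous|exact: dal_integrable|exact: cz|exact: integrableRZ].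
rewrite FTZ; [|exact: cs|exact: is_].
rewrite FT_shift; [|exact: dal_continuous|exact: dal_integrable].
by rewrite mulrN opprK mulNr.
Qed.

(** The coefficient [sqrt 3] compensates the weight lost in the shift by [ln 3], so a plain
    difference of theta values at [s] and [s / 9] remains. *)
Lemma kapE u : kap al u = expR (u / 2) * (Dlim (cc al) (ss al) (al / 2) (pi * expR (2 * u))
   - Dlim (cc al) (ss al) (al / 2) (pi * expR (2 * u) / 9)).
Proof.
rewrite /kap /dal /dlim /wt [RHS]mulrBr; congr (_ + _).
rewrite mulNr mulrA -expRD; congr (- (expR _ * Dlim _ _ _ _)); first by ring.
rewrite -mulrA; congr (_ * _).
rewrite mulrDr expRD; congr (_ * _).
rewrite (_ : 2 * - ln 3 = - (ln 3 + ln 3)); last by ring.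
by rewrite expRN expRD lnK ?posrE//; congr (_^-1); rewrite -natrM.
Qed.

End Fix.

Lemma hal0 : 0 <= (0 : R) < pi / 4.
Proof. by rewrite lexx divr_gt0 ?pi_gt0. Qed.

Lemma dal0 : dal 0 = dlim 1 0 0.
Proof. by rewrite /dal /cc /ss mulr0 cos0 sin0 mul0r. Qed.

Lemma FT_kap_rot al t q : 0 <= al < pi / 4 -> FT (kap al) t q = coshR (t * al) * FT (kap 0) t q.
Proof.
move=> hal; rewrite !FT_kap_dal//; last exact: hal0.
by rewrite dal0 /dal !(FT_dlim_rot _ _ hal); ring.
Qed.

Section Hardy.
Hypothesis kap_even : forall u, kap 0 (- u) = kap 0 u.

Definition Xi t := FT (kap 0) t 0.

Let ck0 : continuous (kap 0). Proof. exact: (kap_continuous hal0). Qed.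
Let ik0 : integrableR (kap 0). Proof. exact: (kap_integrable hal0). Qed.

(** The transform of an even function is real, so the phase only contributes a factor. *)
Lemma FT_kap0 t q : FT (kap 0) t q = cos q * Xi t.
Proof.
have E : FT (kap 0) t (- q) = FT (kap 0) t q.
  rewrite /FT -[RHS](@intR_opp _ (fun u => kap 0 u * cos (t * u + q))).
  - by apply: eq_intR => u; rewrite kap_even -[in RHS]cosN; congr (_ * cos _); ring.
  - exact: FT_continuous.
  - exact: FT_integrable.
  - rewrite (_ : (fun u => _) = (fun u => kap 0 u * cos (t * u + (- q)))).
      exact: FT_integrable.
    by apply/funext => u; rewrite kap_even -[in LHS]cosN; congr (_ * cos _); ring.
have : FT (kap 0) t q + FT (kap 0) t (- q) = 2 * cos q * Xi t.
  rewrite /Xi /FT -intRD; try exact: FT_integrable.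
  rewrite -intRZ; last exact: FT_integrable.
  apply: eq_intR => u; rewrite addr0 (cosD (t * u) q) (cosB (t * u) q); ring.
rewrite E; lra.
Qed.

Lemma Xi_continuous : continuous Xi.
Proof.
move=> t.
have := @continuity_under_integral R _ _ (@lebesgue_measure R)
  (fun t u => kap 0 u * cos (t * u + 0)) setT measurableT (t - 1) (t + 1).
have h1 (x : R) : `]t - 1, t + 1[%classic x -> integrableR (fun u => kap 0 u * cos (x * u + 0)).
  by move=> _; exact: FT_integrable.
have h2 : {ae (@lebesgue_measure R), forall y, setT y -> {in `]t - 1, t + 1[%classic, continuous (fun t => kap 0 y * cos (t * y + 0))}}.
  apply: aeW => y _ x _; apply: cvgM; first exact: cvg_cst.
  apply: (@continuous_comp _ _ _ (fun x : R => x * y + 0)); last exact: continuous_cos.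
  by apply: cvgD; [apply: cvgM; [exact: cvg_id|exact: cvg_cst]|exact: cvg_cst].
have h3 : integrableR (fun u => `|kap 0 u|) by exact: integrableR_norm.
have h4 (x : R) : `]t - 1, t + 1[%classic x -> {ae (@lebesgue_measure R), forall y, setT y -> `|kap 0 y * cos (x * y + 0)| <= `|kap 0 y|}.
  by move=> _; apply: aeW => y _; rewrite normrM ler_piMr// cos_max.
move=> /(_ h1 h2 _ h3 h4 t); apply.
by rewrite inE /= in_itv /=; apply/andP; split; lra.
Qed.

Lemma Xi_sign : (forall t, Xi t != 0) -> (forall t, 0 <= Xi t) \/ (forall t, Xi t <= 0).
Proof.
move=> Xn0.
have key x y : Xi x < 0 -> 0 < Xi y -> False.
  move=> x0 y0.
  have h a b : a <= b -> Num.min (Xi a) (Xi b) <= 0 <= Num.max (Xi a) (Xi b) -> False.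
    move=> ab /(IVT ab)[|z _ /eqP]; first by apply: continuous_subspaceT; exact: Xi_continuous.
    by apply/negP.
  have [xy|yx] := leP x y.
    by apply: (h x y xy); rewrite ge_min le_max (ltW x0) (ltW y0) orbT.
  by apply: (h y x (ltW yx)); rewrite ge_min le_max (ltW x0) (ltW y0) orbT.
have [[x x0]|n] := pselect (exists x, Xi x < 0).
  by right => t; rewrite leNgt; apply/negP => t0; exact: (key x t).
by left => t; rewrite leNgt; apply/negP => t0; apply: n; exists t.
Qed.

Lemma coshR_ge0 (x : R) : 0 <= coshR x.
Proof. by rewrite divr_ge0// addr_ge0 ?expR_ge0. Qed.

(** Up to a constant sign, the transform of [kap u + e kap (u + u0)] with [e = 1] or [e = -1] is
    [cosh (t al) Xi(t) (1 + e cos (t u0))], which is nonnegative; positivity at the origin for both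
    signs bounds [kap] at [u0]. *)
Lemma kap_max al u0 : (forall t, Xi t != 0) -> 0 <= al < pi / 4 ->
  `|kap al u0| <= `|kap al 0|.
Proof.
move=> /Xi_sign Xs hal.
have [s [s1 sX]] : exists s : R, (s = 1 \/ s = -1) /\ forall t, 0 <= s * Xi t.
  case: Xs => h; [exists 1|exists (-1)]; split; [by left| |by right|] => t;
  have := h t; lra.
have ck := kap_continuous hal; have ik := kap_integrable hal.
have key (e : R) : (e = 1 \/ e = -1) -> 0 <= s * (kap al 0 + e * kap al u0).
  move=> e1.
  pose P u := s * (kap al u + e * kap al (u + u0)).
  have cs := @continuous_shift R u0 _ ck.
  have is_ := integrableR_shift u0 ck ik.
  have ces : continuous (fun u => e * kap al (u + u0)).
    by move=> u; apply: cvgM; [exact: cvg_cst|exact: cs].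
  have ies : integrableR (fun u => e * kap al (u + u0)) by exact: integrableRZ.
  have cP : continuous P.
    by move=> u; apply: cvgM; [exact: cvg_cst|apply: cvgD; [exact: ck|exact: ces]].
  have iP : integrableR P by apply: integrableRZ; exact: integrableRD.
  rewrite -[u0]add0r -/(P 0); apply: fourier_pos => // t.
  rewrite /P FTZ; [|by move=> u; apply: cvgD; [exact: ck|exact: ces]|exact: integrableRD].
  rewrite FTD// FTZ// FT_shift// !(FT_kap_rot _ _ hal) !FT_kap0 cos0 sub0r cosN.
  rewrite (_ : s * _ = coshR (t * al) * ((s * Xi t) * (1 + e * cos (t * u0)))); last by ring.
  apply: mulr_ge0; first exact: coshR_ge0.
  apply: mulr_ge0; first exact: sX.
  have := cos_le1 (t * u0); have := cos_geN1 (t * u0).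
  by case: e1 => ->; lra.
have := key 1 (or_introl erefl); have := key (-1) (or_intror erefl).
have : `|s * kap al 0| = `|kap al 0|.
  by rewrite normrM; case: s1 => ->; rewrite ?normrN normr1 mul1r.
move=> <- h1 h2.
apply: (le_trans _ (ler_norm _)).
move: (kap al 0) (kap al u0) h1 h2 => x y h1 h2.
rewrite ler_norml; case: s1 h1 h2 => -> h1 h2; apply/andP; split; lra.
Qed.

End Hardy.

(** * Behaviour of the theta series as the angle tends to pi/4 *)

Lemma cosD_natpi (x : R) (n : nat) : cos (x + n%:R * pi) = (-1) ^+ n * cos x.
Proof. by rewrite mulr_natl (alternatingn (@cosDpi R)). Qed.

Lemma sinD_natpi (x : R) (n : nat) : sin (x + n%:R * pi) = (-1) ^+ n * sin x.
Proof. by rewrite mulr_natl (alternatingn (@sinDpi R)). Qed.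

Lemma a3_per k : a3 (k + 9)%N = a3 k :> R.
Proof. by rewrite /a3 dvdn_addl. Qed.

Lemma anti_window (b : nat -> R) : (forall k, b (k + 9)%N = - b k) ->
  forall k, \sum_(i < 18) b (k + i)%N = 0.
Proof.
move=> hb k; rewrite -[18%N]/(9 + 9)%N big_split_ord /= -big_split /=.
apply: big1 => i _; rewrite addnA (addnAC k) hb subrr //.
Qed.

Lemma tri_window (b : nat -> R) : (forall k, b k + b (k + 3)%N + b (k + 6)%N = 0) ->
  forall k, \sum_(i < 9) b (k + i)%N = 0.
Proof.
move=> hb k; rewrite -[9%N]/(3 + (3 + 3))%N !big_split_ord /=.
rewrite -!big_split /=; apply: big1 => i _.
rewrite -(hb (k + i)%N) addrA; congr (b _ + b _ + b _); lia.
Qed.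

Lemma Dlim_le (c d p s B : R) : 0 < c -> c <= 1 -> c ^+ 2 + d ^+ 2 = 1 -> 0 < s ->
  (\forall n \near \oo, Dsum c d p n s <= B) -> Dlim c d p s <= B.
Proof. by move=> c0 c1 cd1 s0; apply: limr_le; have [] := Dsum_cvg p c0 c1 cd1 s0. Qed.

Lemma Dlim_ge (c d p s B : R) : 0 < c -> c <= 1 -> c ^+ 2 + d ^+ 2 = 1 -> 0 < s ->
  (\forall n \near \oo, B <= Dsum c d p n s) -> B <= Dlim c d p s.
Proof. by move=> c0 c1 cd1 s0; apply: limr_ge; have [] := Dsum_cvg p c0 c1 cd1 s0. Qed.

(* Writing [d = 1 - e] splits off the phase [k^2 s]; the remaining factor has
   total variation bounded independently of [c] because [e <= c^2]. *)
Lemma Dsum_phase (c d p s B : R) n : 0 < c -> c <= 1 -> 0 <= d -> c ^+ 2 + d ^+ 2 = 1 -> 0 < s ->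
  (forall j, `|\sum_(1 <= k < j) a3 k * cos (k%:R ^+ 2 * s)| <= B) ->
  (forall j, `|\sum_(1 <= k < j) a3 k * sin (k%:R ^+ 2 * s)| <= B) ->
  `|Dsum c d p n s| <= 4 * B.
Proof.
move=> c0 c1 d0 cd1 s0 hC hS.
have B0 : 0 <= B by apply: le_trans (hC 0%N).
have -> : Dsum c d p n s =
   \sum_(1 <= k < n) (a3 k * cos (k%:R ^+ 2 * s)) * cosexp c (d - 1) p (k%:R ^+ 2 * s) +
   \sum_(1 <= k < n) (a3 k * sin (k%:R ^+ 2 * s)) * cosexp c (d - 1) (p - pi / 2) (k%:R ^+ 2 * s).
  rewrite /Dsum -big_split /=; apply: eq_bigr => k _; rewrite /cosexp.
  set x := k%:R ^+ 2 * s.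
  rewrite (_ : p - d * x = (p - (d - 1) * x) - x); last by ring.
  rewrite (_ : p - pi / 2 - (d - 1) * x = (p - (d - 1) * x) - pi / 2); last by ring.
  by rewrite cosBpihalf (cosB (p - (d - 1) * x) x); ring.
have h2 : c ^+ 2 + (d - 1) ^+ 2 <= (2 * c) ^+ 2.
  have e1 : 1 - d <= c ^+ 2 by rewrite (_ : c ^+ 2 = (1 - d) * (1 + d)) ?ler_peMr; nra.
  have c21 : c ^+ 2 <= c by rewrite expr2 ler_piMl// ltW.
  have : (1 - d) ^+ 2 <= c ^+ 2 by rewrite ler_pXn2r ?nnegrE//; nra.
  by rewrite exprMn -sqrrN opprB; nra.
have bd p' b : (forall j, `|\sum_(1 <= k < j) b k| <= B) ->
   `|\sum_(1 <= k < n) b k * cosexp c (d - 1) p' (k%:R ^+ 2 * s)| <= 2 * B.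
  move=> hb; apply: (le_trans (@cosexp_sum R c (d - 1) p' (2 * c) B s b 1 n c0 _ h2 (ltW s0) hb)).
    by lra.
  rewrite mulfK ?gt_eqF// mulrA [B * 2]mulrC ler_piMr ?mulr_ge0//.
  by rewrite -expR0 ler_expR oppr_le0 mulr_ge0 ?(ltW c0)// mulr_ge0 ?sqr_ge0// ltW.
have := bd p _ hC; have := bd (p - pi / 2) _ hS => b1 b2.
apply: (le_trans (ler_normD _ _)); lra.
Qed.

(** Advancing [k] by 9 adds to [k^2 s] an odd multiple of [pi], namely [81 + 18 k] or [9 + 2 k]
    times [pi], and leaves [a3] unchanged. The terms are therefore antiperiodic; 36 is the window 18
    times the bound 2. *)
Lemma phase9 (s : R) (j : nat) : (j = 1%N \/ j = 3%N) -> s = pi / j%:R ^+ 2 -> forall n,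
  `|\sum_(1 <= k < n) a3 k * cos (k%:R ^+ 2 * s)| <= 36 /\
  `|\sum_(1 <= k < n) a3 k * sin (k%:R ^+ 2 * s)| <= 36.
Proof.
move=> hj sE n.
have [m [q [mo qe mE]]] : exists (m q : nat), [/\ odd m, odd q = false &
    forall k, (k + 9)%:R ^+ 2 * s = k%:R ^+ 2 * s + (m + k * q)%:R * pi :> R].
  case: hj sE => -> ->; [exists 81%N, 18%N|exists 9%N, 2%N]; split => // k.
    by rewrite !natrD natrM expr1n divr1; ring.
  by rewrite !natrD natrM; field.
have E k : cos ((k + 9)%:R ^+ 2 * s) = - cos (k%:R ^+ 2 * s) /\ sin ((k + 9)%:R ^+ 2 * s) = - sin (k%:R ^+ 2 * s).
  rewrite mE cosD_natpi sinD_natpi -signr_odd oddD oddM qe andbF addbF mo.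
  by rewrite expr1 !mulN1r.
have W (f : R -> R) : (forall x, `|f x| <= 1) -> (forall k, f ((k + 9)%:R ^+ 2 * s) = - f (k%:R ^+ 2 * s)) ->
   `|\sum_(1 <= k < n) a3 k * f (k%:R ^+ 2 * s)| <= 36.
  move=> f1 fE; have := @sum_window_bound R (fun k => a3 k * f (k%:R ^+ 2 * s)) 2 18 1 n erefl.
  rewrite -natrM; apply.
  - by move=> k; rewrite normrM -[leRHS]mulr1 ler_pM ?a3_le.
  - by apply: (@anti_window (fun k => a3 k * f (k%:R ^+ 2 * s))) => k; rewrite a3_per fE mulrN.
by split; apply: W => k; [exact: cos_max|have [] := E k|exact: sin_max|have [] := E k].
Qed.

(** At [u = 0] the theta values are taken at [pi] and [pi / 9], where the phases cancel uniformly in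
    [al]; [288 = 2 * 4 * 36]. *)
Lemma kap_bounded al : 0 <= al < pi / 4 -> `|kap al 0| <= 288.
Proof.
move=> hal; have c0 := cc_gt0 hal; have cd1 := cos2Dsin2 (2 * al).
have s0 : 0 <= ss al by apply: sin_ge0_pi; move: hal => /andP[? ?]; apply/andP; split; have := pi_gt0 R; lra.
rewrite kapE// mul0r mulr0 !expR0 mul1r mulr1.
have key (j : nat) s : (j = 1%N \/ j = 3%N) -> s = pi / j%:R ^+ 2 -> `|Dlim (cc al) (ss al) (al / 2) s| <= 144.
  move=> hj sE; have sp : 0 < s by rewrite sE divr_gt0 ?pi_gt0// exprn_gt0//; case: hj => ->.
  have h n : `|Dsum (cc al) (ss al) (al / 2) n s| <= 144.
    have -> : 144 = 4 * 36 :> R by rewrite -natrM.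
    apply: Dsum_phase => //; first exact: cos_le1.
      by move=> m; have [] := phase9 hj sE m.
    by move=> m; have [] := phase9 hj sE m.
  rewrite ler_norml; apply/andP; split.
    apply: Dlim_ge => //; first exact: cos_le1.
    by apply: nearW => n; have := h n; rewrite ler_norml => /andP[].
  apply: Dlim_le => //; first exact: cos_le1.
  by apply: nearW => n; have := h n; rewrite ler_norml => /andP[].
have h1 := key 1%N pi (or_introl erefl) (ltac:(by rewrite expr1n divr1)).
have h3 := key 3%N (pi / 9) (or_intror erefl) (ltac:(by rewrite -natrX)).
apply: (le_trans (ler_normB _ _)); lra.
Qed.

Lemma third (x : R) : cos x + cos (x + 2 / 3 * pi) + cos (x + 4 / 3 * pi) = 0 :> R.
Proof.
have h3 : cos (pi / 3) = 2^-1 :> R.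
  have E : cos (pi / 3 *+ 2) = - cos (pi / 3) :> R.
    have -> : pi / 3 *+ 2 = - (pi / 3) + pi :> R by rewrite mulr2n; field.
    by rewrite cosDpi cosN.
  rewrite cos_mulr2n in E.
  have c0 : 0 < cos (pi / 3) :> R.
    by apply: cos_gt0_pihalf; apply/andP; split; have := pi_gt0 R; lra.
  have : (2 * cos (pi / 3) - 1) * (cos (pi / 3) + 1) = 0 :> R by nra.
  by move/eqP; rewrite mulf_eq0 => /orP[] /eqP h; lra.
have -> : x + 2 / 3 * pi = (x - pi / 3) + pi by field.
have -> : x + 4 / 3 * pi = (x + pi / 3) + pi by field.
rewrite !cosDpi (cosB x) (cosD x) h3; lra.
Qed.

(** From [k] to [k + 3] the angle grows by [4 pi k / 3] modulo [2 pi]; for [k] prime to 3 the three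
    angles are equally spaced. *)
Lemma third_sq (k : nat) (x : R) : ~~ (3 %| k)%N ->
  cos (x + k%:R ^+ 2 * (2 * pi / 9)) + cos (x + (k + 3)%:R ^+ 2 * (2 * pi / 9)) +
  cos (x + (k + 6)%:R ^+ 2 * (2 * pi / 9)) = 0.
Proof.
move=> k3.
have per (y : R) (n : nat) : cos (y + n%:R * (2 * pi)) = cos y.
  rewrite (_ : n%:R * (2 * pi) = (n * 2)%:R * pi); last by rewrite natrM; ring.
  by rewrite cosD_natpi -signr_odd oddM andbF expr0 mul1r.
have kE : k = (3 * (k %/ 3) + k %% 3)%N by rewrite mulnC -divn_eq.
set y := x + k%:R ^+ 2 * _.
have -> : x + (k + 3)%:R ^+ 2 * (2 * pi / 9) = y + (4 * (k%:R / 3) + 2) * pi.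
  by rewrite /y natrD; field.
have -> : x + (k + 6)%:R ^+ 2 * (2 * pi / 9) = y + (8 * (k%:R / 3) + 8) * pi.
  by rewrite /y natrD; field.
move: kE; set m := (k %/ 3)%N => kE.
have : (k %% 3 = 1 \/ k %% 3 = 2)%N by move: k3; rewrite /dvdn; lia.
case=> r; rewrite r in kE; rewrite kE natrD natrM.
  rewrite (_ : y + (4 * _ + 2) * pi = (y + 4 / 3 * pi) + (2 * m + 1)%:R * (2 * pi)); last first.
    by rewrite natrD natrM; field.
  rewrite (_ : y + (8 * _ + 8) * pi = (y + 2 / 3 * pi) + (4 * m + 5)%:R * (2 * pi)); last first.
    by rewrite natrD natrM; field.
  by rewrite !per addrAC third.
rewrite (_ : y + (4 * _ + 2) * pi = (y + 2 / 3 * pi) + (2 * m + 2)%:R * (2 * pi)); last first.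
  by rewrite natrD natrM; field.
rewrite (_ : y + (8 * _ + 8) * pi = (y + 4 / 3 * pi) + (4 * m + 6)%:R * (2 * pi)); last first.
  by rewrite natrD natrM; field.
by rewrite !per third.
Qed.

(** At the chosen point [d s = 2 pi]. The phases at [s] are then trivial and the partial sums of
    [a3] keep the series bounded. At [s / 9] the multiples of 3 all have the same phase and the
    coefficient -2, and about [J] of them are hardly damped when [c] is of order [J^{-2}]. *)
Lemma kap_unbounded al J : 0 <= al < pi / 4 -> (84 <= J)%N -> 32 * J%:R ^+ 2 * cc al <= 1 ->
  exists u0, J%:R / 2 - 42 <= kap al u0.
Proof.
move=> hal J84 hc; have J0 : (0 < J)%N by lia.
have c0 := cc_gt0 hal; have cd1 : cc al ^+ 2 + ss al ^+ 2 = 1 := cos2Dsin2 (2 * al).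
have s0 : 0 <= ss al by apply: sin_ge0_pi; move: hal => /andP[? ?]; apply/andP; split; have := pi_gt0 R; lra.
have J1 : 1 <= J%:R ^+ 2 :> R by rewrite -natrX ler1n expn_gt0 J0.
have c32 : cc al <= 1 / 32 by nra.
have sh : 1 / 2 <= ss al by nra.
set c := cc al in c0 cd1 hc c32 *; set d := ss al in cd1 s0 sh *; set p := al / 2.
have c1 : c <= 1 by lra.
have d1 : d <= 1 by nra.
pose s := pi * (2 / d).
have d0 : 0 < d by lra.
have sp : 0 < s by rewrite mulr_gt0 ?pi_gt0// divr_gt0.
have dsE : d * s = 2 * pi by rewrite /s; field; rewrite gt_eqF.
have cp : 1 / 2 <= cos p.
  have : cos al = cos p ^+ 2 *+ 2 - 1 by rewrite -cos_mulr2n; congr cos; rewrite /p mulr2n; field.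
  have : 0 <= cos al by apply: cos_ge0_pihalf; move: hal => /andP[? ?]; apply/andP; split; have := pi_gt0 R; lra.
  have : 0 <= cos p by apply: cos_ge0_pihalf; rewrite /p; move: hal => /andP[? ?]; apply/andP; split; have := pi_gt0 R; lra.
  rewrite mulr2n; nra.
exists (ln (2 / d) / 2); rewrite kapE// -/c -/d -/p.
have -> : expR (2 * (ln (2 / d) / 2)) = 2 / d.
  by rewrite mulrC divfK// lnK// posrE divr_gt0.
rewrite -/s.
(* Together with [32 J^2 c <= 1] this keeps the damping exponents [c j^2 s] with [j <= J] below
   [1/2]. *)
have s16 : s <= 16.
  have p4 : pi <= 4 :> R by have := pihalf_lt2 R; lra.
  have d4 : 2 / d <= 4 by rewrite ler_pdivrMr//; lra.
  have e16 : 16 = 4 * 4 :> R by rewrite -natrM.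
  by rewrite /s e16; apply: ler_pM; rewrite ?pi_ge0// divr_ge0// ltW.
clearbody s.
have Ele1 x : 0 <= x -> expR (- (c * x)) <= 1.
  by move=> x0; rewrite -[leRHS]expR0 ler_expR oppr_le0 mulr_ge0// ltW.
have H1 : -6 <= Dlim c d p s.
  apply: Dlim_ge => //; apply: nearW => n.
  have -> : Dsum c d p n s = cos p * \sum_(1 <= k < n) a3 k * cosexp c 0 0 (k%:R ^+ 2 * s).
    rewrite /Dsum mulr_sumr; apply: eq_bigr => k _; rewrite /cosexp mul0r subr0 cos0.
    have -> : p - d * (k%:R ^+ 2 * s) = - (- p + (k * k * 2)%:R * pi).
      by rewrite !natrM mulrCA dsE; ring.
    by rewrite cosN cosD_natpi cosN -signr_odd oddM andbF expr0; ring.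
  have := @cosexp_sum R c 0 0 c 6 s a3 1 n c0 (lexx _) _ (ltW sp) (@a3_sum R 1).
  rewrite expr0n addr0 lexx => /(_ isT); rewrite divff ?gt_eqF// mul1r.
  set X := \sum_(_ <= _ < _) _; set E := expR _ => hX.
  have E1 : E <= 1 by apply: Ele1; rewrite mulr_ge0 ?(ltW sp) ?sqr_ge0.
  have cp1 := cos_le1 p.
  have : `|cos p * X| <= 6.
    rewrite normrM (@ger0_norm _ (cos p)); last by lra.
    have : `|X| <= 6 by apply: (le_trans hX); lra.
    have := normr_ge0 X; nra.
  by rewrite ler_norml => /andP[].
have H2 : Dlim c d p (s / 9) <= 9 - J%:R / 2.
  have s9 : 0 < s / 9 by rewrite divr_gt0.
  pose E k := cosexp c 0 0 (k%:R ^+ 2 * (s / 9)).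
  have E0 k : 0 <= E k by rewrite /E /cosexp mul0r subr0 cos0 mulr1 expR_ge0.
  (* The terms with [3 | k] go into a separate sum with the factor [- 2 cos p]; the remaining ones
     cancel in windows of length 9. *)
  pose b k := if (3 %| k)%N then 0 else cos (- p + k%:R ^+ 2 * (2 * pi / 9)).
  apply: Dlim_le => //; exists (3 * J).+1 => // n /= hn.
  have -> : Dsum c d p n (s / 9) = \sum_(1 <= k < n) b k * E k -
      2 * cos p * \sum_(1 <= k < n) (if (3 %| k)%N then E k else 0).
    rewrite /Dsum mulr_sumr -sumrB; apply: eq_bigr => k _; rewrite /E /cosexp mul0r subr0 cos0 mulr1.
    have -> : p - d * (k%:R ^+ 2 * (s / 9)) = - (- p + k%:R ^+ 2 * (2 * pi / 9)).
      by rewrite -dsE; field.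
    rewrite cosN /a3 /b; case: ifP => [/dvdnP[m ->]|_]; last by ring.
    have -> : - p + (m * 3)%:R ^+ 2 * (2 * pi / 9) = - p + (m * m * 2)%:R * pi.
      by rewrite !natrM; field.
    by rewrite cosD_natpi cosN -signr_odd oddM andbF expr0; ring.
  have hb1 : `|\sum_(1 <= k < n) b k * E k| <= 9.
    have := @cosexp_sum R c 0 0 c 9 (s / 9) b 1 n c0 (lexx _) _ (ltW s9).
    rewrite expr0n addr0 lexx => /(_ isT); rewrite divff ?gt_eqF// mul1r => h.
    apply: (le_trans (h _)).
      move=> j; have := @sum_window_bound R b 1 9 1 j erefl; rewrite mulr1; apply.
        by move=> k; rewrite /b; case: ifP => _; rewrite ?normr0 ?ler01 ?cos_max.
      apply: tri_window => k; rewrite /b !(dvdn_addl _ (_ : 3 %| _)%N)//.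
      by case: ifPn => [_|]; [rewrite !addr0|exact: third_sq].
    by rewrite -[leRHS]mulr1 ler_pM2l//; apply: Ele1; rewrite mulr_ge0 ?(ltW s9) ?sqr_ge0.
  have hb2 : J%:R / 2 <= \sum_(1 <= k < n) (if (3 %| k)%N then E k else 0).
    have hE j : (j < J)%N -> 2^-1 <= E (3 * j).+3.
      move=> jJ; rewrite /E /cosexp mul0r subr0 cos0 mulr1.
      apply: (le_trans _ (expR_ge1Dx _)).
      have -> : (3 * j).+3%:R ^+ 2 * (s / 9) = j.+1%:R ^+ 2 * s.
        rewrite (_ : (3 * j).+3 = 3 * j.+1)%N; last by rewrite mulnS.
        rewrite natrM; move: (j.+1%:R) => y; by field.
      have jJ2 : j.+1%:R ^+ 2 <= J%:R ^+ 2 :> R by rewrite ler_pXn2r ?nnegrE// ler_nat.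
      have : c * (j.+1%:R ^+ 2 * s) <= c * (J%:R ^+ 2 * 16).
        by rewrite ler_pM2l// ler_pM ?sqr_ge0 ?(ltW sp).
      lra.
    have base i : (i <= J)%N -> i%:R / 2 <= \sum_(1 <= k < (3 * i).+1) (if (3 %| k)%N then E k else 0).
      elim: i => [_|i IH iJ]; first by rewrite mul0r big_geq.
      rewrite (_ : (3 * i.+1).+1 = (3 * i).+4)%N; last by clear; lia.
      do 3 (rewrite big_nat_recr //=).
      rewrite (_ : (3 %| (3 * i).+1)%N = false); last by clear; lia.
      rewrite (_ : (3 %| (3 * i).+2)%N = false); last by clear; lia.
      rewrite (_ : (3 %| (3 * i).+3)%N = true); last by clear; lia.
      have := IH (ltnW iJ); have := hE i iJ; rewrite -(natr1 i); lra.
    apply: (le_trans (base J (leqnn _))).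
    rewrite (big_cat_nat (n := (3 * J).+1) _ (leq_trans _ hn))//= lerDl.
    by apply: sumr_ge0 => k _; case: ifP.
  move: hb1; rewrite ler_norml => /andP[_ hb1].
  have : J%:R / 2 <= 2 * cos p * \sum_(1 <= k < n) (if (3 %| k)%N then E k else 0).
    by apply: (le_trans hb2); rewrite ler_peMl ?sumr_ge0//; [move=> k _; case: ifP|lra].
  lra.
have j84 : 84 <= J%:R :> R by rewrite ler_nat.
have H3 : 0 <= J%:R / 2 - 42 :> R by lra.
apply: (@le_trans _ _ (Dlim c d p s - Dlim c d p (s / 9))); first by lra.
rewrite ler_peMl//; first by lra.
rewrite -[leLHS]expR0 ler_expR !divr_ge0// ln_ge0// ler_pdivlMr// mul1r; lra.
Qed.

Theorem Xi_zero : (forall u, kap 0 (- u) = kap 0 u) -> exists t, Xi t = 0.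
Proof.
move=> even; apply: contrapT => nz.
have Xn0 t : Xi t != 0 by apply/eqP => h; apply: nz; exists t.
(* [800 / 2 - 42 = 358] exceeds the bound 288 at the origin. *)
have [J [J0 J84 J800]] : exists J : nat, [/\ (0 < J)%N, (84 <= J)%N & 800 <= J%:R :> R].
  by exists 800%N.
pose c : R := (32 * J%:R ^+ 2)^-1.
have J2 : 0 < 32 * J%:R ^+ 2 :> R by rewrite mulr_gt0// exprn_gt0// ltr0n.
have c0 : 0 < c by rewrite invr_gt0.
have c1 : c < 1 by rewrite invf_lt1//; nra.
pose al := acos c / 2.
have c11 : -1 <= c <= 1 by apply/andP; split; lra.
have cE : cc al = c by rewrite /cc /al mulrC divfK// acosK// in_itv.
have hal : 0 <= al < pi / 4.
  rewrite /al; apply/andP; split; first by rewrite divr_ge0// acos_ge0.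
  have : acos c < pi / 2; last by lra.
  rewrite -acos0 -(@ltr_cos R) ?in_itv /= ?acos_ge0 ?acos_lepi ?lexx ?ler01 ?lerN10//=.
  by rewrite !acosK ?in_itv//= ?ler01 ?lerN10.
have [|u0 hu] := @kap_unbounded al J hal J84.
  by rewrite cE /c divff// gt_eqF.
have := le_trans (ler_norm _) (le_trans (kap_max even u0 Xn0 hal) (kap_bounded hal)).
by move: (kap al u0) hu => x; lra.
Qed.

End Kap.

(** * Inversion of the theta series *)

Section Tannery.
Context {R : realType}.

Lemma geo_tail (r : R) (m n : nat) : 0 < r < 1 -> \sum_(m <= k < n) r ^+ k <= r ^+ m / (1 - r).
Proof.
move=> /andP[r0 r1]; have [nm|mn] := leqP n m.
  by rewrite big_geq// divr_ge0 ?exprn_ge0 ?subr_ge0// ltW.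
have r10 : 0 < 1 - r by rewrite subr_gt0.
rewrite ler_pdivlMr// -[n](subnKC (ltnW mn)).
move: (n - m)%N => j; suff -> : (\sum_(m <= k < m + j) r ^+ k) * (1 - r) = r ^+ m - r ^+ (m + j).
  by rewrite gerBl exprn_ge0// ltW.
elim: j => [|j IH]; first by rewrite addn0 big_geq// mul0r subrr.
by rewrite addnS big_nat_recr ?leq_addr//= mulrDl IH exprS; ring.
Qed.

(** Dominated convergence for sums whose length grows as well: past a fixed index both the sums and
    the limit series are bounded by the same geometric tail. *)
Lemma tannery (u : nat -> nat -> R) (v : nat -> R) (K : nat -> nat) (r : R) : 0 < r < 1 ->
  (forall k, u n k @[n --> \oo] --> v k) ->
  (forall k, `|v k| <= r ^+ k) ->
  (\forall n \near \oo, forall k, (1 <= k < K n)%N -> `|u n k| <= r ^+ k) ->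
  (forall m, \forall n \near \oo, (m <= K n)%N) ->
  \sum_(1 <= k < K n) u n k @[n --> \oo] --> limn (fun m => \sum_(1 <= k < m) v k).
Proof.
move=> r01 uv vr ur Km; have /andP[r0 r1] := r01.
have r10 : 0 < 1 - r by rewrite subr_gt0.
have e0 : r ^+ m / (1 - r) @[m --> \oo] --> (0 : R).
  rewrite -[X in _ --> X](mul0r (1 - r)^-1); apply: cvgM; last exact: cvg_cst.
  by apply: cvg_expr; rewrite ger0_norm// ltW.
have [|cv hv] := @cauchy_dom R (fun m => \sum_(1 <= k < m) v k) (fun m => r ^+ m / (1 - r)) 1 e0.
  move=> m n /andP[m1 mn]; rewrite (big_cat_nat m1 mn)/= [X in X - _]addrC addrK.
  apply: (le_trans (ler_norm_sum _ _ _)); apply: (le_trans _ (geo_tail m n r01)).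
  by apply: ler_sum => k _; exact: vr.
apply/cvgrPdist_lt => e ep.
have e3 : 0 < e / 3 by rewrite divr_gt0.
have /cvgrPdist_lt/(_ _ e3)[M _ hM] := e0.
pose m := maxn 1 M.
have hm : r ^+ m / (1 - r) < e / 3.
  have := hM m; rewrite /= leq_maxr => /(_ isT); rewrite sub0r normrN.
  by apply: le_lt_trans; exact: ler_norm.
have fin : \sum_(1 <= k < m) u n k @[n --> \oo] --> \sum_(1 <= k < m) v k.
  elim: (m) => [|[|j] IH].
  - by rewrite big_geq// (_ : (fun n => _) = cst 0); [exact: cvg_cst|apply/funext => n; rewrite big_geq].
  - by rewrite big_geq// (_ : (fun n => _) = cst 0); [exact: cvg_cst|apply/funext => n; rewrite big_geq].
  rewrite big_nat_recr//= (_ : (fun n => _) = (fun n => \sum_(1 <= k < j.+1) u n k + u n j.+1)).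
    by apply: cvgD; [exact: IH|exact: uv].
  by apply/funext => n; rewrite big_nat_recr.
have /cvgrPdist_lt/(_ _ e3) hfin := fin.
near=> n.
have h1 : `|\sum_(1 <= k < m) v k - \sum_(1 <= k < m) u n k| < e / 3 by near: n.
have h2 : (m <= K n)%N by near: n; exact: Km.
have h3 k : (1 <= k < K n)%N -> `|u n k| <= r ^+ k by move: k; near: n.
have m1 : (1 <= m)%N by rewrite leq_maxl.
rewrite (big_cat_nat m1 h2)/=.
set L := limn _; set V := \sum_(1 <= k < m) v k; set U := \sum_(1 <= k < m) _; set T := \sum_(m <= k < _) _.
have h4 : `|L - V| <= r ^+ m / (1 - r) by exact: hv.
have h5 : `|T| <= r ^+ m / (1 - r).
  apply: (le_trans (ler_norm_sum _ _ _)); apply: (le_trans _ (geo_tail m (K n) r01)).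
  rewrite big_nat_cond [leRHS]big_nat_cond; apply: ler_sum => k /andP[/andP[mk kK] _].
  by apply: h3; rewrite kK (leq_trans m1 mk).
rewrite (_ : L - (U + T) = (L - V) + ((V - U) - T)); last by ring.
apply: (le_lt_trans (ler_normD _ _)).
have := ler_normB (V - U) T; lra.
Unshelve. all: by end_near. Qed.

End Tannery.

(** * Powers of the cosine averaged over roots of unity *)

Section CosineSums.
Context {R : realType}.

(** The binomial theorem for [(e^{ix} + e^{-ix})^N], by Pascal's rule. *)
Lemma cos_pow_bin (x : R) (N : nat) :
  (2 * cos x) ^+ N = \sum_(j < N.+1) 'C(N, j)%:R * cos ((2 * j%:R - N%:R) * x).
Proof.
elim: N => [|N IH].
  by rewrite expr0 big_ord_recl big_ord0 bin0 mulr0 subr0 mul0r cos0 addr0 mul1r.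
rewrite exprS IH mulr_sumr.
have -> : \sum_(i < N.+1) 2 * cos x * ('C(N, i)%:R * cos ((2 * i%:R - N%:R) * x)) =
  \sum_(i < N.+1) 'C(N, i)%:R * cos ((2 * i.+1%:R - N.+1%:R) * x) +
  \sum_(i < N.+1) 'C(N, i)%:R * cos ((2 * i%:R - N.+1%:R) * x).
  rewrite -big_split /=; apply: eq_bigr => i _.
  set y := (2 * i%:R - N%:R) * x.
  rewrite (_ : (2 * i.+1%:R - N.+1%:R) * x = y + x); last by rewrite /y -!natr1; ring.
  rewrite (_ : (2 * i%:R - N.+1%:R) * x = y - x); last by rewrite /y -!natr1; ring.
  rewrite (cosD y x) (cosB y x); ring.
rewrite [in RHS]big_ord_recl [X in _ + X = _]big_ord_recl [X in X + _ = _]big_ord_recr /= !bin0 !binn.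
rewrite [in RHS]big_ord_recr /= binn.
under [in RHS]eq_bigr do rewrite /bump /= add1n binS natrD mulrDl.
rewrite big_split /= /bump /= !add1n.
under [X in _ + (_ + X) = _]eq_bigr do rewrite /bump /= add1n.
ring.
Qed.

(** Orthogonality of the roots of unity; after multiplication by [2 sin (pi d / n)] the sum
    telescopes. *)
Lemma sum_cos_multiple (n d : nat) : (0 < n)%N ->
  \sum_(l < n) cos (2 * d%:R * (pi * l%:R / n%:R)) = if (n %| d)%N then n%:R else 0 :> R.
Proof.
move=> n0; have n0' : n%:R != 0 :> R by rewrite pnatr_eq0 -lt0n.
case: ifPn => [/dvdnP[q ->]|nd].
  rewrite (eq_bigr (fun=> 1)); first by rewrite sumr_const card_ord.
  move=> l _; rewrite (_ : _ * _ = 0 + (q * l * 2)%:R * pi); last by rewrite !natrM; field.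
  by rewrite cosD_natpi -signr_odd oddM andbF cos0 mul1r.
pose y : R := pi * d%:R / n%:R.
have sy : sin y != 0.
  have -> : y = pi * (d %% n)%:R / n%:R + (d %/ n)%:R * pi.
    by rewrite /y {1}(divn_eq d n) natrD natrM; field.
  rewrite sinD_natpi mulf_neq0 ?signr_eq0// gt_eqF// sin_gt0_pi//.
  have r0 : (0 < d %% n)%N by rewrite lt0n; move: nd; rewrite /dvdn.
  have rn : (d %% n < n)%N by rewrite ltn_pmod.
  rewrite divr_gt0 ?mulr_gt0 ?pi_gt0 ?ltr0n//= -mulrA gtr_pMr ?pi_gt0//.
  by rewrite ltr_pdivrMr ?ltr0n// mul1r ltr_nat.
have T k : 2 * sin y * \sum_(l < k) cos (2 * d%:R * (pi * l%:R / n%:R)) = sin ((2 * k%:R - 1) * y) + sin y.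
  elim: k => [|k IH]; first by rewrite big_ord0 mulr0 mulr0 sub0r mulN1r sinN addNr.
  rewrite big_ord_recr /= mulrDr IH.
  rewrite (_ : 2 * d%:R * _ = 2 * k%:R * y); last by rewrite /y; ring.
  rewrite (_ : (2 * k.+1%:R - 1) * y = 2 * k%:R * y + y); last by rewrite -natr1; ring.
  rewrite (_ : (2 * k%:R - 1) * y = 2 * k%:R * y - y); last by ring.
  rewrite (sinD (2 * k%:R * y) y) (sinB (2 * k%:R * y) y); ring.
have := T n; rewrite (_ : (2 * n%:R - 1) * y = - y + (2 * d)%:R * pi); last first.
  by rewrite /y natrM; field.
rewrite sinD_natpi -signr_odd oddM expr0 mul1r sinN addNr => /eqP.
by rewrite mulf_eq0 mulf_eq0 pnatr_eq0 (negbTE sy) => /eqP.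
Qed.

Lemma sum_shift (g : nat -> R) m :
  \sum_(m.+1 <= j < (2 * m).+1) g j = \sum_(1 <= k < m.+1) g (m + k)%N.
Proof.
rewrite -{1}[m.+1]add1n big_addn; have -> : ((2 * m).+1 - m = m.+1)%N by lia.
by apply: eq_bigr => k _; rewrite addnC.
Qed.

Lemma sum_rev (g : nat -> R) m : \sum_(0 <= j < m) g j = \sum_(1 <= k < m.+1) g (m - k)%N.
Proof. by rewrite big_nat_rev big_add1; apply: eq_bigr => k _; rewrite add0n. Qed.

(* The binomial expansion of [(2 cos x)^(2m)] averaged over [x = pi l / n]. *)
Lemma polya (n m : nat) : odd n -> (0 < m)%N ->
  (1 + 2 * \sum_(1 <= l < (n./2).+1) cos (pi * l%:R / n%:R) ^+ (2 * m)) * 2 ^+ (2 * m) =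
  n%:R * ('C(2 * m, m)%:R + 2 * \sum_(1 <= k < m.+1) (if (n %| k)%N then 'C(2 * m, m + k)%:R else 0)) :> R.
Proof.
move=> no m0; have n0 : (0 < n)%N by case: n no.
have n0' : n%:R != 0 :> R by rewrite pnatr_eq0 -lt0n.
pose f l : R := cos (pi * l%:R / n%:R) ^+ (2 * m).
have sym l : (l <= n)%N -> f (n - l)%N = f l.
  move=> ln; rewrite /f !exprM; congr (_ ^+ _).
  rewrite natrB// (_ : pi * (n%:R - l%:R) / n%:R = - (pi * l%:R / n%:R) + pi); last by field.
  by rewrite cosDpi cosN sqrrN.
have nE : n = (n./2 + n./2).+1 by rewrite -{1}(odd_double_half n) no addnn.
have E1 : \sum_(l < n) f l = 1 + 2 * \sum_(1 <= l < (n./2).+1) f l.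
  rewrite -(big_mkord xpredT) big_ltn// {1}/f mulr0 mul0r cos0 expr1n; congr (1 + _).
  rewrite (big_cat_nat (n := (n./2).+1))//=; last by rewrite {2}nE; lia.
  rewrite mulr_natl mulr2n; congr (_ + _).
  have nE2 : n = (2 * n./2).+1 by rewrite mul2n -addnn.
  transitivity (\sum_(n./2.+1 <= i < (2 * n./2).+1) f i); first by rewrite -nE2.
  rewrite sum_shift.
  rewrite [RHS]big_nat_rev /=; apply: eq_big_nat => l /andP[l1 ln].
  rewrite -sym; last by lia.
  by congr f; rewrite {1}nE; lia.
rewrite -E1 mulr_suml.
under eq_bigr do rewrite /f -exprMn [_ * 2]mulrC cos_pow_bin.
rewrite exchange_big /=.
(* The distance from the central index: [2 j - 2 m] is [2 d j] up to a sign, which the cosine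
   ignores. *)
pose d (j : nat) := if (j <= m)%N then (m - j)%N else (j - m)%N.
have E2 (j : nat) : (j < (2 * m).+1)%N -> \sum_(l < n) 'C(2 * m, j)%:R * cos ((2 * j%:R - (2 * m)%:R) * (pi * l%:R / n%:R)) =
   n%:R * (if (n %| d j)%N then 'C(2 * m, j)%:R else 0) :> R.
  move=> _; rewrite -mulr_sumr (_ : \sum_(l < n) _ = \sum_(l < n) cos (2 * (d j)%:R * (pi * l%:R / n%:R))).
    by rewrite sum_cos_multiple//; case: ifP => _; rewrite ?mulr0// mulrC.
  apply: eq_bigr => l _; rewrite /d natrM; case: ifPn => [jm|]; last rewrite -ltnNge => jm.
    by rewrite natrB// -cosN; congr cos; ring.
  by rewrite natrB ?ltW// ?(ltnW jm)//; congr cos; ring.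
rewrite -(big_mkord xpredT (fun j => \sum_(i < n) 'C(2 * m, j)%:R * cos ((2 * j%:R - (2 * m)%:R) * (pi * i%:R / n%:R)))).
rewrite (eq_big_nat _ _ (F2 := fun j => n%:R * (if (n %| d j)%N then 'C(2 * m, j)%:R else 0))); last first.
  by move=> j /andP[_ jm]; exact: E2.
rewrite -mulr_sumr; congr (_ * _).
rewrite (big_cat_nat (n := m.+1))//=; last by lia.
rewrite big_nat_recr//= {2}/d leqnn subnn dvdn0 addrAC [RHS]addrC; congr (_ + _).
rewrite mulr_natl mulr2n; congr (_ + _).
  rewrite sum_rev; apply: eq_big_nat => k /andP[k1 km].
  rewrite /d leq_subr subKn; last by lia.
  by case: ifP => // _; rewrite -bin_sub; [congr ('C(_, _)%:R); lia|lia].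
rewrite sum_shift; apply: eq_big_nat => k /andP[k1 km].
by have -> : d (m + k)%N = k by rewrite /d; case: ifP; lia.
Qed.

End CosineSums.

(** * Gaussian bounds for cosines and binomial coefficients *)

Section Bounds.
Context {R : realType}.

Lemma mono_dom (g dg : R -> R) (a b : R) : a <= b ->
  (forall x, a <= x <= b -> is_derive x (1 : R) g (dg x)) ->
  (forall x, a <= x <= b -> 0 <= dg x) -> g a <= g b.
Proof.
move=> ab dG h; rewrite -subr_ge0.
apply: le_trans (@lip_dom R (cst 0) (cst 0) g dg a b ab _ dG _); first exact: normr_ge0.
by move=> x xab; rewrite /= normr0 h.
Qed.

Lemma sin_le_id (x : R) : 0 <= x -> sin x <= x.
Proof.
move=> x0; have := @mono_dom (fun x => x - sin x) (fun x => 1 - cos x) 0 x x0.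
rewrite sin0 subr0 subr_ge0; apply.
by move=> y _; rewrite subr_ge0 cos_le1.
Qed.

Lemma cos_ge_quad (x : R) : 0 <= x -> 1 - x ^+ 2 / 2 <= cos x.
Proof.
move=> x0; have := @mono_dom (fun x => cos x + x ^+ 2 / 2) (fun x => x - sin x) 0 x x0.
rewrite cos0 expr0n mul0r addr0 => h; have : 1 <= cos x + x ^+ 2 / 2; last by lra.
apply: h.
  by move=> y _; apply: is_derive_eq; rewrite /GRing.scale /=; field.
by move=> y /andP[y0 _]; rewrite subr_ge0 sin_le_id.
Qed.

(** [e^{x^2/2} cos x] decreases because [x cos x <= sin x]. *)
Lemma cos_le_exp (x : R) : 0 <= x <= pi / 2 -> cos x <= expR (- (x ^+ 2 / 2)).
Proof.
move=> /andP[x0 xp].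
have tan_ge (y : R) : 0 <= y <= pi / 2 -> y * cos y <= sin y.
  move=> /andP[y0 yp]; have := @mono_dom (fun x => sin x - x * cos x) (fun x => x * sin x) 0 y y0.
  rewrite sin0 mul0r subr0 subr_ge0; apply.
    by move=> z _; apply: is_derive_eq; rewrite /GRing.scale /=; ring.
  move=> z /andP[z0 zy]; rewrite mulr_ge0// sin_ge0_pi// z0 /=.
  have := pi_gt0 R; lra.
have := @mono_dom (fun x => - (expR (x ^+ 2 / 2) * cos x)) (fun x => expR (x ^+ 2 / 2) * (sin x - x * cos x)) 0 x x0.
rewrite expr0n mul0r expR0 cos0 mul1r lerN2 => h.
rewrite expRN -[leRHS]mul1r ler_pdivlMr ?expR_gt0// mulrC; apply: h.
  by move=> y _; apply: is_derive_eq; rewrite /GRing.scale /=; field.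
move=> y /andP[y0 yx]; rewrite mulr_ge0 ?expR_ge0// subr_ge0; apply: tan_ge.
by rewrite y0 (le_trans yx).
Qed.

Lemma exp_le_1B (y : R) : 0 <= y < 1 -> expR (- (y / (1 - y))) <= 1 - y.
Proof.
move=> /andP[y0 y1]; have h : 0 < 1 - y by rewrite subr_gt0.
rewrite expRN -[leRHS]invrK lef_pV2 ?posrE ?expR_gt0 ?invr_gt0//.
apply: le_trans (expR_ge1Dx _).
by rewrite [leLHS](_ : _ = 1 + y / (1 - y))//; field; rewrite gt_eqF.
Qed.

(** Close to [e^{-k^2/m}]. The central coefficient is divided out, so its asymptotics do not
    enter. *)
Definition binr (m k : nat) : R := 'C(2 * m, m + k)%:R / 'C(2 * m, m)%:R.

Lemma binrS m k : (k < m)%N -> binr m k.+1 = binr m k * ((m%:R - k%:R) / (m%:R + k%:R + 1)).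
Proof.
move=> km; have := mul_bin_left (2 * m) (m + k).
have -> : (2 * m - (m + k) = m - k)%N by lia.
move/(congr1 (fun n : nat => n%:R : R)); rewrite !natrM -addnS natrB ?(ltnW km)// => E.
have hC : 'C(2 * m, m)%:R != 0 :> R by rewrite pnatr_eq0 -lt0n bin_gt0; lia.
have hp : m%:R + k%:R + 1 != 0 :> R by rewrite -natrD natr1 pnatr_eq0.
rewrite /binr [LHS](_ : _ = ('C(2 * m, m)%:R)^-1 * ((m + k.+1)%:R * 'C(2 * m, m + k.+1)%:R / (m%:R + k%:R + 1))).
  by rewrite E; field; rewrite hC hp.
by rewrite addnS -natr1 natrD; field; rewrite hC hp.
Qed.

Lemma sum_multiples (g : nat -> R) (n k : nat) : (0 < n)%N ->
  \sum_(1 <= j < k.+1) (if (n %| j)%N then g j else 0) = \sum_(1 <= i < (k %/ n).+1) g (i * n)%N.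
Proof.
move=> n0; elim: k => [|k IH]; first by rewrite div0n !big_geq.
rewrite big_nat_recr//= IH divnS//.
case: ifPn => [dv|_] /=; last by rewrite addr0 add0n.
rewrite -[(_ + k %/ n)%N]/((k %/ n).+1) [RHS]big_nat_recr//=; congr (_ + g _).
by have /divnK := dv; rewrite divnS// dv add1n => ->.
Qed.

Lemma binr0 m : binr m 0 = 1.
Proof. by rewrite /binr addn0 divff// pnatr_eq0 -lt0n bin_gt0; lia. Qed.

Lemma binr_ge0 m k : 0 <= binr m k.
Proof. by rewrite divr_ge0. Qed.

(** The ratio in [binrS] is [1 - (2k + 1) / (m + k + 1)]. With the common denominator [m + K] the
    odd numbers [2k + 1] add up to a square. *)
Lemma binr_le m K k : (k <= K <= m)%N -> binr m k <= expR (- (k%:R ^+ 2 / (m%:R + K%:R))).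
Proof.
move=> /andP[kK Km]; elim: k kK => [_|k IH kK].
  by rewrite binr0 expr0n mul0r oppr0 expR0.
rewrite binrS; last by lia.
have mk : 0 < m%:R + k%:R + 1 :> R by rewrite -natrD natr1 ltr0n.
have mK : 0 < m%:R + K%:R :> R by rewrite -natrD ltr0n; lia.
rewrite (_ : - _ = - (k%:R ^+ 2 / (m%:R + K%:R)) + - ((2 * k%:R + 1) / (m%:R + K%:R))); last first.
  by rewrite -natr1; field; rewrite gt_eqF.
rewrite expRD ler_pM ?binr_ge0//.
- by rewrite divr_ge0 ?(ltW mk)// subr_ge0 ler_nat; lia.
- by apply: IH; lia.
apply: (@le_trans _ _ (1 + - ((2 * k%:R + 1) / (m%:R + k%:R + 1)))).
  by rewrite [leLHS](_ : _ = 1 - (2 * k%:R + 1) / (m%:R + k%:R + 1))//; field; rewrite gt_eqF.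
apply: (le_trans (expR_ge1Dx _)); rewrite ler_expR lerN2.
rewrite ler_wpM2l ?addr_ge0 ?mulr_ge0// lef_pV2 ?posrE// -addrA natr1 lerD2l ler_nat //.
Qed.

(** The inverse ratio is [1 + (2k + 1) / (m - k)], and [m - k >= m - K + 1] for the indices that
    occur. *)
Lemma binr_ge m K k : (k <= K <= m)%N -> expR (- (k%:R ^+ 2 / (m%:R - K%:R + 1))) <= binr m k.
Proof.
move=> /andP[kK Km]; elim: k kK => [_|k IH kK].
  by rewrite binr0 expr0n mul0r oppr0 expR0.
rewrite binrS; last by lia.
have mk : 0 < m%:R - k%:R :> R by rewrite subr_gt0 ltr_nat; lia.
have mk1 : 0 < m%:R + k%:R + 1 :> R by rewrite -natrD natr1 ltr0n.
have mK : 0 < m%:R - K%:R + 1 :> R by rewrite ltr_wpDl// subr_ge0 ler_nat.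
rewrite (_ : - _ = - (k%:R ^+ 2 / (m%:R - K%:R + 1)) + - ((2 * k%:R + 1) / (m%:R - K%:R + 1))); last first.
  by rewrite -natr1; field; rewrite gt_eqF.
rewrite expRD ler_pM ?expR_ge0//.
  by apply: IH; lia.
apply: (@le_trans _ _ (expR (- ((2 * k%:R + 1) / (m%:R - k%:R))))).
  rewrite ler_expR lerN2 ler_wpM2l ?addr_ge0 ?mulr_ge0// lef_pV2 ?posrE//.
  have : k.+1%:R <= K%:R :> R by rewrite ler_nat.
  rewrite -natr1; lra.
rewrite expRN -[leRHS]invrK lef_pV2 ?posrE ?expR_gt0 ?invr_gt0 ?divr_gt0//.
apply: le_trans (expR_ge1Dx _).
rewrite [leLHS](_ : _ = 1 + (2 * k%:R + 1) / (m%:R - k%:R))//; field.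
by rewrite !gt_eqF.
Qed.

End Bounds.

(** * Passage to the limit and the theta inversion *)

Section Theta.
Context {R : realType}.
Implicit Types lam s : R.

Definition qs s := limn (fun n => \sum_(1 <= k < n) expR (- (k%:R ^+ 2 * s))).

Lemma cvg_expRN (f : nat -> R) (l : R) : f n @[n --> \oo] --> l -> expR (- f n) @[n --> \oo] --> expR (- l).
Proof.
move=> h; apply: (@cvg_comp _ _ _ (fun n => - f n) expR _ (nbhs (- l))); first exact: cvgN.
exact: continuous_expR.
Qed.

Section Lam.
Variable lam : R.
Hypothesis lam0 : 0 < lam.

(* An odd integer close to [sqrt (m / lam)]. *)
Definition nn (m : nat) : nat := (2 * Num.truncn (Num.sqrt (m%:R / lam) / 2)).+1.
Definition ww (m : nat) : R := (nn m)%:R / Num.sqrt m%:R.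

Lemma sqrtn_cvg : (Num.sqrt m%:R)^-1 @[m --> \oo] --> (0 : R).
Proof.
apply/cvgrPdist_lt => e e0; exists (Num.truncn (e ^- 2)).+1 => // m /= hm.
have m0 : 0 < m%:R :> R by rewrite ltr0n; lia.
rewrite sub0r normrN ger0_norm ?invr_ge0 ?sqrtr_ge0//.
rewrite -[ltRHS]invrK ltf_pV2 ?posrE ?invr_gt0 ?sqrtr_gt0//.
rewrite -(ltr_pXn2r (_ : 0 < 2)%N) ?nnegrE ?sqrtr_ge0 ?invr_ge0 ?(ltW e0)// sqr_sqrtr ?(ltW m0)//.
rewrite exprVn; apply: (lt_le_trans (truncnS_gt _)); by rewrite ler_nat.
Qed.

Lemma ww_cvg : ww m @[m --> \oo] --> (Num.sqrt lam)^-1.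
Proof.
have h := sqrtn_cvg.
apply: (@cvg_sub0 _ _ _ _ _ _ (cst (Num.sqrt lam)^-1)) => //; last exact: cvg_cst.
apply: norm_cvg0; apply: (@squeeze_cvgr _ _ _ _ (cst 0) (fun m : nat => (Num.sqrt m%:R)^-1)) => //; last exact: cvg_cst.
exists 1%N => // m /= m0; rewrite normr_ge0 /=.
have sm : 0 < Num.sqrt m%:R :> R by rewrite sqrtr_gt0 ltr0n.
rewrite /ww fctE /=.
set y := Num.sqrt (m%:R / lam).
have yE : (Num.sqrt lam)^-1 = y / Num.sqrt m%:R.
  rewrite /y sqrtrM// sqrtrV ?(ltW lam0)//; field.
  by rewrite !gt_eqF// sqrtr_gt0.
rewrite yE -mulrBl normrM (@ger0_norm _ (_^-1)) ?invr_ge0 ?(ltW sm)// ler_piMl ?invr_ge0 ?(ltW sm)//.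
have y0 : 0 <= y / 2 by rewrite divr_ge0// sqrtr_ge0.
have /andP[h1 h2] := truncn_itv y0.
have -> : (nn m)%:R = 2 * (Num.truncn (y / 2))%:R + 1 :> R by rewrite /nn -(natr1 (2 * _)) natrM.
clearbody y; move: (Num.truncn _) h1 h2 => t h1; rewrite -(natr1 t) => h2.
rewrite ler_norml; apply/andP; split; lra.
Qed.

Lemma nnE (m : nat) : (0 < m)%N -> (nn m)%:R = ww m * Num.sqrt m%:R.
Proof. by move=> m0; rewrite /ww mulfVK// gt_eqF// sqrtr_gt0 ltr0n. Qed.

Lemma ww_gt0 (m : nat) : (0 < m)%N -> 0 < ww m.
Proof. by move=> m0; rewrite divr_gt0 ?ltr0n// sqrtr_gt0 ltr0n. Qed.

Lemma ww2_cvg : ww m ^+ 2 @[m --> \oo] --> lam^-1.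
Proof.
have -> : lam^-1 = (Num.sqrt lam)^-1 * (Num.sqrt lam)^-1.
  by rewrite -invfM -expr2 sqr_sqrtr// ltW.
by under eq_fun do rewrite expr2; apply: cvgM; exact: ww_cvg.
Qed.

Lemma ww2_near : \forall m \near \oo, (2 * lam)^-1 <= ww m ^+ 2 <= 2 / lam.
Proof.
have l0 : 0 < lam^-1 by rewrite invr_gt0.
have h1 : (2 * lam)^-1 < lam^-1 by rewrite invfM; lra.
have h2 : lam^-1 < 2 / lam by lra.
near=> m; apply/andP; split; apply: ltW; near: m.
  exact: (cvgr_gt _ ww2_cvg).
exact: (cvgr_lt _ ww2_cvg).
Unshelve. all: by end_near. Qed.

Definition S1 (m : nat) : R := \sum_(1 <= l < ((nn m)./2).+1) cos (pi * l%:R / (nn m)%:R) ^+ (2 * m).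
Definition S2 (m : nat) : R := \sum_(1 <= i < (m %/ nn m).+1) binr m (i * nn m).

Lemma nn_sqr (m : nat) : (0 < m)%N -> (nn m)%:R ^+ 2 = ww m ^+ 2 * m%:R :> R.
Proof. by move=> m0; rewrite nnE// exprMn sqr_sqrtr. Qed.

Lemma exp_geo (x y : R) (k : nat) : 0 <= x -> x <= y -> expR (- (k%:R ^+ 2 * y)) <= expR (- x) ^+ k.
Proof.
move=> x0 xy; rewrite -expRM_natr ler_expR mulNr lerN2 [leLHS]mulrC ler_pM//.
by rewrite -natrX ler_nat; nia.
Qed.

Lemma nn_near (K : nat) : \forall m \near \oo, (K <= nn m)%N.
Proof.
near=> m.
have m0 : (0 < m)%N by near: m; exists 1%N.
have /andP[h1 _] : (2 * lam)^-1 <= ww m ^+ 2 <= 2 / lam by near: m; exact: ww2_near.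
rewrite -(ler_nat R) -(ler_pXn2r (_ : 0 < 2)%N) ?nnegrE// nn_sqr//.
apply: (@le_trans _ _ ((2 * lam)^-1 * m%:R)); last by rewrite ler_wpM2r.
rewrite mulrC ler_pdivlMr ?mulr_gt0//.
rewrite (le_trans (ltW (truncnS_gt _)))// ler_nat; near: m.
by exists (Num.truncn (K%:R ^+ 2 * (2 * lam) : R)).+1.
Unshelve. all: by end_near. Qed.

(** [cos(pi l / n)^{2m}] is close to [exp(- m (pi l / n)^2)], and [m / n^2] tends to [lam];
    [cos x <= e^{-x^2/2}] provides the majorant. *)
Lemma S1_cvg : S1 m @[m --> \oo] --> qs (pi ^+ 2 * lam).
Proof.
(* Half of the limiting exponent, since [ww m ^+ 2] is only known to be within a factor 2 of its
   limit. *)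
pose r : R := expR (- (pi ^+ 2 * lam / 2)).
have pl : 0 < pi ^+ 2 * lam :> R by rewrite mulr_gt0 ?exprn_gt0 ?pi_gt0.
have r01 : 0 < r < 1 by rewrite expR_gt0 /= /r -expR0 ltr_expR oppr_lt0 divr_gt0.
have argE (m l : nat) : (0 < m)%N -> m%:R * (pi * l%:R / (nn m)%:R) ^+ 2 = l%:R ^+ 2 * (pi ^+ 2 / ww m ^+ 2).
  move=> m0; rewrite exprMn exprVn nn_sqr//.
  by field; rewrite !gt_eqF ?ltr0n ?ww_gt0.
have upper (m l : nat) : (0 < m)%N -> (l <= (nn m)./2)%N ->
    0 <= cos (pi * l%:R / (nn m)%:R : R) /\ cos (pi * l%:R / (nn m)%:R) ^+ (2 * m) <= expR (- (l%:R ^+ 2 * (pi ^+ 2 / ww m ^+ 2))).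
  move=> m0 ln.
  have n0 : 0 < (nn m)%:R :> R by rewrite ltr0n.
  have xb : 0 <= (pi : R) * l%:R / (nn m)%:R <= pi / 2.
    rewrite divr_ge0 ?mulr_ge0 ?pi_ge0//= -mulrA ler_wpM2l ?pi_ge0//.
    rewrite ler_pdivrMr// ler_pdivlMl// -natrM ler_nat.
    by rewrite (leq_trans (leq_mul (leqnn 2) ln))// mul2n -{2}(odd_double_half (nn m)) leq_addl.
  have c0 : 0 <= cos (pi * l%:R / (nn m)%:R) :> R.
    by apply: cos_ge0_pihalf; move: xb => /andP[? ?]; apply/andP; split; have := pi_gt0 R; lra.
  split=> //; have := cos_le_exp xb => hx.
  apply: (le_trans (_ : _ <= expR (- ((pi * l%:R / (nn m)%:R) ^+ 2 / 2)) ^+ (2 * m))).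
    by rewrite lerXn2r ?nnegrE ?expR_ge0.
  rewrite -expRM_natr ler_expR -argE// natrM mulNr lerN2.
  by move: ((_ / _) ^+ 2) => X; lra.
rewrite /S1 /qs.
have vinv : (ww m ^+ 2)^-1 @[m --> \oo] --> lam.
  rewrite -[X in _ --> X]invrK; apply: cvgV; first by rewrite invr_eq0 gt_eqF.
  exact: ww2_cvg.
have invm : (m%:R)^-1 @[m --> \oo] --> (0 : R).
  rewrite (_ : (fun m : nat => _) = (fun m : nat => (Num.sqrt m%:R)^-1 * (Num.sqrt m%:R)^-1 : R)).
    by rewrite -[X in _ --> X](mulr0 0); apply: cvgM; exact: sqrtn_cvg.
  by apply/funext => m; rewrite -invfM -expr2 sqr_sqrtr.
apply: (tannery r01).
- move=> l.
  pose A (m : nat) : R := l%:R ^+ 2 * (pi ^+ 2 / ww m ^+ 2).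
  have cA : A m @[m --> \oo] --> l%:R ^+ 2 * (pi ^+ 2 * lam).
    apply: cvgM; first exact: cvg_cst.
    by apply: cvgM; first exact: cvg_cst.
  (* At [x = pi l / n] one has [A m = m x^2] and [y m = x^2 / 2], so [1 - y m <= cos x]. *)
  pose y (m : nat) : R := A m * (m%:R)^-1 / 2.
  have cy : y m @[m --> \oo] --> (0 : R).
    rewrite (_ : 0 = l%:R ^+ 2 * (pi ^+ 2 * lam) * 0 / 2 :> R); last by rewrite mulr0 mul0r.
    by apply: cvgM; [apply: cvgM|exact: cvg_cst].
  apply: (@squeeze_cvgr _ _ _ _ (fun m => expR (- (A m / (1 - y m)))) (fun m => expR (- A m))); last exact: cvg_expRN.
  + near=> m.
    have m0 : (0 < m)%N by near: m; exists 1%N.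
    have ln : (l <= (nn m)./2)%N.
      have : (2 * l <= nn m)%N by near: m; exact: nn_near.
      lia.
    have y1 : y m < 1 by near: m; apply: (cvgr_lt _ cy).
    have [c0 ->] := upper m l m0 ln; rewrite andbT.
    have yE : y m = (pi * l%:R / (nn m)%:R) ^+ 2 / 2.
      by rewrite /y /A -argE//; field; rewrite !gt_eqF ?ltr0n.
    have y0 : 0 <= y m by rewrite yE divr_ge0 ?sqr_ge0.
    have x0 : 0 <= pi * l%:R / (nn m)%:R :> R by rewrite divr_ge0 ?mulr_ge0 ?pi_ge0.
    have h1 := cos_ge_quad x0; rewrite -yE in h1.
    have h2 := @exp_le_1B _ (y m); rewrite y0 y1 in h2.
    apply: (@le_trans _ _ (expR (- (y m / (1 - y m))) ^+ (2 * m))).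
      rewrite -expRM_natr ler_expR mulNr lerN2.
      by rewrite /y natrM; set Y := 1 - _; rewrite le_eqVlt; apply/orP; left; apply/eqP; rewrite !mulrA; field; rewrite !gt_eqF ?ltr0n// subr_gt0.
    by rewrite lerXn2r ?nnegrE ?expR_ge0 ?(le_trans _ h1) ?subr_ge0 ?(ltW y1)// (le_trans (h2 isT)).
  + apply: cvg_expRN.
    rewrite (_ : l%:R ^+ 2 * (pi ^+ 2 * lam) = l%:R ^+ 2 * (pi ^+ 2 * lam) / (1 - 0)); last by rewrite subr0 divr1.
    apply: cvgM; first exact: cA.
    apply: cvgV; first by rewrite subr0 oner_eq0.
    by apply: cvgB; first exact: cvg_cst.
- move=> k; rewrite ger0_norm ?expR_ge0//; apply: exp_geo; lra.
- near=> m => l /andP[l1 ln].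
  have m0 : (0 < m)%N by near: m; exists 1%N.
  have /andP[_ w2] : (2 * lam)^-1 <= ww m ^+ 2 <= 2 / lam by near: m; exact: ww2_near.
  have [c0 h] := upper m l m0 ln.
  rewrite ger0_norm ?exprn_ge0//; apply: (le_trans h); apply: exp_geo; first lra.
  rewrite -mulrA ler_pM2l ?exprn_gt0 ?pi_gt0//.
  by rewrite -[leLHS]invrK lef_pV2 ?posrE ?invr_gt0 ?divr_gt0 ?exprn_gt0 ?ww_gt0// invf_div.
- move=> K; near=> m.
  have : (2 * K <= nn m)%N by near: m; exact: nn_near.
  lia.
Unshelve. all: by end_near. Qed.

(** [binr m (i n)] is close to [e^{- i^2 n^2 / m}], and [n^2 / m] tends to [1 / lam]. *)
Lemma S2_cvg : S2 m @[m --> \oo] --> qs lam^-1.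
Proof.
(* A quarter of the limiting exponent: one factor 2 comes from [m + l n <= 2 m], the other from
   [ww2_near]. *)
pose r : R := expR (- (4 * lam)^-1).
have r01 : 0 < r < 1 by rewrite expR_gt0 /= /r -[ltRHS]expR0 ltr_expR oppr_lt0 invr_gt0 mulr_gt0.
have w0 : ww m * (Num.sqrt m%:R)^-1 @[m --> \oo] --> (0 : R).
  by rewrite -[X in _ --> X](mulr0 (Num.sqrt lam)^-1); apply: cvgM; [exact: ww_cvg|exact: sqrtn_cvg].
have invm : (m%:R)^-1 @[m --> \oo] --> (0 : R).
  rewrite (_ : (fun m : nat => _) = (fun m : nat => (Num.sqrt m%:R)^-1 * (Num.sqrt m%:R)^-1 : R)).
    by rewrite -[X in _ --> X](mulr0 0); apply: cvgM; exact: sqrtn_cvg.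
  by apply/funext => m; rewrite -invfM -expr2 sqr_sqrtr.
have wE (m : nat) : (0 < m)%N -> ww m * (Num.sqrt m%:R)^-1 = (nn m)%:R / m%:R.
  move=> m0; have s0 : Num.sqrt m%:R != 0 :> R by rewrite gt_eqF// sqrtr_gt0 ltr0n.
  by rewrite /ww -{3}[m%:R]sqr_sqrtr//; field.
have near_le (K : nat) : \forall m \near \oo, (K * nn m <= m)%N.
  near=> m.
  have m0 : (0 < m)%N by near: m; exists 1%N.
  rewrite -(ler_nat R) natrM -(ler_pM2r (_ : 0 < m%:R^-1)) ?invr_gt0 ?ltr0n//.
  rewrite divff ?pnatr_eq0 -?lt0n// -mulrA -wE//.
  near: m; have h : K%:R * (ww m * (Num.sqrt m%:R)^-1) @[m --> \oo] --> (0 : R).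
    by rewrite -[X in _ --> X](mulr0 K%:R); apply: cvgM; first exact: cvg_cst.
  have h2 : \forall m \near \oo, K%:R * (ww m * (Num.sqrt m%:R)^-1) < 1 by apply: (cvgr_lt _ h); exact: ltr01.
  by apply: filterS h2 => m /ltW.
rewrite /S2 /qs; apply: (tannery r01).
- move=> i.
  pose A (m : nat) : R := i%:R ^+ 2 * ww m ^+ 2.
  have cA : A m @[m --> \oo] --> i%:R ^+ 2 * lam^-1.
    by apply: cvgM; [exact: cvg_cst|exact: ww2_cvg].
  pose y (m : nat) : R := i%:R * (ww m * (Num.sqrt m%:R)^-1).
  have cy : y m @[m --> \oo] --> (0 : R).
    by rewrite -[X in _ --> X](mulr0 i%:R); apply: cvgM; first exact: cvg_cst.
  have ce (D : nat -> R) : D m @[m --> \oo] --> (1 : R) -> expR (- (A m / D m)) @[m --> \oo] --> expR (- (i%:R ^+ 2 * lam^-1)).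
    move=> cD; apply: cvg_expRN.
    by rewrite -[X in _ --> X]divr1; apply: cvgM => //; apply: cvgV.
  apply: (@squeeze_cvgr _ _ _ _ (fun m => expR (- (A m / (1 - y m + m%:R^-1)))) (fun m => expR (- (A m / (1 + y m))))).
  + near=> m.
    have m0 : (0 < m)%N by near: m; exists 1%N.
    have im : (i * nn m <= m)%N by near: m; exact: near_le.
    have y1 : y m < 1 by near: m; apply: (cvgr_lt _ cy).
    have mR : 0 < m%:R :> R by rewrite ltr0n.
    have m1 : 0 < m%:R^-1 :> R by rewrite invr_gt0.
    have yE : (i * nn m)%:R = m%:R * y m.
      by rewrite /y wE// natrM; field; rewrite gt_eqF.
    have y0 : 0 <= y m by rewrite /y wE// mulr_ge0 ?divr_ge0.
    have AE : (i * nn m)%:R ^+ 2 = A m * m%:R by rewrite natrM exprMn nn_sqr// /A mulrA.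
    have h : (i * nn m <= i * nn m <= m)%N by rewrite leqnn.
    have := @binr_ge R _ _ _ h; have := @binr_le R _ _ _ h; rewrite AE yE.
    rewrite (_ : A m * m%:R / (m%:R + _) = A m / (1 + y m)); last first.
      by field; rewrite !gt_eqF//; nra.
    rewrite (_ : A m * m%:R / (m%:R - _ + 1) = A m / (1 - y m + m%:R^-1)); first by move=> -> ->.
    move: mR m1 y1 y0; move: (A m) (m%:R : R) (y m) => a M z mR m1 y1 y0.
    field; rewrite !gt_eqF//=; nra.
  + apply: ce; rewrite -[X in _ --> X]addr0 -[X in _ --> X + _]subr0.
    by apply: cvgD => //; apply: cvgB => //; exact: cvg_cst.
  + apply: ce; rewrite -[X in _ --> X]addr0.
    by apply: cvgD => //; exact: cvg_cst.
- move=> k; rewrite ger0_norm ?expR_ge0//; apply: exp_geo; first by rewrite invr_ge0 mulr_ge0// ltW.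
  by rewrite invfM; have : 0 < lam^-1 by [rewrite invr_gt0]; lra.
- near=> m => l /andP[l1 ln].
  have m0 : (0 < m)%N by near: m; exists 1%N.
  have /andP[w2 _] : (2 * lam)^-1 <= ww m ^+ 2 <= 2 / lam by near: m; exact: ww2_near.
  have lm : (l * nn m <= m)%N by rewrite -leq_divRL//.
  rewrite ger0_norm ?binr_ge0//.
  have h : (l * nn m <= l * nn m <= m)%N by rewrite leqnn.
  apply: (le_trans (@binr_le R _ _ _ h)).
  have mR : 0 < m%:R :> R by rewrite ltr0n.
  apply: (@le_trans _ _ (expR (- (l%:R ^+ 2 * (ww m ^+ 2 / 2))))); last first.
    apply: exp_geo; first by rewrite invr_ge0 mulr_ge0// ltW.
    by move: w2; rewrite !invfM; lra.
  rewrite ler_expR lerN2 ler_pdivlMr ?ltr_wpDr ?ltr0n//.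
  have -> : (l * nn m)%:R ^+ 2 = l%:R ^+ 2 * (ww m ^+ 2 * m%:R) by rewrite natrM exprMn nn_sqr.
  have : (l * nn m)%:R <= m%:R :> R by rewrite ler_nat.
  move: ((l * nn m)%:R) (sqr_ge0 (ww m)) => X /=; move: (ww m ^+ 2) => W W0 hX.
  rewrite -mulrA ler_wpM2l ?sqr_ge0// -mulrA ler_wpM2l//.
  lra.
- move=> K; near=> m.
  have : (K * nn m <= m)%N by near: m; exact: near_le.
  by rewrite -leq_divRL// => h; exact: leqW.
Unshelve. all: by end_near. Qed.

Lemma qs_ge0 : 0 <= qs lam^-1.
Proof.
have h := S2_cvg; rewrite -(cvg_lim _ h)//; apply: limr_ge; first by apply/cvg_ex; eexists; exact: h.
by near=> n; apply: sumr_ge0 => k _; exact: binr_ge0.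
Unshelve. all: by end_near. Qed.

Lemma polya_S (m : nat) : (0 < m)%N ->
  (1 + 2 * S1 m) * 2 ^+ (2 * m) = (nn m)%:R * ('C(2 * m, m)%:R * (1 + 2 * S2 m)).
Proof.
move=> m0; have hC : 'C(2 * m, m)%:R != 0 :> R by rewrite pnatr_eq0 -lt0n bin_gt0; lia.
rewrite /S1 polya//; last by rewrite /nn /= mul2n odd_double.
congr (_ * _); rewrite mulrDr mulr1; congr (_ + _); rewrite mulrCA; congr (_ * _).
rewrite /S2 mulr_sumr.
under [RHS]eq_bigr do rewrite /binr mulrCA divff// mulr1.
by rewrite (sum_multiples (fun j => 'C(2 * m, m + j)%:R)).
Qed.

End Lam.

(* Dividing [polya] for two values of [n] of order [sqrt m] by one another
   eliminates the central binomial coefficient. *)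
Lemma theta_scaled lam lam' : 0 < lam -> 0 < lam' ->
  (1 + 2 * qs (pi ^+ 2 * lam)) * (1 + 2 * qs lam'^-1) * Num.sqrt lam =
  (1 + 2 * qs (pi ^+ 2 * lam')) * (1 + 2 * qs lam^-1) * Num.sqrt lam'.
Proof.
move=> l0 l0'.
have sq : forall l, 0 < l -> 0 < Num.sqrt l :> R by move=> l ?; rewrite sqrtr_gt0.
have key m : (0 < m)%N -> (1 + 2 * S1 lam m) * (1 + 2 * S2 lam' m) * ww lam' m =
    (1 + 2 * S1 lam' m) * (1 + 2 * S2 lam m) * ww lam m.
  move=> m0; have h1 := polya_S l0 m0; have h2 := polya_S l0' m0.
  have hC : 'C(2 * m, m)%:R != 0 :> R by rewrite pnatr_eq0 -lt0n bin_gt0; lia.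
  have h3 : 2 ^+ (2 * m) != 0 :> R by rewrite expf_neq0.
  have s0 : Num.sqrt m%:R != 0 :> R by rewrite gt_eqF// sqrtr_gt0 ltr0n.
  apply: (mulIf h3); apply: (mulIf s0); apply: (mulIf hC).
  move: h1 h2; rewrite !nnE//.
  set a := S1 _ _; set b := S2 _ _; set a' := S1 _ _; set b' := S2 _ _.
  move: (2 ^+ _) ('C(_, _)%:R) (Num.sqrt _) => P C s h1 h2.
  have e1 : (1 + 2 * a) * P * ((1 + 2 * b') * ww lam' m * s * C) = (ww lam m * s * (C * (1 + 2 * b))) * ((1 + 2 * a') * P).
    by rewrite h1 h2; ring.
  rewrite [LHS](_ : _ = (1 + 2 * a) * P * ((1 + 2 * b') * ww lam' m * s * C)); last by ring.
  by rewrite e1; ring.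
have lim (a b : R) : 0 < a -> 0 < b -> (1 + 2 * S1 a m) * (1 + 2 * S2 b m) * ww b m @[m --> \oo]
    --> (1 + 2 * qs (pi ^+ 2 * a)) * (1 + 2 * qs b^-1) * (Num.sqrt b)^-1.
  move=> a0 b0; apply: cvgM; last exact: ww_cvg.
  apply: cvgM; apply: cvgD; try exact: cvg_cst; apply: cvgM; try exact: cvg_cst.
    exact: S1_cvg.
  exact: S2_cvg.
have : (1 + 2 * qs (pi ^+ 2 * lam)) * (1 + 2 * qs lam'^-1) * (Num.sqrt lam')^-1 =
  (1 + 2 * qs (pi ^+ 2 * lam')) * (1 + 2 * qs lam^-1) * (Num.sqrt lam)^-1.
  apply: (cvg_unique _ (lim _ _ l0 l0')) => //.
  apply: cvg_trans (lim _ _ l0' l0).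
  by apply: near_eq_cvg; exists 1%N => // m /= m0; rewrite key.
move/(congr1 (fun x => x * (Num.sqrt lam * Num.sqrt lam'))).
have := sq _ l0; have := sq _ l0'; move: (Num.sqrt _) (Num.sqrt _) => a b a0 b0.
move: (1 + _) (1 + _) (1 + _) (1 + _) => p q p' q' h.
have {}h : p * q * (b * (a * a^-1)) = p' * q' * (a * (b * b^-1)).
  by move: h; lra.
by move: h; rewrite !divff ?gt_eqF// !mulr1 => h; lra.
Qed.

(** The theta series over all integers. *)
Definition Th s := 1 + 2 * qs s.

(** For [lam = x^2 / pi] and [lam' = 1 / pi] both sides of [theta_scaled] contain the positive
    factor [Th pi], which cancels. *)
Lemma Th_inversion (x : R) : 0 < x -> x * Th (pi * x ^+ 2) = Th (pi / x ^+ 2).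
Proof.
move=> x0; have p0 := pi_gt0 R.
have q0 : 0 <= qs pi.
  by rewrite -[pi]invrK; apply: qs_ge0; rewrite invr_gt0.
have := @theta_scaled (x ^+ 2 / pi) pi^-1.
rewrite divr_gt0 ?exprn_gt0// invr_gt0 p0 => /(_ isT isT).
rewrite invrK (_ : pi ^+ 2 * (x ^+ 2 / pi) = pi * x ^+ 2); last by field; lra.
rewrite (_ : pi ^+ 2 / pi = pi); last by field; lra.
rewrite invf_div sqrtrM ?sqr_ge0// sqrtr_sqr gtr0_norm//.
rewrite -/(Th _) -/(Th _) -/(Th (pi / _)) => h.
have T0 : Th pi != 0 by rewrite gt_eqF// /Th; lra.
have s0 : Num.sqrt pi^-1 != 0 :> R by rewrite gt_eqF// sqrtr_gt0 invr_gt0.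
by apply: (mulIf T0); apply: (mulIf s0); move: h; lra.
Qed.

Lemma qs_cvg s : 0 < s -> \sum_(1 <= k < n) expR (- (k%:R ^+ 2 * s)) @[n --> \oo] --> qs s.
Proof.
move=> s0; have r01 : 0 < expR (- s) < 1 by rewrite expR_gt0 -[ltRHS]expR0 ltr_expR oppr_lt0.
have dom k : `|expR (- (k%:R ^+ 2 * s))| <= expR (- s) ^+ k.
  by rewrite ger0_norm ?expR_ge0//; apply: exp_geo => //; exact: ltW.
apply: (tannery r01 (K := id)) => //.
- by move=> k; exact: cvg_cst.
- by near=> n => k _; exact: dom.
- by move=> m; exists m.
Unshelve. all: by end_near. Qed.

Lemma Dlim_Th s : 0 < s -> Dlim 1 0 0 s = (Th s - 3 * Th (9 * s)) / 2 + 1.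
Proof.
move=> s0.
have [h _] := @Dsum_cvg R 1 0 0 ltr01 (lexx _) (ltac:(by rewrite expr1n expr0n addr0)) s s0.
pose Q s n := \sum_(1 <= k < n) expR (- (k%:R ^+ 2 * s)) : R.
(* The cut-off [3 n + 1] makes the multiples of 3 a complete partial sum. *)
have DQ n : Dsum 1 0 0 (3 * n).+1 s = Q s (3 * n).+1 - 3 * Q (9 * s) n.+1.
  rewrite /Dsum (eq_bigr (fun k => expR (- (k%:R ^+ 2 * s)) + (if (3 %| k)%N then -3 * expR (- (k%:R ^+ 2 * s)) else 0))); last first.
    move=> k _; rewrite /cosexp mul0r subr0 cos0 mul1r mulr1 /a3.
    by case: ifP => _; ring.
  rewrite big_split /= (sum_multiples (fun k => -3 * expR (- (k%:R ^+ 2 * s))))//.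
  rewrite mulKn// -mulr_sumr mulNr; congr (_ - _ * _); apply: eq_bigr => k _.
  by congr (expR (- _)); rewrite natrM; ring.
have c3 : (3 * n).+1 @[n --> \oo] --> \oo.
  by apply/cvgnyPge => A; exists A => // n /= An; lia.
have c1 : n.+1 @[n --> \oo] --> \oo.
  by apply/cvgnyPge => A; exists A => // n /= An; lia.
have s9 : 0 < 9 * s by rewrite mulr_gt0.
have l1 : Dsum 1 0 0 (3 * n).+1 s @[n --> \oo] --> Dlim 1 0 0 s := cvg_comp _ _ c3 h.
have l2 : Q s (3 * n).+1 - 3 * Q (9 * s) n.+1 @[n --> \oo] --> qs s - 3 * qs (9 * s).
  apply: cvgB; first exact: (cvg_comp _ _ c3 (qs_cvg s0)).
  by apply: cvgM; [exact: cvg_cst|exact: (cvg_comp _ _ c1 (qs_cvg s9))].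
have -> : Dlim 1 0 0 s = qs s - 3 * qs (9 * s).
  apply: (cvg_unique _ l1) => //.
  by rewrite (_ : (fun n => _) = (fun n => Q s (3 * n).+1 - 3 * Q (9 * s) n.+1))//; apply/funext => n; rewrite DQ.
by rewrite /Th; field.
Qed.

Lemma kap0_Th (u : R) : kap 0 u = expR (u / 2) / 2 *
  (4 * Th (pi * expR u ^+ 2) - 3 * Th (9 * (pi * expR u ^+ 2)) - Th (pi * expR u ^+ 2 / 9)).
Proof.
have e0 := expR_gt0 u; have p0 := pi_gt0 R.
rewrite kapE.
rewrite mulr0 cos0 sin0 mul0r !Dlim_Th.
- rewrite (_ : 2 * u = u + u) ?[expR (u + u)]expRD -?expr2; last by ring.
  rewrite (_ : 9 * (pi * _ / 9) = pi * expR u ^+ 2); last by field.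
  by field.
- by rewrite divr_gt0// mulr_gt0 ?expR_gt0.
- by rewrite mulr_gt0 ?expR_gt0.
Qed.

(** In [kap0_Th] the constants of the theta series have cancelled. Inversion at [e^u] carries the
    term with coefficient 4 into itself, and inversion at [e^u / 3] and [3 e^u] exchanges the other
    two. *)
Lemma kap_even (u : R) : kap 0 (- u) = kap 0 u.
Proof.
have e0 := expR_gt0 u; have en : expR u != 0 by rewrite gt_eqF.
rewrite !kap0_Th expRN.
have h1 := Th_inversion e0.
have h2 := @Th_inversion (expR u / 3) (divr_gt0 e0 (ltr0n _ 3)).
have h3 := @Th_inversion (expR u * 3) (mulr_gt0 e0 (ltr0n _ 3)).
rewrite (_ : pi * (expR u)^-1 ^+ 2 = pi / expR u ^+ 2); last by rewrite exprVn.
rewrite (_ : 9 * (pi / expR u ^+ 2) = pi / (expR u / 3) ^+ 2); last by field.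
rewrite (_ : pi / expR u ^+ 2 / 9 = pi / (expR u * 3) ^+ 2); last by field.
rewrite -h1 -h2 -h3.
rewrite (_ : pi * (expR u / 3) ^+ 2 = pi * expR u ^+ 2 / 9); last by field.
rewrite (_ : pi * (expR u * 3) ^+ 2 = 9 * (pi * expR u ^+ 2)); last by field.
rewrite (_ : expR (- u / 2) = expR (u / 2) / expR u); last first.
  by rewrite -expRN -expRD; congr expR; field.
by field.
Qed.

End Theta.

(** * Partial sums at a zero *)

Section Nonvanishing.
Context {R : realType}.
Implicit Types (sg t u q : R).

(** Its complex Fourier transform is the gamma factor [pi^{-w/2} Gamma(w/2) / 2] at
    [w = sg + i t]. *)
Definition ks sg u := expR (sg * u) * expR (- (pi * expR (2 * u))).

Lemma ks_continuous sg : continuous (ks sg).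
Proof.
move=> u; apply: cvgM.
  by apply: (@continuous_comp _ _ _ (fun u : R => sg * u)); [exact: mulrl_continuous|exact: continuous_expR].
apply: (@continuous_comp _ _ _ (fun u : R => - (pi * expR (2 * u)))); last exact: continuous_expR.
apply: cvgN; apply: cvgM; first exact: cvg_cst.
by apply: (@continuous_comp _ _ _ (fun u : R => 2 * u)); [exact: mulrl_continuous|exact: continuous_expR].
Qed.

Lemma ks_gt0 sg u : 0 < ks sg u.
Proof. by rewrite mulr_gt0 ?expR_gt0. Qed.

Lemma ks_bound sg u : 2^-1 <= sg -> `|ks sg u| <= expR ((sg + 2^-1) ^+ 2) * expR (- `|u| / 2).
Proof.
move=> sg2; rewrite (ger0_norm (ltW (ks_gt0 _ _))) /ks -!expRD ler_expR.
have p2 : 2 <= pi :> R by exact: pi_ge2.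
have e0 := expR_gt0 (2 * u).
have [u0|u0] := leP 0 u; last first.
  rewrite ltr0_norm//; nra.
rewrite ger0_norm//.
have h1 : (1 + u) ^+ 2 <= expR (2 * u).
  rewrite (_ : expR (2 * u) = expR u ^+ 2); last by rewrite -expRM_natr mulrC.
  by rewrite lerXn2r ?nnegrE ?addr_ge0 ?expR_ge0 ?expR_ge1Dx.
have h2 : (1 + u) ^+ 2 <= pi * expR (2 * u) by nra.
nra.
Qed.

Lemma ks_integrable sg : 2^-1 <= sg -> integrableR (ks sg).
Proof.
move=> sg2; apply: (@integrableR_decay _ (expR ((sg + 2^-1) ^+ 2))); first exact: ks_continuous.
by move=> u; exact: ks_bound.
Qed.

(** The functional equation of the gamma function: the derivative of [ks sg u * cos (t u + q)]
    integrates to 0. *)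
Lemma FT_ks_rec sg t q : 2^-1 <= sg ->
  2 * pi * FT (ks (sg + 2)) t q = sg * FT (ks sg) t q + t * FT (ks sg) t (q + pi / 2).
Proof.
move=> s2; have s2' : 2^-1 <= sg + 2 by lra.
have ck := ks_continuous; have ik := ks_integrable s2; have ik' := ks_integrable s2'.
have i1 q' : integrableR (fun u => ks sg u * cos (t * u + q')) by exact: FT_integrable.
have i2 : integrableR (fun u => ks (sg + 2) u * cos (t * u + q)) by exact: FT_integrable.
have c1 (f : R -> R) q' : continuous f -> continuous (fun u => f u * cos (t * u + q')) by exact: FT_continuous.
pose F u := ks sg u * cos (t * u + q).
pose f u := (sg * (ks sg u * cos (t * u + q)) + t * (ks sg u * cos (t * u + (q + pi / 2)))) +
  (- (2 * pi)) * (ks (sg + 2) u * cos (t * u + q)).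
have iA := integrableRZ sg (i1 q); have iB := integrableRZ t (i1 (q + pi / 2)).
have iC := integrableRZ (- (2 * pi)) i2.
have : intR f = 0.
  apply: (@intR_derive _ (expR ((sg + 2^-1) ^+ 2)) F).
  - move=> u; rewrite /F /f /ks; apply: is_derive_eq; rewrite /GRing.scale /=.
    rewrite addrA (cosDpihalf (t * u + q)) (_ : (sg + 2) * u = sg * u + 2 * u); last by ring.
    by rewrite expRD; ring.
  - have cz (k : R) (g : R -> R) : continuous g -> continuous (fun u => k * g u : R).
      by move=> cg u; apply: cvgM; [exact: cvg_cst|exact: cg].
    move=> u; apply: cvgD; last exact: (cz _ _ (c1 _ q (ck (sg + 2)))).
    by apply: cvgD; [exact: (cz _ _ (c1 _ q (ck sg)))|exact: (cz _ _ (c1 _ (q + pi / 2) (ck sg)))].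
  - by apply: integrableRD => //; apply: integrableRD.
  - by move=> u; apply: le_trans (ks_bound u s2); rewrite /F normrM ler_piMr// cos_max.
rewrite /f intRD//; last exact: integrableRD.
by rewrite intRD// !intRZ// mulNr /FT => /eqP; rewrite subr_eq0 => /eqP <-.
Qed.

(** Replaces a square by exponentials [e^{2v}] and [e^{-2v}], which only shift the exponent of [ks]
    by 2. *)
Lemma sqr_le_cosh (v : R) : 4 * v ^+ 2 <= expR (2 * v) + expR (- (2 * v)) - 2.
Proof.
wlog v0 : v / 0 <= v.
  move=> h; have [/h//|/ltW v0] := leP 0 v.
  by have := h (- v); rewrite oppr_ge0 sqrrN mulrN opprK => /(_ v0); rewrite [expR (- _) + _]addrC.
have s : 2 * v <= expR v - expR (- v).
  have := @mono_dom R (fun x => expR x - expR (- x) - 2 * x) (fun x => expR x + expR (- x) - 2) 0 v v0.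
  rewrite oppr0 subrr mulr0 subr0 subr_ge0; apply.
    by move=> x _; apply: is_derive_eq; rewrite /GRing.scale /=; ring.
  move=> x _; have e0 := expR_gt0 x; rewrite expRN.
  have : expR x * (expR x)^-1 = 1 by rewrite divff ?gt_eqF.
  have : 0 < (expR x)^-1 by rewrite invr_gt0.
  have := sqr_ge0 (expR x - 1); nra.
have e (x : R) : expR (2 * x) = expR x ^+ 2 by rewrite -expRM_natr mulrC.
rewrite -mulrN !e.
have h1 : expR v * expR (- v) = 1 by rewrite -expRD subrr expR0.
rewrite (_ : _ - 2 = (expR v - expR (- v)) ^+ 2 + 2 * (expR v * expR (- v) - 1)); last by ring.
rewrite h1 subrr mulr0 addr0.
by rewrite (_ : 4 * _ = (2 * v) ^+ 2); [rewrite lerXn2r ?nnegrE// ?mulr_ge0// (le_trans _ s)// mulr_ge0|ring].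
Qed.

Lemma ks_mass_gt0 sg : 2^-1 <= sg -> 0 < intR (ks sg).
Proof.
move=> s2; pose m := expR (- (pi * expR 2)) : R.
apply: (@lt_le_trans _ _ (m * (1 - 0))); first by rewrite subr0 mulr1 expR_gt0.
apply: intR_ge_itv => //; first exact: ks_integrable.
  by move=> u; rewrite ltW// ks_gt0.
move=> u /andP[u0 u1]; rewrite -[leLHS]mul1r ler_pM ?expR_ge0//.
  by rewrite -expR0 ler_expR mulr_ge0//; lra.
by rewrite ler_expR lerN2 ler_wpM2l ?pi_ge0// ler_expR; lra.
Qed.

Lemma FT0 f : FT f 0 0 = intR f :> R.
Proof. by apply: eq_intR => u; rewrite mul0r addr0 cos0 mulr1. Qed.

Lemma ks_mass_rec sg : 2^-1 <= sg -> 2 * pi * intR (ks (sg + 2)) = sg * intR (ks sg).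
Proof. by move=> /(FT_ks_rec 0 0); rewrite mul0r addr0 !FT0. Qed.

(* [cos x >= 1 - x^2/2], with the second moment of [ks sg] around [b] computed
   from the recursion of [ks]; it is of relative size [1 / (sg - 2)]. *)
Lemma FT_ks_gt0 sg t : t ^+ 2 / 4 + 5 / 2 <= sg -> exists q, 0 < FT (ks sg) t q.
Proof.
move=> hs; have t0 := sqr_ge0 t.
have s2 : 2^-1 <= sg - 2 by lra.
have s3 : 2^-1 <= sg by lra.
have s4 : 2^-1 <= sg + 2 by lra.
have sg0 : 0 < sg by lra.
have p0 := pi_gt0 R.
(* By the recursion [sg / (2 pi)] is the mean of [e^{2u}] with respect to the weight [ks sg]. *)
pose b := ln (sg / (2 * pi)) / 2.
have eb : expR (2 * b) = sg / (2 * pi).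
  by rewrite mulrC divfK// lnK// posrE divr_gt0// mulr_gt0.
clearbody b.
exists (- (t * b)).
pose g u := (1 + t ^+ 2 / 4) * ks sg u + (- (t ^+ 2 / 8 * expR (- (2 * b)))) * ks (sg + 2) u
  + (- (t ^+ 2 / 8 * expR (2 * b))) * ks (sg - 2) u.
have i1 := integrableRZ (1 + t ^+ 2 / 4) (ks_integrable s3).
have i2 := integrableRZ (- (t ^+ 2 / 8 * expR (- (2 * b)))) (ks_integrable s4).
have i3 := integrableRZ (- (t ^+ 2 / 8 * expR (2 * b))) (ks_integrable s2).
apply: (@lt_le_trans _ _ (intR g)); last first.
  apply: le_intR.
  - by apply: integrableRD => //; exact: integrableRD.
  - by apply: FT_integrable; [exact: ks_continuous|exact: ks_integrable].
  move=> u; pose v := u - b.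
  have h1 : 1 - (t * v) ^+ 2 / 2 <= cos (t * u + - (t * b)).
    rewrite (_ : t * u + _ = t * v); last by rewrite /v; ring.
    have [x0|x0] := leP 0 (t * v); first exact: cos_ge_quad.
    by rewrite -cosN -[X in X / 2]sqrrN; apply: cos_ge_quad; rewrite oppr_ge0 ltW.
  have h2 := sqr_le_cosh v.
  rewrite (_ : g u = ks sg u * (1 - t ^+ 2 / 8 * (expR (2 * v) + expR (- (2 * v)) - 2))); last first.
    rewrite /g /ks (_ : 2 * v = 2 * u + (- (2 * b))); last by rewrite /v; ring.
    rewrite (_ : - (2 * u + _) = - (2 * u) + 2 * b); last by ring.
    rewrite [expR (2 * u + _)]expRD [expR (- (2 * u) + _)]expRD.
    rewrite (_ : (sg + 2) * u = sg * u + 2 * u); last by ring.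
    rewrite (_ : (sg - 2) * u = sg * u + (- (2 * u))); last by ring.
    by rewrite [expR (_ + 2 * u)]expRD [expR (sg * u + _)]expRD; field.
  rewrite ler_wpM2l ?(ltW (ks_gt0 _ _))//; apply: le_trans h1.
  rewrite exprMn; nra.
rewrite /g intRD//; last exact: integrableRD.
rewrite intRD// !intRZ; try exact: ks_integrable.
have r1 := ks_mass_rec s3; have r2 := ks_mass_rec s2; rewrite subrK in r2.
have m0 := ks_mass_gt0 s3.
rewrite expRN eb; clear g i1 i2 i3 eb.
move: r1 r2 m0; move: (intR (ks (sg + 2))) (intR (ks sg)) (intR (ks (sg - 2))) => a m c r1 r2 m0.
move: (pi : R) p0 r1 r2 => P P0 r1 r2.
have P2 : 2 * P != 0 by lra.
have P3 : P != 0 by lra.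
have g2 : sg - 2 != 0 by lra.
have g0 : sg != 0 by lra.
have -> : a = sg / (2 * P) * m by apply: (mulfI P2); rewrite r1; field.
have -> : c = 2 * P / (sg - 2) * m by rewrite mulrAC r2; field.
rewrite [ltRHS](_ : _ = m * (1 - t ^+ 2 / (4 * (sg - 2)))); last by field; rewrite g2 g0 P3.
rewrite mulr_gt0// subr_gt0 ltr_pdivrMr; lra.
Qed.

(** If the transform vanished at exponent [1/2] for all phases, the recursion would carry this to
    all [1/2 + 2 n], including large exponents where the weight is concentrated. *)
Lemma FT_ks_neq0 t : exists q, FT (ks 2^-1) t q != 0.
Proof.
apply: contrapT => h.
have z n q : FT (ks (2^-1 + n%:R * 2)) t q = 0.
  elim: n q => [|n IH] q.
    by rewrite mul0r addr0; apply/eqP/negPn/negP => hq; apply: h; exists q.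
  have p0 : 2 * pi != 0 :> R by rewrite mulf_neq0// gt_eqF// pi_gt0.
  have s0 : 2^-1 <= 2^-1 + n%:R * 2 :> R by rewrite lerDl mulr_ge0.
  have -> : 2^-1 + n.+1%:R * 2 = 2^-1 + n%:R * 2 + 2 :> R by rewrite -(natr1 n); ring.
  apply: (mulfI p0); rewrite FT_ks_rec// !IH.
  by rewrite !mulr0 addr0.
pose n := (Num.truncn (t ^+ 2 / 4 + 5 / 2)).+1.
have [|q] := @FT_ks_gt0 (2^-1 + n%:R * 2) t; last by rewrite z ltxx.
have := truncnS_gt (t ^+ 2 / 4 + 5 / 2); rewrite -/n => ?; have : 0 <= n%:R :> R by []. lra.
Qed.

Lemma ks_gs : ks 2^-1 = gs 1 0 0 :> (R -> R).
Proof.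
apply/funext => u; rewrite /ks /gs /wt /cosexp mul0r subr0 cos0 mulr1 mul1r.
by rewrite mulrC [_^-1 * u]mulrC mulrC.
Qed.

End Nonvanishing.

(** * From the zero of Xi to the partial sums *)

Section ZeroBound.
Context {R : realType}.
Implicit Types (t q : R).

(* Partial sums of [(1 - 3^(1 - s)) zeta(s)] at [s = 1/2 + i t], up to a phase [q]. *)
Definition Vsum t q (n : nat) : R :=
  \sum_(1 <= k < n) a3 k * expR (- (ln k%:R / 2)) * cos (q - t * ln k%:R).

Lemma FT_decomp (f : R -> R) t q : continuous f -> integrableR f ->
  FT f t q = cos q * FT f t 0 + sin q * FT f t (pi / 2).
Proof.
move=> cf fi; rewrite /FT -!intRZ; try exact: FT_integrable.
rewrite -intRD; try (apply: integrableRZ; exact: FT_integrable).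
apply: eq_intR => u; rewrite addr0 (cosDpihalf (t * u)) (cosD (t * u) q); ring.
Qed.

Let le11 : (1 : R) <= 1. Proof. exact: lexx. Qed.
Let cd : 1 ^+ 2 + 0 ^+ 2 = 1 :> R. Proof. by rewrite expr1n expr0n addr0. Qed.

(** At a zero of [Xi] each value is [3^{-1/2}] times the value at another phase. All values are
    bounded by the same integral, so iteration forces them to vanish; in complex terms,
    [1 - 3^{1/2 + i t}] is not 0. *)
Lemma FT_dlim_eq0 t q : Xi t = 0 -> FT (dlim 1 0 0) t q = 0 :> R.
Proof.
move=> X0; set f := dlim 1 0 0 : R -> R.
have cf : continuous f by exact: dlim_continuous.
have fi : integrableR f by exact: dlim_integrable.
pose z := expR (- (ln 3 / 2)) : R.
have step p : FT f t p = z * FT f t (p - t * ln 3).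
  have := FT_kap_dal hal0 t (p - t * ln 3); rewrite FT_kap0; last exact: kap_even.
  rewrite X0 mulr0 dal0 subrK -/f => h.
  have -> : FT f t (p - t * ln 3) = expR (ln 3 / 2) * FT f t p by lra.
  by rewrite mulrA -expRD addNr expR0 mul1r.
have bound n p : `|FT f t p| <= z ^+ n * intR (fun u => `|f u|).
  elim: n p => [|n IH] p; first by rewrite expr0 mul1r; exact: FT_le.
  by rewrite step normrM ger0_norm ?expR_ge0// exprS -mulrA ler_wpM2l ?expR_ge0.
have z1 : `|z| < 1.
  rewrite ger0_norm ?expR_ge0// -expR0 ltr_expR oppr_lt0 divr_gt0//.
  by apply: ln_gt0; rewrite ltr1n.
have zc : z ^+ n * intR (fun u => `|f u|) @[n --> \oo] --> (0 : R).
  rewrite -[X in _ --> X](mul0r (intR (fun u => `|f u|))).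
  by apply: cvgM; [exact: cvg_expr|exact: cvg_cst].
apply/eqP; apply: contraT; rewrite -normr_gt0 => h.
near \oo => n.
have : z ^+ n * intR (fun u => `|f u|) < `|FT f t q| by near: n; apply: (cvgr_lt _ zc).
by rewrite ltNge bound.
Unshelve. all: by end_near. Qed.

(** The whole series has transform 0, so the partial sum may be replaced by minus its tail. The tail
    is dominated by 6 times its leading damping, a shift of [gs] by [ln n] with the factor
    [n^{-1/2}]. *)
Lemma FT_dfun_small t q n : (0 < n)%N -> Xi t = 0 ->
  `|FT (dfun 1 0 0 n) t q| <= 6 * intR (gs 1 0 0) * expR (- (ln n%:R / 2)) :> R.
Proof.
move=> n0 X0; set f := dlim 1 0 0 : R -> R; set fn := dfun 1 0 0 n : R -> R.
have cf : continuous f by exact: dlim_continuous.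
have fi : integrableR f by exact: dlim_integrable.
have cfn : continuous fn by exact: dfun_continuous.
have fni : integrableR fn by apply: (integrableR_decay cfn); exact: dfun_bound.
have cg : continuous (gs 1 0 0 : R -> R) by exact: gs_continuous.
have gi : integrableR (gs 1 0 0 : R -> R) by exact: gs_integrable.
have c' : continuous (fun u => (-1) * f u) by move=> u; apply: cvgM; [exact: cvg_cst|exact: cf].
have i' := integrableRZ (-1) fi.
have -> : FT fn t q = FT (fun u => fn u + (-1) * f u) t q.
  by rewrite FTD// FTZ// FT_dlim_eq0// mulr0 addr0.
have cD : continuous (fun u => fn u + (-1) * f u) by move=> u; apply: cvgD; [exact: cfn|exact: c'].
have iD := integrableRD fni i'.
apply: (le_trans (FT_le t q cD iD)).
have cs := continuous_shift (b := ln n%:R) cg; have is_ := integrableR_shift (ln n%:R) cg gi.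
rewrite (_ : 6 * _ * _ = intR (fun u => 6 * expR (- (ln n%:R / 2)) * gs 1 0 0 (u + ln n%:R))); last first.
  by rewrite intRZ// intR_shift//; ring.
apply: le_intR; [exact: integrableR_norm|exact: integrableRZ|].
move=> u; rewrite mulN1r distrC.
apply: le_trans (@dlim_diff R 1 0 0 ltr01 le11 cd n u n0) _.
by rewrite divr1 -mulrA -gs_shift// /wt /cosexp mul0r subr0 cos0 mulr1.
Qed.

(** Division by the gamma factor with components [A] and [B]: the phases [q] and [q - pi/2] give a
    linear system of determinant [A^2 + B^2], since two quarter turns change the sign of [Vsum]. *)
Theorem Vsum_small : exists t (C : R), 0 <= C /\ forall q n, (0 < n)%N ->
  `|Vsum t q n| <= C * expR (- (ln n%:R / 2)).
Proof.
have [t X0] := Xi_zero (@kap_even R); exists t.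
have [q0] := FT_ks_neq0 t; rewrite ks_gs.
have cg : continuous (gs 1 0 0 : R -> R) by exact: gs_continuous.
have gi : integrableR (gs 1 0 0 : R -> R) by exact: gs_integrable.
set A := FT (gs 1 0 0) t 0; set B := FT (gs 1 0 0) t (pi / 2).
rewrite FT_decomp// -/A -/B => AB.
have AB0 : 0 < A ^+ 2 + B ^+ 2.
  rewrite lt_neqAle eq_sym addr_ge0 ?sqr_ge0// andbT; apply: contra AB.
  by rewrite paddr_eq0 ?sqr_ge0// !sqrf_eq0 => /andP[/eqP -> /eqP ->]; rewrite !mulr0 addr0.
have W q n : FT (dfun 1 0 0 n) t q = A * Vsum t q n + B * Vsum t (q - pi / 2) n.
  rewrite FT_dfun// /Vsum !mulr_sumr -big_split; apply: eq_bigr => k _ /=.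
  rewrite FT_decomp// -/A -/B (_ : q - pi / 2 - t * _ = q - t * ln k%:R - pi / 2); last by ring.
  by rewrite (cosBpihalf (q - t * ln k%:R)); ring.
pose K := 6 * intR (gs 1 0 0 : R -> R).
have K0 : 0 <= K.
  by rewrite mulr_ge0//; apply: intR_ge0 => u; rewrite -ks_gs ltW// ks_gt0.
exists ((`|A| + `|B|) / (A ^+ 2 + B ^+ 2) * K); split.
  by apply: mulr_ge0 => //; apply: divr_ge0; [exact: addr_ge0|exact: ltW].
move=> q n n0.
have V : Vsum t (q - pi / 2 - pi / 2) n = - Vsum t q n.
  rewrite /Vsum -sumrN; apply: eq_bigr => k _; rewrite -[RHS]mulrN; congr (_ * _).
  rewrite (_ : q - _ - _ - _ = q - t * ln k%:R - pi / 2 - pi / 2); last by ring.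
  by rewrite (cosBpihalf (q - t * ln k%:R - pi / 2)) (sinBpihalf (q - t * ln k%:R)).
have E : (A ^+ 2 + B ^+ 2) * Vsum t q n = A * FT (dfun 1 0 0 n) t q - B * FT (dfun 1 0 0 n) t (q - pi / 2).
  by rewrite !W V; ring.
rewrite -(ler_pM2l AB0) -[X in X * `|_|](ger0_norm (ltW AB0)) -normrM E.
apply: (le_trans (ler_normB _ _)); rewrite !normrM.
rewrite (_ : _ * (_ * _ * _) = `|A| * (K * expR (- (ln n%:R / 2))) + `|B| * (K * expR (- (ln n%:R / 2)))); last first.
  by field; rewrite gt_eqF.
by apply: lerD; apply: ler_wpM2l => //; exact: FT_dfun_small.
Qed.

End ZeroBound.

(** * Resonance with the Moebius function *)

Section Mobius.

Lemma primes_mulp (p i : nat) : prime p -> (0 < i)%N -> ~~ (p %| i)%N ->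
  perm_eq (primes (i * p)) (p :: primes i).
Proof.
move=> pp i0 pi; apply: uniq_perm; rewrite ?primes_uniq//=.
  by rewrite primes_uniq mem_primes pp i0 (negbTE pi).
move=> q; rewrite inE (primesM _ i0 (prime_gt0 pp)) (primes_prime pp) inE.
by rewrite orbC.
Qed.

Lemma mobius_mulp (p i : nat) : prime p -> (0 < i)%N -> mobius (i * p) = if (p %| i)%N then 0 else - mobius i.
Proof.
move=> pp i0; rewrite /mobius muln_gt0 i0 prime_gt0//=.
case: (boolP (p %| i)%N) => pi.
  case: ifPn => // /allP /(_ p).
  rewrite mem_primes pp muln_gt0 i0 prime_gt0//= dvdn_mull// => /(_ isT).
  rewrite (lognM _ i0 (prime_gt0 pp)) (logn_prime _ pp) eqxx addn1 => /eqP[]/eqP.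
  by rewrite -leqn0 leqNgt logn_gt0 mem_primes pp i0 pi.
have hp := primes_mulp pp i0 pi.
rewrite (perm_size hp) (perm_all _ hp) /= (lognM _ i0 (prime_gt0 pp)) (logn_prime _ pp) eqxx addn1 eqSS.
have -> : (logn p i == 0)%N by rewrite -leqn0 leqNgt logn_gt0 mem_primes pp i0.
rewrite /= (eq_in_all (a2 := fun q => logn q i == 1)%N); last first.
  move=> q; rewrite mem_primes => /and3P[qp _ qi].
  rewrite (lognM _ i0 (prime_gt0 pp)) (logn_prime _ pp).
  by have /negbTE -> : q != p; [apply: contraNneq pi => <-|rewrite addn0].
by case: ifP => _; rewrite ?oppr0// exprS mulN1r.
Qed.

Lemma mobius1 : mobius 1 = 1.
Proof. by []. Qed.

Context {R : realType}.

Definition mu (n : nat) : R := (mobius n)%:~R.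

Lemma mu_mulp (p i : nat) : prime p -> (0 < i)%N -> mu (i * p) = if (p %| i)%N then 0 else - mu i.
Proof. by move=> pp i0; rewrite /mu mobius_mulp//; case: ifP => _; rewrite ?mulrNz. Qed.

(** For a prime [p] dividing [m], the divisors [i] and [i p] with [i] prime to [p] cancel, and [mu]
    vanishes on the other multiples of [p]. *)
Lemma sum_mu_dvd (m N : nat) : (0 < m <= N)%N ->
  \sum_(1 <= n < N.+1) (if (n %| m)%N then mu n else 0) = (m == 1)%:R.
Proof.
move=> /andP[m0 mN]; have [->|m1] := eqVneq m 1%N.
  rewrite big_ltn ?ltnS ?(leq_trans m0)// dvdnn /mu mobius1 big1_seq ?addr0// => n.
  rewrite /= mem_index_iota => /andP[n1 _]; rewrite dvdn1.
  by case: eqP n1 => // ->.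
set p := pdiv m; have pp : prime p by apply: pdiv_prime; lia.
have pm : (p %| m)%N by exact: pdiv_dvd.
rewrite (eq_bigr (fun n => (if (p %| n)%N then (if (n %| m)%N then mu n else 0) else 0) +
   (if (p %| n)%N then 0 else (if (n %| m)%N then mu n else 0)))); last first.
  by move=> n _; case: (p %| n)%N; rewrite ?addr0 ?add0r.
rewrite big_split /= (sum_multiples (fun n => if (n %| m)%N then mu n else 0)) ?prime_gt0//.
have Np : (N %/ p <= N)%N by exact: leq_div.
(* An [i > N / p] prime to [p] cannot divide [m], since [i p] would be a divisor of [m <= N]. *)
rewrite [X in _ + X](big_cat_nat (n := (N %/ p).+1))//= [X in _ + (_ + X)]big1_seq ?addr0.
  rewrite -big_split /= big1_seq// => i /=; rewrite mem_index_iota => /andP[i1 _].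
  rewrite mu_mulp//; case: (boolP (p %| i)%N) => pi; first by rewrite if_same addr0.
  rewrite Gauss_dvd ?pm ?andbT; last by rewrite coprime_sym prime_coprime.
  by case: ifP => _; rewrite ?addr0// addNr.
move=> i /=; rewrite mem_index_iota => /andP[iN _].
case: ifPn => // pi; case: ifPn => // im; exfalso.
have : (i * p %| m)%N by rewrite Gauss_dvd ?im ?pm// coprime_sym prime_coprime.
move=> /(dvdn_leq m0) h; move: iN; rewrite ltnNge => /negP; apply.
by rewrite leq_divRL ?prime_gt0// (leq_trans h).
Qed.

(** The terms with [k n = m] are collected; their coefficient is the sum of [mu] over the divisors
    of [m]. *)
Lemma sum_mu_mult (h : nat -> R) (N : nat) : (0 < N)%N ->
  \sum_(1 <= n < N.+1) mu n * (\sum_(1 <= k < (N %/ n).+1) h (k * n)%N) = h 1.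
Proof.
move=> N0.
transitivity (\sum_(1 <= n < N.+1) \sum_(1 <= m < N.+1) (if (n %| m)%N then mu n else 0) * h m).
  apply: eq_big_nat => n /andP[n1 _]; rewrite -sum_multiples// mulr_sumr.
  by apply: eq_bigr => m _; case: ifP => _; rewrite ?mulr0 ?mul0r.
rewrite exchange_big /=.
transitivity (\sum_(1 <= m < N.+1) (m == 1)%:R * h m).
  by apply: eq_big_nat => m /andP[m1 mN]; rewrite -mulr_suml sum_mu_dvd// m1.
rewrite big_ltn// eqxx mul1r big1_seq ?addr0// => m; rewrite /= mem_index_iota => /andP[m1 _].
by case: eqP m1 => [->//|]; rewrite mul0r.
Qed.

End Mobius.

Section Resonance.
Context {R : realType}.
Implicit Types (q u : R) (n m N : nat).

Definition mert n : R := \sum_(1 <= k < n.+1) mu k.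

Local Notation lam k := (ln k%:R : R).

Variables (t C : R).
Hypotheses (C0 : 0 <= C) (VC : forall q n, (0 < n)%N -> `|Vsum t q n| <= C * expR (- (lam n / 2))).

(* [hq q (ln y)] is [H y], [Phq q N n] is [Phi (n / N)]. *)
Definition hq q u := expR (- (u / 2)) * cos (q - t * u) - cos q.
Definition Wq q m u := \sum_(1 <= k < m.+1) a3 k * hq q (lam k + u).
Definition Phq q N n := Wq q (N %/ n) (lam n - lam N).

Lemma WqE q m u : Wq q m u =
  expR (- (u / 2)) * Vsum t (q - t * u) m.+1 - cos q * \sum_(1 <= k < m.+1) a3 k.
Proof.
rewrite /Wq /Vsum !mulr_sumr -sumrB; apply: eq_bigr => k _; rewrite /hq.
rewrite (_ : - ((lam k + u) / 2) = - (u / 2) + - (lam k / 2)); last by field.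
rewrite expRD (_ : q - t * (lam k + u) = q - t * u - t * lam k); last by ring.
by ring.
Qed.

Lemma Vsum_derive q n u : is_derive u (1 : R) (fun u => Vsum t (q - t * u) n) (- t * Vsum t (q - t * u + pi / 2) n).
Proof.
rewrite /Vsum; elim: n => [|[|n] IH].
- rewrite (_ : (fun u => _) = cst 0); last by apply/funext => v; rewrite big_geq.
  by rewrite big_geq// mulr0; exact: is_derive_cst.
- rewrite (_ : (fun u => _) = cst 0); last by apply/funext => v; rewrite big_geq.
  by rewrite big_geq// mulr0; exact: is_derive_cst.
rewrite (_ : (fun u => _) = (fun u => \sum_(1 <= k < n.+1) a3 k * expR (- (lam k / 2)) * cos (q - t * u - t * lam k)
    + a3 n.+1 * expR (- (lam n.+1 / 2)) * cos (q - t * u - t * lam n.+1))); last first.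
  by apply/funext => v; rewrite big_nat_recr.
rewrite big_nat_recr//= mulrDr; apply: is_derive_eq; rewrite /GRing.scale /=.
congr (_ + _); rewrite (_ : q - t * u + pi / 2 - _ = q - t * u - t * lam n.+1 + pi / 2); last by ring.
by rewrite (cosDpihalf (q - t * u - t * lam n.+1)); ring.
Qed.

(** Twice [1/2 + |t|]: a Lipschitz constant of [hq] in the logarithmic variable where
    [e^{-u/2} <= 2]. *)
Let L := 1 + 2 * `|t|.

Lemma exp_le2 (v : R) : - (2 * ln 2) <= v -> expR (- (v / 2)) <= 2.
Proof. by move=> hv; rewrite -[leRHS]lnK ?posrE// ler_expR; lra. Qed.

Lemma hq_lip q u u' : - (2 * ln 2) <= u -> u <= u' -> `|hq q u' - hq q u| <= L * u' - L * u.
Proof.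
move=> hu uu'; apply: (@lip_dom R (hq q) (fun v => expR (- (v / 2)) * (- 2^-1 * cos (q - t * v) + t * sin (q - t * v))) (fun v => L * v) (fun=> L) u u') => //.
- by move=> x _; rewrite /hq; apply: is_derive_eq; rewrite /GRing.scale /=; field.
- by move=> x _; apply: is_derive_eq; rewrite /GRing.scale /=; ring.
move=> x /andP[ux _]; rewrite normrM (ger0_norm (expR_ge0 _)).
have h1 : expR (- (x / 2)) <= 2 by apply: exp_le2; exact: le_trans ux.
have h2 : `|- 2^-1 * cos (q - t * x) + t * sin (q - t * x)| <= 2^-1 + `|t|.
  apply: (le_trans (ler_normD _ _)); rewrite !normrM normrN (@ger0_norm _ 2^-1) ?invr_ge0//.
  by apply: lerD; rewrite ler_piMr ?cos_max ?sin_max ?invr_ge0.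
rewrite (_ : L = 2 * (2^-1 + `|t|)); last by rewrite /L; field.
by rewrite ler_pM ?expR_ge0.
Qed.

(** This is where the zero enters. The derivative involves only [Vsum] at [m + 1], of size
    [(m + 1)^{-1/2}], and this compensates [e^{-u/2}] because [(m + 1) e^u] is bounded below. *)
Lemma Wq_lip q m u u' : - (2 * ln 2) <= lam m.+1 + u -> u <= u' ->
  `|Wq q m u' - Wq q m u| <= C * L * u' - C * L * u.
Proof.
move=> hu uu'.
apply: (@lip_dom R (Wq q m) (fun v => expR (- (v / 2)) * (- 2^-1 * Vsum t (q - t * v) m.+1 + - t * Vsum t (q - t * v + pi / 2) m.+1)) (fun v => C * L * v) (fun=> C * L) u u') => //.
- move=> x _; rewrite (_ : Wq q m = (fun v => expR (- (v / 2)) * Vsum t (q - t * v) m.+1 - cos q * \sum_(1 <= k < m.+1) a3 k)); last first.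
    by apply/funext => v; rewrite WqE.
  have ? := Vsum_derive q m.+1 x.
  by apply: is_derive_eq; rewrite /GRing.scale /=; field.
- by move=> x _; apply: is_derive_eq; rewrite /GRing.scale /=; ring.
move=> x /andP[ux _]; rewrite normrM (ger0_norm (expR_ge0 _)).
have h1 : expR (- (x / 2)) * expR (- (lam m.+1 / 2)) <= 2.
  rewrite -expRD (_ : - (x / 2) + _ = - ((lam m.+1 + x) / 2)); last by field.
  by apply: exp_le2; lra.
have V q' : `|Vsum t q' m.+1| <= C * expR (- (lam m.+1 / 2)) by exact: VC.
set E := expR (- (lam _ / 2)) in V h1.
have h2 : `|- 2^-1 * Vsum t (q - t * x) m.+1 + - t * Vsum t (q - t * x + pi / 2) m.+1| <= (2^-1 + `|t|) * (C * E).
  apply: (le_trans (ler_normD _ _)); rewrite !normrM !normrN (@ger0_norm _ 2^-1) ?invr_ge0// [leRHS]mulrDl.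
  by apply: lerD; rewrite ler_wpM2l ?invr_ge0.
apply: (le_trans (ler_wpM2l (expR_ge0 _) h2)).
rewrite [leLHS](_ : _ = (2^-1 + `|t|) * C * (expR (- (x / 2)) * E)); last by ring.
rewrite (_ : C * L = (2^-1 + `|t|) * C * 2); last by rewrite /L; field.
by rewrite ler_wpM2l// mulr_ge0// addr_ge0 ?invr_ge0.
Qed.

Lemma lam_le m n : (0 < m)%N -> (m <= n)%N -> lam m <= lam n.
Proof. by move=> m0 mn; rewrite ler_ln ?posrE ?ltr0n ?(leq_trans m0)// ler_nat. Qed.

Lemma lamS n : (0 < n)%N -> lam n.+1 - lam n <= n%:R^-1.
Proof.
move=> n0; rewrite -ln_div ?posrE ?ltr0n// -natr1 mulrDl divff ?pnatr_eq0 -?lt0n// mul1r.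
have n1 : 0 < n%:R^-1 :> R by rewrite invr_gt0 ltr0n.
by have := @le_ln1Dx R n%:R^-1; apply; lra.
Qed.

Lemma lamS2 n : (0 < n)%N -> lam n.+1 - lam n <= ln 2.
Proof.
move=> n0; rewrite -ln_div ?posrE ?ltr0n// ler_ln ?posrE ?divr_gt0 ?ltr0n//.
by rewrite ler_pdivrMr ?ltr0n// -natrM ler_nat; lia.
Qed.

Lemma lamM m n : (0 < m)%N -> (0 < n)%N -> lam (m * n) = lam m + lam n.
Proof. by move=> m0 n0; rewrite natrM lnM ?posrE ?ltr0n. Qed.

(** From [n] to [n + 1] the terms with [m' < k <= m] disappear and the others are dilated by
    [(n + 1) / n]. The lost terms have [k n / N] between [n / (n + 1)] and 1, where [H] is [O(1/n)]
    because [H(1) = 0]; the dilation is handled by [Wq_lip]. *)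
Lemma Phq_var q N n : (0 < n)%N -> (n < N)%N -> `|Phq q N n - Phq q N n.+1| <= (6 + C) * L / n%:R.
Proof.
move=> n0 nN; pose u := lam n - lam N; pose u' := lam n.+1 - lam N.
pose m := (N %/ n)%N; pose m' := (N %/ n.+1)%N.
have N0 : (0 < N)%N by lia.
have mm : (m' <= m)%N by rewrite /m' /m leq_div2l.
have m'N : (N < m'.+1 * n.+1)%N by rewrite /m' ltn_ceil.
have mN : (m * n <= N)%N by rewrite leq_divM.
have L0 : 0 <= L by rewrite addr_ge0// mulr_ge0.
have hS := lamS n0; have hS2 := lamS2 n0.
have l2 : 0 <= ln 2 :> R by rewrite ln_ge0// ler1n.
have gap k : (m' < k)%N -> - (lam n.+1 - lam n) <= lam k + u.
  move=> mk; have : lam N <= lam (k * n.+1).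
    by apply: lam_le => //; apply: ltnW; apply: (leq_trans m'N); rewrite leq_mul2r mk orbT.
  rewrite lamM ?(leq_ltn_trans _ mk)// /u; lra.
have top k : (0 < k)%N -> (k <= m)%N -> lam k + u <= 0.
  move=> k0 km; have : lam (k * n) <= lam N.
    by apply: lam_le; [rewrite muln_gt0 k0|apply: leq_trans mN; rewrite leq_mul2r km orbT].
  by rewrite lamM// /u; lra.
rewrite /Phq -/u -/u' -/m -/m'.
have hA : `|Wq q m u - Wq q m' u| <= 6 * (L / n%:R).
  rewrite /Wq (big_cat_nat (n := m'.+1) (p := m.+1))//= [X in X - _]addrC addrK.
  have h := @abel_summation R a3 (fun k => hq q (lam k + u)) (fun k => - (L * (lam k + u))) 6 m'.+1 m.+1.
  have [mlt|] := ltnP m' m; last first.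
    by move=> ge; rewrite big_geq// normr0 mulr_ge0// divr_ge0.
  apply: (le_trans (h _ _ _ _)).
  - by move=> j; exact: a3_sum.
  - move=> k mk km.
    have lk : lam k <= lam k.+1 by apply: lam_le => //; exact: leq_ltn_trans mk.
    have := @hq_lip q (lam k + u) (lam k.+1 + u).
    rewrite distrC; have := gap k mk => hg.
    by move=> /(_ (ltac:(lra)) (ltac:(lra))); rewrite distrC; lra.
  - move=> k /andP[mk km].
    have := @hq_lip q (lam k + u) 0.
    have hg := gap k mk; have ht := top k (leq_ltn_trans (leq0n _) mk) km.
    move=> /(_ (ltac:(lra)) (ltac:(lra))).
    by rewrite {1}/hq mul0r oppr0 expR0 mulr0 subr0 mul1r subrr sub0r normrN mulr0 sub0r.
  - by rewrite -mulrN mulr_ge0// oppr_ge0; apply: top.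
  - rewrite ler_wpM2l// -mulrN ler_wpM2l//; have := gap _ (leqnn m'.+1); lra.
have hB : `|Wq q m' u' - Wq q m' u| <= C * (L / n%:R).
  have hg := gap _ (leqnn m'.+1).
  apply: (le_trans (@Wq_lip q m' u u' _ _)); [lra|rewrite /u /u'; have := lam_le n0 (leqnSn n); lra|].
  rewrite -mulrBr -mulrA; apply: ler_wpM2l => //; apply: ler_wpM2l => //.
  rewrite /u /u'; lra.
rewrite (_ : _ - _ = (Wq q m u - Wq q m' u) - (Wq q m' u' - Wq q m' u)); last by ring.
rewrite (le_trans (ler_normB _ _))// -mulrA mulrDl; exact: lerD.
Qed.

(** [a3] is 1 minus 3 times the indicator of the multiples of 3, so Moebius inversion applies twice,
    with the cut-offs [N] and [N / 3]. *)
Lemma sum_mu_Phq q N : (3 <= N)%N -> \sum_(1 <= n < N.+1) mu n * Phq q N n = hq q (- lam N) - 3 * hq q (lam 3 - lam N).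
Proof.
move=> N3; have N0 : (0 < N)%N by lia.
pose g k := hq q (lam k - lam N).
have Ph n : (0 < n)%N -> Phq q N n = \sum_(1 <= k < (N %/ n).+1) g (k * n)%N - 3 * \sum_(1 <= k < ((N %/ 3) %/ n).+1) g (3 * (k * n))%N.
  move=> n0; rewrite /Phq /Wq.
  rewrite (eq_big_nat _ _ (F2 := fun k => g (k * n)%N + (if (3 %| k)%N then -3 * g (k * n)%N else 0))); last first.
    move=> k /andP[k0 _]; rewrite /g lamM// /a3 [in RHS](_ : lam k + lam n - lam N = lam k + (lam n - lam N)); last by ring.
    by case: ifP => _; ring.
  rewrite big_split /= (sum_multiples (fun k => -3 * g (k * n)%N))// -mulr_sumr mulNr.
  rewrite divnAC; congr (_ - _ * _); apply: eq_bigr => k _; congr g; lia.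
have -> : \sum_(1 <= n < N.+1) mu n * Phq q N n = \sum_(1 <= n < N.+1) mu n * (\sum_(1 <= k < (N %/ n).+1) g (k * n)%N)
   - 3 * \sum_(1 <= n < N.+1) mu n * (\sum_(1 <= k < ((N %/ 3) %/ n).+1) g (3 * (k * n))%N).
  rewrite mulr_sumr -sumrB; apply: eq_big_nat => n /andP[n0 _]; rewrite Ph//; ring.
rewrite sum_mu_mult// [X in _ - 3 * X](big_cat_nat (n := (N %/ 3).+1))//=; last by rewrite ltnS leq_div.
rewrite (sum_mu_mult (fun k => g (3 * k)%N)); last by rewrite divn_gt0.
rewrite [X in _ - 3 * (_ + X)]big1_seq ?addr0.
  by rewrite /g muln1 ln1 sub0r.
move=> n /=; rewrite mem_index_iota => /andP[n1 _].
by rewrite divn_small// big_geq// mulr0.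
Qed.

Lemma Phq_NN q N : (0 < N)%N -> Phq q N N = 0.
Proof.
move=> N0; rewrite /Phq divnn N0 /Wq big_nat1 subrr ln1 addr0.
by rewrite /hq mul0r oppr0 expR0 mulr0 subr0 mul1r subrr mulr0.
Qed.

Lemma sum_mu_abel (F : nat -> R) N : \sum_(1 <= n < N.+2) mu n * F n =
  \sum_(1 <= n < N.+1) mert n * (F n - F n.+1) + mert N.+1 * F N.+1.
Proof.
elim: N => [|N IH]; first by rewrite /mert !big_nat1 big_geq// add0r.
have E : mert N.+2 = mert N.+1 + mu N.+2 by rewrite /mert [LHS]big_nat_recr.
rewrite big_nat_recr//= IH [X in _ = X + _]big_nat_recr//= E; ring.
Qed.

Lemma expR_half_ln (x : R) : 0 < x -> expR (ln x / 2) = Num.sqrt x.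
Proof.
move=> x0; apply/eqP; rewrite -(eqrXn2 (_ : 0 < 2)%N) ?expR_ge0 ?sqrtr_ge0//.
by rewrite sqr_sqrtr ?(ltW x0)// -expRM_natr divfK// lnK.
Qed.

Lemma resonance_bound N : (3 <= N)%N -> Num.sqrt N%:R <=
  2 * (4 + (6 + C) * L * \sum_(1 <= n < N) `|mert n| / n%:R).
Proof.
(* With this phase the cosine in [H(3/N)] is 1, so [3 H(3/N)] is [sqrt (3 N)] up to 3, and it
   exceeds [H(1/N)], at most [sqrt N + 1]. *)
move=> N3; pose q := t * (lam 3 - lam N).
have := sum_mu_Phq q N3.
case: N N3 @q => // N N3 q; rewrite sum_mu_abel Phq_NN// mulr0 addr0.
set S := \sum_(1 <= n < N.+1) mert n * _ => SE.
have hS : `|S| <= (6 + C) * L * \sum_(1 <= n < N.+1) `|mert n| / n%:R.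
  apply: (le_trans (ler_norm_sum _ _ _)); rewrite mulr_sumr big_nat_cond [leRHS]big_nat_cond.
  apply: ler_sum => n /andP[/andP[n0 nN] _]; rewrite normrM mulrCA; apply: ler_wpM2l => //.
  exact: Phq_var.
move: hS; set T := (6 + C) * L * _; rewrite SE.
set s := Num.sqrt N.+1%:R.
have s0 : 0 < s by rewrite sqrtr_gt0 ltr0n.
have h1 : hq q (- lam N.+1) <= s + 1.
  rewrite /hq mulNr opprK expR_half_ln ?ltr0n// -/s.
  have := cos_le1 (q - t * - lam N.+1); have := cos_geN1 q; nra.
have r3 : Num.sqrt 3 ^+ 2 = 3 :> R by rewrite sqr_sqrtr.
have r30 : 0 < Num.sqrt 3 :> R by rewrite sqrtr_gt0.
have h2 : s / Num.sqrt 3 - 1 <= hq q (lam 3 - lam N.+1).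
  rewrite /hq subrr cos0 mulr1 -mulNr opprB mulrBl expRB !expR_half_ln ?ltr0n// -/s.
  by have := cos_le1 q; lra.
have h3 : 3 * (s / Num.sqrt 3) = s * Num.sqrt 3 by rewrite -[X in X * _]r3; field; rewrite gt_eqF.
have r17 : 3 / 2 <= Num.sqrt 3 :> R by nra.
move=> h; have := ler_norm (- (hq q (- lam N.+1) - 3 * hq q (lam 3 - lam N.+1))); rewrite normrN => h4.
have : s / 2 <= s * Num.sqrt 3 - s by nra.
lra.
Qed.

End Resonance.

Theorem mertens_resonance {R : realType} : exists K : R, 0 <= K /\ forall N, (3 <= N)%N ->
  Num.sqrt N%:R <= K * (1 + \sum_(1 <= n < N) `|mert n : R| / n%:R).
Proof.
have [t [C [C0 VC]]] := @Vsum_small R.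
have L0 : 0 <= (6 + C) * (1 + 2 * `|t|) by rewrite mulr_ge0// addr_ge0// mulr_ge0.
exists (2 * (4 + (6 + C) * (1 + 2 * `|t|))); split; first by rewrite mulr_ge0// addr_ge0.
move=> N N3; apply: (le_trans (resonance_bound C0 VC N3)).
rewrite -[leRHS]mulrA; apply: ler_wpM2l => //.
have : 0 <= \sum_(1 <= n < N) `|mert n : R| / n%:R by apply: sumr_ge0 => n _; rewrite divr_ge0.
nra.
Qed.

(** * Step functions in L2 *)

Section L2Steps.
Context {R : realType}.
Local Notation mu2 := (@lebesgue_pos R).

(* No measurability is needed, unlike in [ge0_le_integral]. *)
Lemma le_ge0_integral (f g : measurableTypeR R -> \bar R) :
  (forall x, 0 <= f x)%E -> (forall x, f x <= g x)%E -> (\int[mu2]_x f x <= \int[mu2]_x g x)%E.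
Proof.
move=> f0 fg; have g0 x : (0 <= g x)%E by exact: le_trans (fg x).
rewrite !ge0_integralTE//; apply: ereal_sup_le => _ [h hf <-].
by exists h => // x; exact: le_trans (fg x).
Qed.

Lemma Lnorm2_sqr (h : R -> R) (e : R) : 0 <= e -> ('N[mu2]_2%:E [EFin \o h] <= e%:E)%E ->
  (\int[mu2]_x ((h x ^+ 2)%:E) <= (e ^+ 2)%:E)%E.
Proof.
move=> e0 hN; have -> : (\int[mu2]_x ((h x ^+ 2)%:E) = \int[mu2]_x (`|(EFin \o h) x| `^ 2))%E.
  apply: eq_integral => x _; rewrite /poweR /= powR_mulrn//.
  by rewrite real_normK ?num_real.
rewrite -powR_Lnorm//.
apply: (@le_trans _ _ (e%:E `^ 2)%E); last by rewrite poweR_EFin powR_mulrn.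
by apply: gt0_ler_poweR => //; rewrite in_itv /= ?Lnorm_ge0 ?lee_fin ?e0 ?leey.
Qed.

Lemma lebesgue_pos_itv (l r : R) : 0 <= l -> l <= r -> mu2 `]l, r[%classic = (r - l)%:E.
Proof.
move=> l0 lr; rewrite /lebesgue_pos /= /mrestr.
rewrite (_ : _ `&` _ = `]l, r[%classic); last first.
  apply/seteqP; split => [x [] //|x hx]; split=> //=.
  by move: hx; rewrite /= !in_itv /= andbT => /andP[lx _]; exact: le_lt_trans lx.
rewrite lebesgue_measure_itv /= lte_fin; case: ltP => //.
move=> rl; have -> : l = r by apply/eqP; rewrite eq_le lr rl.
by rewrite subrr.
Qed.

Section Steps.
Variables (u v f : R -> R) (K : nat) (p a : nat -> R) (b : R).
Hypotheses (mf : measurable_fun setT f)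
  (p0 : forall i, 0 <= p i) (pS : forall i, p i.+1 <= p i)
  (ua : forall i x, (i < K)%N -> p i.+1 < x < p i -> u x = a i)
  (vb : forall i x, (i < K)%N -> p i.+1 < x < p i -> v x = b).

Let J i : set R := `]p i.+1, p i[%classic.
(** Integrands assembled cell by cell from [a], [b] and [f], hence measurable; [u] and [v] enter
    through pointwise comparison only. *)
Let S (c : nat -> R -> R) (x : R) := \sum_(0 <= i < K) c i x * \1_(J i) x.

Let mJ i : measurable (J i). Proof. exact: measurable_itv. Qed.

Let p_le i j : (i <= j)%N -> p j <= p i.
Proof.
move=> /subnKC <-; elim: (j - i)%N => [|k IH]; first by rewrite addn0.
by rewrite addnS; exact: le_trans IH.
Qed.

Let J_uniq i j x : J i x -> J j x -> i = j.
Proof.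
rewrite /J /= !in_itv /= => /andP[i1 i2] /andP[j1 j2].
have [ij|ji|//] := ltngtP i j; exfalso.
  by have := lt_le_trans (lt_trans i1 j2) (p_le ij); rewrite ltxx.
by have := lt_le_trans (lt_trans j1 i2) (p_le ji); rewrite ltxx.
Qed.

Let S_le (c : nat -> R -> R) (g : R -> R) : (forall x, 0 <= g x) ->
  (forall i x, (i < K)%N -> J i x -> c i x <= g x) -> forall x, S c x <= g x.
Proof.
move=> g0 cg x; rewrite /S.
have [[i [iK iJ]]|no] := pselect (exists i, (i < K)%N /\ J i x); last first.
  rewrite big1_seq ?g0// => i /=; rewrite mem_index_iota => /andP[_ iK].
  by rewrite indicE memNset ?mulr0// => iJ; apply: no; exists i.
rewrite (bigD1_seq i) ?mem_index_iota ?iota_uniq//= big1_seq ?addr0.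
  by rewrite indicE mem_set// mulr1; exact: cg.
move=> j /andP[ji _]; rewrite indicE memNset ?mulr0// => jJ.
by rewrite (J_uniq jJ iJ) eqxx in ji.
Qed.

Let S_ge0 (c : nat -> R -> R) x : (forall i x, 0 <= c i x) -> 0 <= S c x.
Proof. by move=> c0; apply: sumr_ge0 => i _; rewrite mulr_ge0// indicE. Qed.

Let mS (c : nat -> R -> R) : (forall i, measurable_fun setT (c i)) -> measurable_fun setT (S c).
Proof.
by move=> mc; apply: measurable_sum => i; apply: measurable_funM => //; exact: measurable_indic.
Qed.

(** On each cell [(a - b)^2 <= 2 (a - f)^2 + 2 (b - f)^2], and the disjoint cells together
    contribute at most the two squared norms. *)
Lemma L2_steps (e : R) : 0 <= e ->
  ('N[mu2]_2%:E [EFin \o (u \- f)%R] <= e%:E)%E -> ('N[mu2]_2%:E [EFin \o (v \- f)%R] <= e%:E)%E ->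
  \sum_(0 <= i < K) (a i - b) ^+ 2 * (p i - p i.+1) <= 4 * e ^+ 2.
Proof.
move=> e0 /(Lnorm2_sqr e0) hu /(Lnorm2_sqr e0) hv.
pose c1 i x := (a i - f x) ^+ 2; pose c2 (i : nat) x := (b - f x) ^+ 2.
pose c3 i (x : R) := (a i - b) ^+ 2.
have mc1 i : measurable_fun setT (c1 i) by apply: measurable_funX; apply: measurable_funB.
have mc2 i : measurable_fun setT (c2 i) by apply: measurable_funX; apply: measurable_funB.
have h1 : (\int[mu2]_x (S c1 x)%:E <= (e ^+ 2)%:E)%E.
  apply: le_trans hu; apply: le_ge0_integral => x; rewrite lee_fin.
    by apply: S_ge0 => i y; exact: sqr_ge0.
  apply: (@S_le c1 (fun x => (u x - f x) ^+ 2)); first by move=> y; exact: sqr_ge0.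
  by move=> i y iK; rewrite /J /= in_itv /= => hy; rewrite (ua iK hy).
have h2 : (\int[mu2]_x (S c2 x)%:E <= (e ^+ 2)%:E)%E.
  apply: le_trans hv; apply: le_ge0_integral => x; rewrite lee_fin.
    by apply: S_ge0 => i y; exact: sqr_ge0.
  apply: (@S_le c2 (fun x => (v x - f x) ^+ 2)); first by move=> y; exact: sqr_ge0.
  by move=> i y iK; rewrite /J /= in_itv /= => hy; rewrite (vb iK hy).
have E3 : (\int[mu2]_x (S c3 x)%:E = (\sum_(0 <= i < K) (a i - b) ^+ 2 * (p i - p i.+1))%:E)%E.
  rewrite -sumEFin.
  under eq_integral do rewrite /S -sumEFin.
  rewrite ge0_integral_sum//.
  - apply: eq_bigr => i _; rewrite /c3.
    under eq_integral do rewrite EFinM.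
    rewrite ge0_integralZl_EFin ?sqr_ge0//.
    + rewrite [RHS]EFinM; congr (_ * _)%E; rewrite -lebesgue_pos_itv//.
      by rewrite integral_indic ?setIT//; exact: mJ.
    + by apply/measurable_EFinP; apply: measurable_indic; exact: mJ.
  - move=> i; apply/measurable_EFinP; apply: measurable_funM; first exact: measurable_cst.
    apply: measurable_indic; exact: mJ.
  - by move=> i x _; rewrite lee_fin mulr_ge0 ?sqr_ge0// indicE.
have : (\int[mu2]_x (S c3 x)%:E <= (2 * e ^+ 2 + 2 * e ^+ 2)%:E)%E.
  apply: (@le_trans _ _ (\int[mu2]_x (2%:E * (S c1 x)%:E + 2%:E * (S c2 x)%:E))%E).
    apply: le_ge0_integral => x.
      by rewrite lee_fin; apply: S_ge0 => i y; exact: sqr_ge0.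
    rewrite -!EFinM -EFinD lee_fin /S !mulr_sumr -big_split; apply: ler_sum => i _ /=.
    rewrite !mulrA -mulrDl ler_wpM2r ?indicE// /c1 /c2 /c3.
    have := sqr_ge0 ((a i - f x) + (b - f x)); lra.
  have m1 : measurable_fun setT (EFin \o S c1) by apply/measurable_EFinP; exact: mS.
  have m2 : measurable_fun setT (EFin \o S c2) by apply/measurable_EFinP; exact: mS.
  have g1 x : (0 <= (S c1 x)%:E)%E by rewrite lee_fin; apply: S_ge0 => i y; exact: sqr_ge0.
  have g2 x : (0 <= (S c2 x)%:E)%E by rewrite lee_fin; apply: S_ge0 => i y; exact: sqr_ge0.
  rewrite ge0_integralD//.
  - rewrite [leRHS]EFinD; apply: leeD; rewrite ge0_integralZl_EFin// [leRHS]EFinM.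
      by apply: lee_wpmul2l.
    by apply: lee_wpmul2l.
  - by move=> x _; rewrite mule_ge0// lee_fin.
  - by apply: measurable_funeM.
  - by move=> x _; rewrite mule_ge0// lee_fin.
  - by apply: measurable_funeM.
by rewrite E3 lee_fin => h; apply: (le_trans h); lra.
Qed.

End Steps.

Lemma converges_steps (u : nat -> R -> R) : converges_L2_pos u -> forall e : R, 0 < e ->
  exists n0, forall n N, (n0 <= n)%N -> (n0 <= N)%N ->
  forall (K : nat) (p a : nat -> R) (b : R), (forall i, 0 <= p i) -> (forall i, p i.+1 <= p i) ->
  (forall i x, (i < K)%N -> p i.+1 < x < p i -> u n x = a i) ->
  (forall i x, (i < K)%N -> p i.+1 < x < p i -> u N x = b) ->
  \sum_(0 <= i < K) (a i - b) ^+ 2 * (p i - p i.+1) <= e.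
Proof.
move=> [f fL cv] e e0.
have mf : measurable_fun setT f by have := sub_Lfun_mfun fL; rewrite inE.
pose d := Num.sqrt e / 2; have d0 : 0 < d by rewrite divr_gt0 ?sqrtr_gt0.
have [n0 _ hn0] : \forall n \near \oo, ('N[mu2]_2%:E [EFin \o (u n \- f)%R] < d%:E)%E.
  move/fine_cvgP: cv => [fin cv].
  have lt : \forall n \near \oo, fine ('N[mu2]_2%:E [EFin \o (u n \- f)%R])%E < d by apply: (cvgr_lt _ cv).
  by near=> n; rewrite -[ltLHS]fineK; [rewrite lte_fin; near: n|near: n].
exists n0 => n N nn NN K p a b p0 pS ua vb.
have := @L2_steps (u n) (u N) f K p a b mf p0 pS ua vb d (ltW d0) (ltW (hn0 _ nn)) (ltW (hn0 _ NN)).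
by rewrite /d exprMn sqr_sqrtr ?(ltW e0)// => h; apply: (le_trans h); lra.
Unshelve. all: by end_near. Qed.

End L2Steps.

(** * The values of B_n and F_n *)

Section Floors.
Context {R : realType}.
Implicit Types (x z : R) (n m k N : nat).

Lemma truncn_div z k : 0 <= z -> Num.truncn (z / k%:R) = (Num.truncn z %/ k)%N.
Proof.
move=> z0; case: k => [|k]; first by rewrite invr0 mulr0 truncn0 divn0.
have /andP[h1 h2] := truncn_itv z0; apply: truncn_def.
rewrite ler_pdivlMr// ltr_pdivrMr// -!natrM; apply/andP; split.
  by apply: le_trans h1; rewrite ler_nat leq_divM.
by apply: (lt_le_trans h2); rewrite ler_nat; exact: ltn_ceil.
Qed.

Lemma rhoE z : 0 <= z -> rho z = z - (Num.truncn z)%:R.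
Proof.
move=> z0; rewrite /rho; have /andP[h1 h2] := truncn_itv z0.
rewrite (@floor_def _ z (Num.truncn z)%:Z)//.
by rewrite intrD mulr1z natr1; apply/andP; split.
Qed.

Lemma mertens_div n k : mertens (n%:R / k%:R : R) = mert (n %/ k).
Proof. by rewrite /mertens truncn_div// natrK. Qed.

Definition gn n : R := \sum_(1 <= k < n.+1) mu k / k%:R.

Lemma gsum_nat n : gsum (n%:R : R) = gn n.
Proof. by rewrite /gsum natrK. Qed.

Lemma sum_mu_div n N : (0 < n <= N)%N -> \sum_(1 <= k < N.+1) mu k * (n %/ k)%:R = 1 :> R.
Proof.
move=> /andP[n0 nN]; rewrite (big_cat_nat (n := n.+1))//= [X in _ + X]big1_seq ?addr0.
  rewrite -[RHS](@sum_mu_mult R (fun=> 1) n n0); apply: eq_bigr => k _.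
  by rewrite sumr_const_nat subn1.
by move=> k /=; rewrite mem_index_iota => /andP[kn _]; rewrite divn_small// mulr0.
Qed.

Lemma invM_div x n : 1 / (n%:R * x) = x^-1 / n%:R.
Proof. by rewrite div1r invfM mulrC. Qed.

(** The correction term of [B_n] cancels the part linear in [1/x]. For [n < k <= m < 2n] the
    quotient [m / k] is 1, so the terms missing from the identity [sum mu k * (m / k) = 1] amount to
    [M(m) - M(n)]. *)
Lemma Bapprox_inner n x : (0 < n)%N -> 0 < x -> (n <= Num.truncn x^-1 < 2 * n)%N ->
  Bapprox n x = n%:R * gn n - mert n + mert (Num.truncn x^-1) - 1.
Proof.
move=> n0 x0 /andP[nm mn]; have z0 : 0 <= x^-1 by rewrite invr_ge0 ltW.
have nR : n%:R != 0 :> R by rewrite pnatr_eq0 -lt0n.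
rewrite /Bapprox gsum_nat invM_div rhoE ?divr_ge0// truncn_div//.
have -> : (Num.truncn x^-1 %/ n = 1)%N.
  by apply/eqP; rewrite eqn_leq -ltnS ltn_divLR// mn leq_divRL// mul1n.
move: nm mn; set m := Num.truncn _ => nm mn.
have -> : \sum_(1 <= k < n.+1) (mobius k)%:~R * rho (1 / (k%:R * x)) =
   x^-1 * gn n - \sum_(1 <= k < n.+1) mu k * (m %/ k)%:R :> R.
  rewrite /gn mulr_sumr -sumrB; apply: eq_bigr => k _.
  rewrite invM_div rhoE ?divr_ge0// truncn_div// -/m /mu; ring.
have : \sum_(1 <= k < n.+1) mu k * (m %/ k)%:R + (mert m - mert n) = 1 :> R.
  rewrite -[RHS](@sum_mu_div m m); last by rewrite leqnn andbT (leq_trans n0).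
  rewrite [RHS](big_cat_nat (n := n.+1))//=; congr (_ + _).
  have -> : mert m = mert n + \sum_(n.+1 <= k < m.+1) mu k :> R by rewrite /mert (big_cat_nat (n := n.+1)).
  rewrite [mert n + _]addrC addrK.
  apply: eq_big_nat => k /andP[nk km].
  have -> : (m %/ k = 1)%N; last by rewrite mulr1.
  apply/eqP; rewrite eqn_leq -ltnS ltn_divLR ?(leq_ltn_trans _ nk)//.
  by rewrite divn_gt0; [lia|exact: leq_ltn_trans nk].
move=> /(canRL (addrK _)) ->; rewrite mulr1n; field.
by rewrite nR gt_eqF.
Qed.

Lemma Bapprox_outer n x : 0 < x -> (0 < Num.truncn x^-1 < n)%N -> Bapprox n x = -1.
Proof.
move=> x0 /andP[m0 mn]; have z0 : 0 <= x^-1 by rewrite invr_ge0 ltW.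
have nR : n%:R != 0 :> R by rewrite pnatr_eq0; lia.
rewrite /Bapprox gsum_nat invM_div rhoE ?divr_ge0// truncn_div// divn_small//.
move: m0 mn; set m := Num.truncn _ => m0 mn.
have -> : \sum_(1 <= k < n.+1) (mobius k)%:~R * rho (1 / (k%:R * x)) =
   x^-1 * gn n - \sum_(1 <= k < n.+1) mu k * (m %/ k)%:R :> R.
  rewrite /gn mulr_sumr -sumrB; apply: eq_bigr => k _.
  rewrite invM_div rhoE ?divr_ge0// truncn_div// -/m /mu; ring.
rewrite sum_mu_div; last by rewrite m0 ltnW.
by field; rewrite nR gt_eqF.
Qed.

Lemma mert_diff n k : (0 < k)%N ->
  mert (n %/ k) - mert (n %/ k.+1) = \sum_(1 <= j < n.+1) (if (n %/ j == k)%N then mu j else 0) :> R.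
Proof.
move=> k0.
have M q : (0 < q)%N -> mert (n %/ q) = \sum_(1 <= j < n.+1) (if (q <= n %/ j)%N then mu j else 0) :> R.
  move=> q0; rewrite [RHS](big_cat_nat (n := (n %/ q).+1))//=; last by rewrite ltnS leq_div.
  rewrite [X in _ + X]big1_seq ?addr0.
    apply: eq_big_nat => j /andP[j0 jn]; rewrite leq_divRL// mulnC -leq_divRL//.
    by rewrite -ltnS jn.
  move=> j /=; rewrite mem_index_iota => /andP[nj _].
  by rewrite leq_divRL ?(leq_ltn_trans _ nj)// mulnC -leq_divRL// leqNgt nj.
rewrite !M// -sumrB; apply: eq_bigr => j _.
have [h|h|h] := ltngtP k (n %/ j); first by rewrite subrr.
- by rewrite subrr.
- by rewrite subr0.
Qed.

(** The coefficients of [F_n] are the sums of [mu] over the groups of [j] with a common value of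
    [n / j]. *)
Lemma sum_mert_diff n (phi : nat -> R) :
  \sum_(1 <= k < n.+1) (mert (n %/ k) - mert (n %/ k.+1)) * phi k =
  \sum_(1 <= j < n.+1) mu j * phi (n %/ j)%N.
Proof.
transitivity (\sum_(1 <= k < n.+1) \sum_(1 <= j < n.+1) (if (n %/ j == k)%N then mu j else 0) * phi k).
  by apply: eq_big_nat => k /andP[k0 _]; rewrite mert_diff// mulr_suml.
rewrite exchange_big /=; apply: eq_big_nat => j /andP[j0 jn].
rewrite (bigD1_seq (n %/ j)%N) ?iota_uniq//=; last first.
  by rewrite mem_index_iota divn_gt0// -ltnS jn ltnS leq_div.
rewrite eqxx big1 ?addr0// => k kn; rewrite eq_sym (negbTE kn) mul0r//.
Qed.

Lemma Fapprox_E n x : (0 < n)%N -> 0 < x ->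
  Fapprox n x = (Num.truncn (x^-1 / n%:R))%:R
    - \sum_(1 <= j < n.+1) mu j * (Num.truncn ((n %/ j)%:R * (x^-1 / n%:R)))%:R.
Proof.
move=> n0 x0; have z0 : 0 <= x^-1 by rewrite invr_ge0 ltW.
rewrite /Fapprox invM_div; set y := x^-1 / n%:R.
have y0 : 0 <= y by rewrite divr_ge0.
have -> : \sum_(1 <= k < n.+1) (mertens (n%:R / k%:R) - mertens (n%:R / k.+1%:R)) * rho (k%:R / (n%:R * x)) =
  \sum_(1 <= k < n.+1) (mert (n %/ k) - mert (n %/ k.+1)) * (k%:R * y - (Num.truncn (k%:R * y))%:R).
  apply: eq_bigr => k _; rewrite !mertens_div -rhoE ?mulr_ge0//.
  by rewrite /y invfM [_ * x^-1]mulrC.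
rewrite (sum_mert_diff n (fun k => k%:R * y - (Num.truncn (k%:R * y))%:R)) rhoE//.
have : \sum_(1 <= j < n.+1) mu j * (n %/ j)%:R = 1 :> R by rewrite sum_mu_div// n0 leqnn.
move=> S1; have : \sum_(1 <= j < n.+1) mu j * ((n %/ j)%:R * y) = y.
  transitivity ((\sum_(1 <= j < n.+1) mu j * (n %/ j)%:R) * y); last by rewrite S1 mul1r.
  by rewrite mulr_suml; apply: eq_bigr => j _; rewrite mulrA.
move=> S2; under eq_bigr do rewrite mulrBr.
rewrite sumrB S2; ring.
Qed.

(** Divisibility makes [N / j] exact for [j <= n], so the integer parts are those of [1 / (j x)];
    for [j > n] they are 0. What remains is [sum mu j * (m / j) = 1]. *)
Lemma Fapprox_outer N n x : 0 < x -> (0 < Num.truncn x^-1 < n)%N -> (n <= N)%N ->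
  (forall j, (0 < j <= n)%N -> (j %| N)%N) -> Fapprox N x = -1.
Proof.
move=> x0 /andP[m0 mn] nN dN; have z0 : 0 <= x^-1 by rewrite invr_ge0 ltW.
have N0 : (0 < N)%N by lia.
have NR : N%:R != 0 :> R by rewrite pnatr_eq0 -lt0n.
rewrite Fapprox_E// truncn_div// divn_small; last by lia.
move: m0 mn; set m := Num.truncn x^-1 => m0 mn.
rewrite -[RHS]sub0r -[in RHS](@sum_mu_div m N) ?m0 ?(leq_trans (ltnW mn))//.
congr (_ - _); apply: eq_big_nat => j /andP[j0 jN]; congr (_ * _%:R).
have [jn|jn] := leqP j n.
  rewrite (_ : (N %/ j)%:R * _ = x^-1 / j%:R) ?truncn_div//.
  have jR : j%:R != 0 :> R by rewrite pnatr_eq0 -lt0n.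
  have -> : N%:R = (N %/ j)%:R * j%:R :> R by rewrite -natrM divnK// dN// j0.
  have qR : (N %/ j)%:R != 0 :> R by rewrite pnatr_eq0 -lt0n divn_gt0.
  by field; rewrite qR jR gt_eqF.
rewrite [(m %/ j)%N]divn_small; last by lia.
apply: truncn_def; apply/andP; split; first by rewrite mulr_ge0// divr_ge0.
have jR : 0 < j%:R :> R by rewrite ltr0n.
have : (N %/ j)%:R * j%:R <= N%:R :> R by rewrite -natrM ler_nat leq_divM.
have /andP[_ h2] := truncn_itv z0; rewrite -/m in h2.
have h3 : x^-1 < j%:R by apply: (lt_le_trans h2); rewrite ler_nat; lia.
rewrite mulrA ltr_pdivrMr ?ltr0n// mul1r => h.
have [q0|q0] := eqVneq (N %/ j)%N 0%N; first by rewrite q0 mul0r ltr0n.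
apply: lt_le_trans h; rewrite ltr_pM2l// ltr0n lt0n//.
Qed.

(* The values of [Fapprox n] on the cells [L / (n (i + 1)) < x < L / (n i)]. *)
Definition Fstep L n i : R := 1 - \sum_(1 <= j < n.+1) mu j * (i %/ (L %/ (n %/ j)))%:R.

(** On the grid of mesh [1 / L] in [y = 1 / (n x)] the integer parts of all [q y] with [q = n / j]
    are constant, as each [q] divides [L]. *)
Lemma Fapprox_inner L n i x : (0 < n)%N -> (0 < L)%N -> 0 < x -> (forall j, (0 < j <= n)%N -> (j %| L)%N) ->
  (L <= i < 2 * L)%N -> i%:R <= L%:R * (x^-1 / n%:R) < i.+1%:R -> Fapprox n x = Fstep L n i.
Proof.
move=> n0 L0 x0 dL /andP[Li iL]; set y := x^-1 / n%:R => hy.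
have y0 : 0 <= y by rewrite divr_ge0// invr_ge0 ltW.
have LR : L%:R != 0 :> R by rewrite pnatr_eq0 -lt0n.
have ti : Num.truncn (L%:R * y) = i by exact: truncn_def.
have tq q : (0 < q)%N -> (q %| L)%N -> Num.truncn (q%:R * y) = (i %/ (L %/ q))%N.
  move=> q0 qL; have d0 : (0 < L %/ q)%N by rewrite divn_gt0// dvdn_leq.
  have -> : q%:R * y = L%:R * y / (L %/ q)%:R; last first.
    by rewrite truncn_div ?ti//; exact: mulr_ge0.
  have -> : L%:R = q%:R * (L %/ q)%:R :> R by rewrite -natrM mulnC divnK.
  by field; rewrite pnatr_eq0 -lt0n.
rewrite Fapprox_E// -/y /Fstep; congr (_ - _).
  rewrite -[y]mul1r (tq 1%N)// divn1.
  suff -> : (i %/ L = 1)%N by [].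
  by apply/eqP; rewrite eqn_leq -ltnS ltn_divLR// iL leq_divRL// mul1n.
apply: eq_big_nat => j /andP[j0 jn]; rewrite tq//; first by rewrite divn_gt0.
by apply: dL; rewrite leq_div andbT divn_gt0.
Qed.

Lemma sum_div_block (d q : nat) : (0 < d)%N ->
  2 * \sum_(d * q <= i < 2 * (d * q)) (i %/ d)%:R = d%:R * (q%:R * (3 * q%:R - 1)) :> R.
Proof.
move=> d0.
have B (a : nat) : \sum_(0 <= i < d * a) (i %/ d)%:R * 2 = d%:R * (a%:R * (a%:R - 1)) :> R.
  elim: a => [|a IH]; first by rewrite muln0 big_geq// mul0r mulr0.
  rewrite (big_cat_nat (n := (d * a)%N))//=; last by rewrite leq_mul2l leqnSn orbT.
  rewrite IH (eq_big_nat _ _ (F2 := fun=> a%:R * 2)); last first.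
    move=> i /andP[h1 h2]; congr (_%:R * _); apply/eqP.
    by rewrite eqn_leq leq_divRL// -ltnS ltn_divLR// mulnC [(_ * d)%N]mulnC h1 h2.
  rewrite sumr_const_nat (_ : (d * a.+1 - d * a = d)%N); last by lia.
  rewrite -(natr1 a) -[_ *+ d]mulr_natr; ring.
have := B (2 * q)%N; rewrite (big_cat_nat (n := (d * q)%N))//=; last by rewrite leq_mul2l; lia.
rewrite B -!mulr_suml mulnCA natrM mulrC => h; lra.
Qed.

(** For [q = n / j] the integer parts average to [(3 q - 1) / 2]. The terms in [q] add up to a
    constant by [sum mu j * (n / j) = 1], and the constants [1/2] leave [M(n)]. *)
Lemma sum_Fstep L n : (0 < n)%N -> (0 < L)%N -> (forall j, (0 < j <= n)%N -> (j %| L)%N) ->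
  2 * \sum_(L <= i < 2 * L) (Fstep L n i + 1) = L%:R * (1 + mert n).
Proof.
move=> n0 L0 dL.
have E : \sum_(L <= i < 2 * L) (Fstep L n i + 1) =
   L%:R * 2 - \sum_(1 <= j < n.+1) mu j * \sum_(L <= i < 2 * L) (i %/ (L %/ (n %/ j)))%:R.
  under [in RHS]eq_bigr do rewrite mulr_sumr.
  rewrite exchange_big /= (_ : L%:R * 2 = \sum_(L <= i < 2 * L) (1 + 1)); last first.
    by rewrite sumr_const_nat (_ : (2 * L - L = L)%N) ?mulr_natl//; lia.
  by rewrite -sumrB; apply: eq_bigr => i _; rewrite /Fstep; ring.
rewrite E mulrBr mulr_sumr.
rewrite (eq_big_nat _ _ (F2 := fun j => L%:R * (3 * (mu j * (n %/ j)%:R) - mu j))); last first.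
  move=> j /andP[j0 jn]; set q := (n %/ j)%N.
  have q0 : (0 < q)%N by rewrite divn_gt0.
  have qL : (q %| L)%N by apply: dL; rewrite q0 leq_div.
  have LE : L = ((L %/ q) * q)%N by rewrite divnK.
  have := @sum_div_block (L %/ q) q; rewrite -LE divn_gt0// dvdn_leq// => /(_ isT) h.
  rewrite mulrCA h.
  have -> : L%:R = (L %/ q)%:R * q%:R :> R by rewrite -natrM -LE.
  ring.
rewrite -mulr_sumr sumrB -mulr_sumr sum_mu_div ?n0 ?leqnn// -/(mert n); ring.
Qed.

End Floors.

(** * Smallness of the Mertens sums *)

Section Deduction.
Context {R : realType}.
Implicit Types (n m N : nat) (e : R).

Local Notation sq n := (Num.sqrt (n%:R : R)).

Lemma sq_sqr n : sq n ^+ 2 = n%:R.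
Proof. by rewrite sqr_sqrtr. Qed.

Lemma le_sq n m : (n <= m)%N -> sq n <= sq m.
Proof. by move=> nm; rewrite ler_wsqrtr// ler_nat. Qed.

Lemma sq_large (B : R) : exists n0, forall n, (n0 <= n)%N -> B <= sq n.
Proof.
exists (Num.truncn (B ^+ 2)).+1 => n hn; have [B0|B0] := leP B 0; first by rewrite (le_trans B0).
rewrite -(@ler_pXn2r _ 2) ?nnegrE ?(ltW B0)// sq_sqr.
by apply: (le_trans (ltW (truncnS_gt _))); rewrite ler_nat.
Qed.

(* Since [g n <= 7/8 n], the increments [e sqrt (g^i n)] sum to a geometric series. *)
Lemma contraction_bound (f : nat -> R) (g : nat -> nat) (e : R) n0 : 0 <= e -> (0 < n0)%N ->
  (forall n, (n0 <= n)%N -> (8 * g n <= 7 * n)%N) ->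
  (forall n, (n0 <= n)%N -> f n <= f (g n) + e * sq n) ->
  exists K, 0 <= K /\ forall n, f n <= 16 * e * sq n + K.
Proof.
move=> e0 n00 hg hf; pose K := \sum_(0 <= k < n0) `|f k|.
have K0 : 0 <= K by apply: sumr_ge0.
exists K; split => // n; elim/ltn_ind: n => n IH.
have [nn|nn] := ltnP n n0.
  rewrite -[leLHS]add0r lerD ?mulr_ge0 ?sqrtr_ge0//; apply: (le_trans (ler_norm _)).
  by rewrite /K (bigD1_seq n) ?mem_index_iota ?iota_uniq//= lerDl; apply: sumr_ge0.
have h1 := hg n nn; have gn : (g n < n)%N by lia.
apply: (le_trans (hf n nn)); have := IH _ gn.
(* [7/8 < (15/16)^2], and [16 * 15/16 + 1 = 16] closes the induction. *)
have h2 : sq (g n) <= 15 / 16 * sq n.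
  rewrite -(@ler_pXn2r _ 2) ?nnegrE ?mulr_ge0 ?divr_ge0 ?sqrtr_ge0// exprMn !sq_sqr.
  have : (8 * g n)%:R <= (7 * n)%:R :> R by rewrite ler_nat.
  rewrite !natrM; have : 0 <= n%:R :> R by []. lra.
have h3 : e * sq (g n) <= e * (15 / 16 * sq n) by rewrite ler_wpM2l.
lra.
Qed.

(** Cauchy-Schwarz in the form [2 |a| <= a^2 / s + s]. *)
Lemma sum_abs_le (a : nat -> R) K (s : R) : 0 < s ->
  \sum_(0 <= i < K) `|a i| <= (s^-1 * \sum_(0 <= i < K) a i ^+ 2 + K%:R * s) / 2.
Proof.
move=> s0; rewrite (_ : K%:R * s = \sum_(0 <= i < K) s); last by rewrite sumr_const_nat subn0 mulr_natl.
rewrite mulr_sumr -big_split mulr_suml; apply: ler_sum => i _ /=.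
rewrite ler_pdivlMr// -[a i ^+ 2]real_normK ?num_real// -subr_ge0.
rewrite (_ : _ - _ = s^-1 * (`|a i| - s) ^+ 2); first by rewrite mulr_ge0 ?sqr_ge0// invr_ge0 ltW.
by field; rewrite gt_eqF.
Qed.

Definition mert_small := forall e, 0 < e -> exists n1, forall n, (n1 <= n)%N ->
  \sum_(n <= m < 2 * n) `|mert m : R| / m%:R <= e * sq n.

Lemma mert_not_small : ~ mert_small.
Proof.
move=> small; have [K [K0 res]] := @mertens_resonance R.
(* The halving argument bounds the sum up to [N] by [16 e sqrt N] plus a constant, and
   [16 K e <= 1/4]. *)
pose e := (64 * (K + 1))^-1; have e0 : 0 < e by rewrite invr_gt0 mulr_gt0// ltr_wpDl.
have [n1 h1] := small e e0.
pose f N := \sum_(1 <= m < N) `|mert m : R| / m%:R.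
have t0 (m : nat) : 0 <= `|mert m : R| / m%:R by rewrite divr_ge0.
have [|n nn|n nn|K' [K'0 hK]] := @contraction_bound f uphalf e (2 + 2 * n1) (ltW e0).
- by [].
- have := uphalf_half n; have := odd_double_half n; case: (odd n) => /=; lia.
- have un : (n <= 2 * uphalf n)%N by have := uphalf_half n; have := odd_double_half n; case: (odd n) => /=; lia.
  have nu : (n1 <= uphalf n <= n)%N by have := uphalf_half n; have := odd_double_half n; case: (odd n) => /=; lia.
  have u1 : (0 < uphalf n)%N by lia.
  apply: (@le_trans _ _ (f (2 * uphalf n)%N)).
    rewrite /f [leRHS](big_cat_nat (n := n))//=; last by lia.
    by rewrite lerDl; apply: sumr_ge0.
  rewrite /f (big_cat_nat (n := uphalf n))//=; last by lia.
  rewrite lerD2l; move: nu => /andP[nu1 nu2].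
  by apply: (le_trans (h1 _ nu1)); rewrite ler_wpM2l ?(ltW e0)// le_sq.
have [n2 hn2] := sq_large (2 * K * (1 + K') + 1).
pose N := (3 + n2)%N; have := res N; rewrite leq_addr => /(_ isT).
have /hn2 : (n2 <= N)%N by exact: leq_addl.
have := hK N; rewrite /f.
set S := \sum_(1 <= _ < _) _ => hS hN hr.
have h2 : K * (1 + S) <= K * (1 + (16 * e * sq N + K')) by rewrite ler_wpM2l// lerD2l.
have eK : K * e <= 64^-1.
  by rewrite /e invfM mulrCA ler_piMr ?invr_ge0// ler_pdivrMr ?mul1r ?lerDl// ltr_wpDl.
have h3 : K * e * sq N <= 64^-1 * sq N by rewrite ler_wpM2r ?sqrtr_ge0.
have s0 : 0 <= sq N by exact: sqrtr_ge0.
have k0 : 0 <= K * (1 + K') by rewrite mulr_ge0// addr_ge0.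
nra.
Qed.

Lemma inv_between (x : R) n : 0 < x -> (0 < n)%N -> n.+1%:R^-1 < x < n%:R^-1 -> Num.truncn x^-1 = n.
Proof.
move=> x0 n0 /andP[h1 h2]; apply: truncn_def; apply/andP; split.
  by rewrite ltW// -[ltLHS]invrK ltf_pV2 ?posrE ?invr_gt0 ?ltr0n.
by rewrite -[ltRHS]invrK ltf_pV2 ?posrE ?invr_gt0 ?ltr0n.
Qed.

(* [Bapprox n x + 1 = cB n + M(m)] when [1/x] has integer part [m] in [n, 2n). *)
Definition cB n : R := n%:R * gn n - mert n.

Lemma B_window : converges_L2_pos (@Bapprox R) -> forall e, 0 < e -> exists n0, (0 < n0)%N /\
  forall n, (n0 <= n)%N -> \sum_(n <= m < 2 * n) `|cB n + mert m| <= e * (n%:R * sq n).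
Proof.
(* The cells have length at least [1 / (4 n^2)], so the squares add up to at most [e^2 n^2]. *)
move=> cv e e0; have [|n0 h] := converges_steps cv (e := e ^+ 2 / 4); first by rewrite divr_gt0 ?exprn_gt0.
exists n0.+1; split => // n hn; have n0' : (0 < n)%N by lia.
have s0 : 0 < sq n by rewrite sqrtr_gt0 ltr0n.
pose a i := cB n + mert (n + i)%N.
pose p i : R := (n + i)%:R^-1.
have pE i : p i - p i.+1 = ((n + i)%:R * (n + i).+1%:R)^-1.
  rewrite /p addnS -(natr1 (n + i)); have : 0 < (n + i)%:R :> R by rewrite ltr0n; lia.
  by move: (_%:R) => z z0; field; rewrite !gt_eqF// ltr_wpDl// ltW.
have pS i : p i.+1 <= p i by rewrite -subr_ge0 pE invr_ge0 mulr_ge0.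
have pin i x : p i.+1 < x < p i -> 0 < x /\ Num.truncn x^-1 = (n + i)%N.
  move=> hx; have x0 : 0 < x by move: hx => /andP[+ _]; apply: le_lt_trans; rewrite invr_ge0.
  by split => //; apply: inv_between => //; [lia|rewrite -addnS].
have := h n (2 * n)%N _ _ n p (fun i => a i - 1) (-1).
have -> : (n0 <= n)%N by lia.
have -> : (n0 <= 2 * n)%N by lia.
move=> /(_ isT isT _ pS) => {}h.
have {}h : \sum_(0 <= i < n) (a i - 1 - -1) ^+ 2 * (p i - p i.+1) <= e ^+ 2 / 4.
  apply: h.
  - by move=> i; rewrite invr_ge0.
  - move=> i x iK /pin[x0 E]; rewrite Bapprox_inner// E; first by rewrite /a /cB; ring.
    by apply/andP; split; lia.
  - by move=> i x iK /pin[x0 E]; apply: Bapprox_outer => //; rewrite E; apply/andP; split; lia.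
have h2 : \sum_(0 <= i < n) a i ^+ 2 <= 4 * n%:R ^+ 2 * (e ^+ 2 / 4).
  apply: (le_trans _ (ler_wpM2l _ h)); last by rewrite mulr_ge0// exprn_ge0.
  rewrite mulr_sumr big_nat_cond [leRHS]big_nat_cond; apply: ler_sum => i /andP[/andP[_ iK] _].
  rewrite opprK subrK pE mulrCA ler_peMr ?sqr_ge0// ler_pdivlMr ?mulr_gt0 ?ltr0n//; last by lia.
  by rewrite mul1r -natrX -!natrM ler_nat; nia.
rewrite -{1}[n]add0n big_addn (_ : (2 * n - n = n)%N); last by lia.
under eq_bigr do rewrite addnC.
apply: (le_trans (@sum_abs_le a n (e * sq n) (mulr_gt0 e0 s0))).
have h3 : (e * sq n)^-1 * (\sum_(0 <= i < n) a i ^+ 2) <= e * (n%:R * sq n).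
  apply: (le_trans (ler_wpM2l _ h2)); first by rewrite invr_ge0 mulr_ge0 ?ltW.
  move: s0 (sq_sqr n); move: (sq n) => s s0 <-; rewrite le_eqVlt; apply/orP; left; apply/eqP; field.
  by rewrite !gt_eqF.
lra.
Qed.

(** The number [cB n] is not known in advance. On the overlap of the windows of [n] and [g n] the
    same [M(m)] is close to both [- cB n] and [- cB (g n)] on average, so [cB] changes by
    [O(e sqrt n)]; iterating [g] bounds [cB] itself. *)
Lemma B_small : converges_L2_pos (@Bapprox R) -> mert_small.
Proof.
(* [66 = 1 + 64 + 1]: the window, [16 * 4] from the contraction, and the constant [K] absorbed for
   large [n]. *)
move=> cv e' e'0; pose e := e' / 66; have e0 : 0 < e by rewrite divr_gt0.
have [n0 [n00 win]] := B_window cv e0.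
(* About [3 n / 4], so the two windows share at least [n / 2] indices. *)
pose g n := (n - n %/ 4)%N.
have [|||n nn|K [K0 hK]] := @contraction_bound (fun n => `|cB n|) g (4 * e) (4 + 2 * n0).
- by rewrite mulr_ge0// ltW.
- by [].
- by move=> n nn; rewrite /g; lia.
- have gn : (g n <= n)%N by rewrite /g; lia.
  have ng : (n <= 2 * g n)%N by rewrite /g; lia.
  have g0 : (n0 <= g n)%N by rewrite /g; lia.
  have nR : 0 < n%:R :> R by rewrite ltr0n; lia.
  have nc (m : nat) : 0 <= `|cB n + mert m| by [].
  have h1 : \sum_(n <= m < 2 * g n) `|cB n + mert m| <= e * (n%:R * sq n).
    apply: (le_trans _ (win n _)); last by lia.
    rewrite [leRHS](big_cat_nat (n := (2 * g n)%N))//=; last by lia.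
    by rewrite lerDl; apply: sumr_ge0.
  have h2 : \sum_(n <= m < 2 * g n) `|cB (g n) + mert m| <= e * (n%:R * sq n).
    apply: (@le_trans _ _ (e * ((g n)%:R * sq (g n)))).
      apply: (le_trans _ (win _ g0)).
      rewrite [leRHS](big_cat_nat (n := n))//=.
      by rewrite lerDr; apply: sumr_ge0.
    by rewrite ler_wpM2l ?(ltW e0)// ler_pM ?sqrtr_ge0 ?ler_nat// le_sq.
  have h3 : (2 * g n - n)%:R * `|cB n - cB (g n)| <= 2 * (e * (n%:R * sq n)).
    rewrite mulr_natl -sumr_const_nat; apply: (@le_trans _ _ (\sum_(n <= m < 2 * g n) (`|cB n + mert m| + `|cB (g n) + mert m|))).
      apply: ler_sum => m _; rewrite (_ : cB n - _ = (cB n + mert m) - (cB (g n) + mert m)); last by ring.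
      exact: ler_normB.
    by rewrite big_split /= mulr2n mulrDl mul1r; exact: lerD.
  have h4 : n%:R / 2 <= (2 * g n - n)%:R :> R.
    by rewrite ler_pdivrMr// -natrM ler_nat /g; lia.
  have h5 : n%:R / 2 * `|cB n - cB (g n)| <= 2 * (e * (n%:R * sq n)).
    by apply: le_trans h3; rewrite ler_wpM2r.
  have h6 : `|cB n - cB (g n)| <= 4 * e * sq n.
    rewrite -(ler_pM2l (_ : 0 < n%:R / 2)) ?divr_gt0//; apply: (le_trans h5).
    by rewrite le_eqVlt; apply/orP; left; apply/eqP; field.
  have := ler_normD (cB n - cB (g n)) (cB (g n)); rewrite subrK; lra.
have [n1 hn1] := sq_large (K / e).
exists (n0 + n1)%N => n nn.
have nR : 0 < n%:R :> R by rewrite ltr0n; lia.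
have Ke : K <= e * sq n by rewrite -ler_pdivrMl// mulrC; apply: hn1; lia.
have h1 := win n (ltac:(lia)); have h2 := hK n.
apply: (@le_trans _ _ (\sum_(n <= m < 2 * n) (`|cB n + mert m| + `|cB n|) / n%:R)).
  rewrite big_nat_cond [leRHS]big_nat_cond; apply: ler_sum => m /andP[/andP[nm _] _].
  rewrite ler_pM ?invr_ge0//.
    by have := ler_normB (cB n + mert m) (cB n); rewrite addrAC subrr add0r.
  by rewrite lef_pV2 ?posrE ?ltr0n ?ler_nat//; lia.
rewrite -mulr_suml big_split /= sumr_const_nat (_ : (2 * n - n = n)%N); last by lia.
rewrite ler_pdivrMr// -[X in _ + X]mulr_natl.
have h3 : n%:R * `|cB n| <= n%:R * (16 * (4 * e) * sq n + K) by rewrite ler_wpM2l.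
have h4 : n%:R * K <= n%:R * (e * sq n) by rewrite ler_wpM2l.
have -> : e' = 66 * e by rewrite /e; field.
have : 0 <= e * (n%:R * sq n) by rewrite !mulr_ge0 ?sqrtr_ge0// ltW.
lra.
Qed.

(** The mean of [F_n + 1] over the cells is [(1 + M(n)) / 2], and Cauchy-Schwarz bounds it by the
    distance to [F_{(2n)!} = -1]. *)
Lemma F_mert : converges_L2_pos (@Fapprox R) -> forall e, 0 < e -> exists n0, (0 < n0)%N /\
  forall n, (n0 <= n)%N -> `|1 + mert n : R| <= e * sq n.
Proof.
(* The [L] cells have length at least [1 / (4 n L)], so the squares add up to at most
   [L n e^2 / 4]. *)
move=> cv e e0; have [|n0 h] := converges_steps cv (e := e ^+ 2 / 16); first by rewrite divr_gt0 ?exprn_gt0.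
exists n0.+1; split => // n hn; have n0' : (0 < n)%N by lia.
have s0 : 0 < sq n by rewrite sqrtr_gt0 ltr0n.
pose L := n`!; have L0 : (0 < L)%N by exact: fact_gt0.
have dL j : (0 < j <= n)%N -> (j %| L)%N by exact: dvdn_fact.
have nR : 0 < n%:R :> R by rewrite ltr0n.
have LR : 0 < L%:R :> R by rewrite ltr0n.
pose a i := Fstep L n (L + i) : R.
pose p i : R := L%:R / (n%:R * (L + i)%:R).
have zR i : 0 < (L + i)%:R :> R by rewrite ltr0n; lia.
have pE i : p i - p i.+1 = L%:R / (n%:R * ((L + i)%:R * (L + i).+1%:R)).
  rewrite /p addnS -(natr1 (L + i)); move: (zR i); move: ((L + i)%:R) => z z0.
  by field; rewrite !gt_eqF// ltr_wpDl// ltW.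
have pS i : p i.+1 <= p i by rewrite -subr_ge0 pE divr_ge0// !mulr_ge0.
have p0 i : 0 <= p i by rewrite divr_ge0// mulr_ge0.
have pin i x : p i.+1 < x < p i -> 0 < x /\ (L + i)%:R <= L%:R * (x^-1 / n%:R) < (L + i).+1%:R.
  move=> /andP[h1 h2]; have x0 : 0 < x by apply: le_lt_trans h1.
  split => //; have xn : 0 < n%:R * x by rewrite mulr_gt0.
  rewrite (_ : L%:R * _ = L%:R / (n%:R * x)); last by field; rewrite !gt_eqF.
  move: h1 h2; rewrite /p addnS ltr_pdivrMr ?mulr_gt0// ltr_pdivlMr ?mulr_gt0// => h1 h2.
  rewrite ler_pdivlMr// ltr_pdivrMr//; apply/andP; split; lra.
have := h n (2 * n)`! _ _ L p a (-1).
have nN : (2 * n <= (2 * n)`!)%N by rewrite dvdn_leq ?fact_gt0// dvdn_fact// leqnn andbT; lia.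
have -> : (n0 <= n)%N by lia.
have -> : (n0 <= (2 * n)`!)%N by lia.
move=> /(_ isT isT p0 pS) => {}h.
have {}h : \sum_(0 <= i < L) (a i - -1) ^+ 2 * (p i - p i.+1) <= e ^+ 2 / 16.
  apply: h.
  - move=> i x iK /pin[x0 E]; apply: (Fapprox_inner n0' L0 x0 dL) => //.
    by apply/andP; split; lia.
  - move=> i x iK /pin[x0 /andP[h1 h2]].
    have e1 : n%:R <= x^-1.
      have : L%:R <= (L + i)%:R :> R by rewrite ler_nat leq_addr.
      move=> /le_trans /(_ h1); rewrite ler_pMr// ler_pdivlMr// mul1r //.
    have e2 : x^-1 < (2 * n)%:R.
      have : (L + i).+1%:R <= (2 * L)%:R :> R by rewrite ler_nat; lia.
      move=> /(lt_le_trans h2); rewrite natrM mulrC ltr_pM2r// ltr_pdivrMr// natrM //.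
    have z0 : 0 <= x^-1 by rewrite invr_ge0 ltW.
    have /andP[t1 t2] := truncn_itv z0.
    apply: (@Fapprox_outer R _ (2 * n)) => //.
      have : n%:R < (Num.truncn x^-1).+1%:R :> R by exact: le_lt_trans t2.
      have : (Num.truncn x^-1)%:R < (2 * n)%:R :> R by exact: le_lt_trans e2.
      by rewrite !ltr_nat ltnS => h3 h4; rewrite h3 (leq_trans n0' h4).
    by move=> j hj; exact: dvdn_fact.
have h2 : \sum_(0 <= i < L) (a i + 1) ^+ 2 <= 4 * (L%:R * n%:R) * (e ^+ 2 / 16).
  apply: (le_trans _ (ler_wpM2l _ h)); last by rewrite !mulr_ge0.
  rewrite mulr_sumr big_nat_cond [leRHS]big_nat_cond; apply: ler_sum => i /andP[/andP[_ iK] _].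
  rewrite opprK pE [leRHS]mulrCA ler_peMr ?sqr_ge0// [leRHS]mulrA ler_pdivlMr ?mulr_gt0//.
  rewrite mul1r -!natrM ler_nat.
  have : ((L + i) * (L + i).+1 <= 4 * (L * L))%N by nia.
  by move=> hh; rewrite mulnA [(4 * (L * n))%N]mulnA; nia.
have h3 := @sum_abs_le (fun i => a i + 1) L (e * sq n / 2) (divr_gt0 (mulr_gt0 e0 s0) (ltr0n _ 2)).
have h4 : (e * sq n / 2)^-1 * (\sum_(0 <= i < L) (a i + 1) ^+ 2) <= L%:R * (e * sq n / 2).
  apply: (le_trans (ler_wpM2l _ h2)); first by rewrite invr_ge0 divr_ge0// mulr_ge0 ?ltW.
  rewrite -[X in 4 * (_ * X)]sq_sqr le_eqVlt; apply/orP; left; apply/eqP; field.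
  by rewrite !gt_eqF.
have := @sum_Fstep R L n n0' L0 dL.
rewrite -[X in \sum_(X <= _ < _) _]add0n big_addn mul2n -addnn addnK.
under eq_bigr do rewrite addnC -/(a _).
move=> E; have h5 : `|\sum_(0 <= i < L) (a i + 1)| <= \sum_(0 <= i < L) `|a i + 1| by exact: ler_norm_sum.
rewrite -(ler_pM2l LR) -[X in X * `|_|](gtr0_norm LR) -normrM -E normrM (@ger0_norm _ 2)//.
move: h3 h4 h5; move: (\sum_(0 <= i < L) `|_|) (`|\sum_(0 <= i < L) _|) => u v; lra.
Qed.

Lemma F_small : converges_L2_pos (@Fapprox R) -> mert_small.
Proof.
(* One factor 2 absorbs the 1 in [1 + M(m)], the other compares [sqrt m] with [sqrt n]. *)
move=> cv e' e'0; pose e := e' / 4; have e0 : 0 < e by rewrite divr_gt0.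
have [n0 [n00 win]] := F_mert cv e0.
have [n1 hn1] := sq_large e^-1.
exists (n0 + n1)%N => n nn.
have nR : 0 < n%:R :> R by rewrite ltr0n; lia.
apply: (@le_trans _ _ (\sum_(n <= m < 2 * n) (e' * sq n) / n%:R)).
  rewrite big_nat_cond [leRHS]big_nat_cond; apply: ler_sum => m /andP[/andP[nm mn] _].
  rewrite ler_pM ?invr_ge0//; last by rewrite lef_pV2 ?posrE ?ltr0n ?ler_nat//; lia.
  have h1 := win m (ltac:(lia)).
  have h2 : 1 <= e * sq m by rewrite -ler_pdivrMl// mulr1; apply: hn1; lia.
  have h3 : sq m <= 2 * sq n.
    rewrite -(@ler_pXn2r _ 2) ?nnegrE ?mulr_ge0 ?sqrtr_ge0// exprMn !sq_sqr -natrX -natrM ler_nat; lia.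
  have E : e' = 4 * e by rewrite /e; field.
  have h4 : e * sq m <= e * (2 * sq n) by rewrite ler_wpM2l ?(ltW e0).
  by move: h1; rewrite !ler_norml E => /andP[? ?]; apply/andP; split; lra.
rewrite sumr_const_nat (_ : (2 * n - n = n)%N); last by lia.
by rewrite -[leLHS]mulr_natr divfK// gt_eqF.
Qed.

End Deduction.

Theorem proposition4p6 (R : realType) :
  ~ converges_L2_pos (@Bapprox R) /\ ~ converges_L2_pos (@Fapprox R).
Proof.
by split => cv; apply: (@mert_not_small R); [exact: B_small|exact: F_small].
Qed.
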